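(* Let $\theta=(\theta_j)_{j\ge1}$ be a sequence of nonnegative weights defining a generalized Ewens measure $\mathbb{P}$ on $S_n$, and let $g_\theta(t)=\sum_{k\ge1}\frac{\theta_k}{k}t^k$. Suppose that $g=g_\theta$ is $\log$-admissible with radius of convergence $\rho$ and associated functions $a,b$. For $x>0$ let $r_x$ be the unique solution in $[0,\rho)$ of $a(r)=x$, and suppose that for each $2\le k\le4$ there is a constant $C$ with $$\left|r_x^{(k)}x^k\right|\le C\left|r_x^{(k-1)}x^{k-1}\right|\quad\text{for all }x\text{ sufficiently large},$$ where $r_x^{(k)}$ is the $k$-th derivative of $x\mapsto r_x$. Put $\eta_1(x)=-x\,r_x'/r_x$. Then there are functions $\mu_n$ and $\sigma_n$ such that $$\frac{K_{0n}-\mu_n}{\sigma_n}\stackrel{d}{\longrightarrow}N(0,1)\qquad(n\to\infty),$$ where $\mu_n,\sigma_n$ satisfy the asymptotics $$\mu_n=g(r_n)(1+o(1))$$ and $$\sigma_n^2=\left(g(r_n)+n\eta_1(n)\right)(1+o(1)).$$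
   Context: Weighted random permutations (generalized Ewens measure). For $\sigma\in S_n$ let $c_j(\sigma)$ be the number of cycles of length $j$ in the disjoint cycle decomposition of $\sigma$ (fixed points are cycles of length 1), and $K_{0n}(\sigma)=\sum_{j=1}^nc_j(\sigma)$. Given weights $\theta_j\ge0$, the measure on $S_n$ is $\mathbb{P}(\sigma)=\frac{1}{h_nn!}\prod_{j=1}^n\theta_j^{c_j(\sigma)}$, where $h_n$ is the normalization constant making this a probability measure (defined whenever $\frac1{n!}\sum_{\sigma\in S_n}\prod_j\theta_j^{c_j(\sigma)}>0$). Definition ($\log$-admissible). Let $g(t)=\sum_{n\ge 0}g_nt^n$ with $g_n\ge 0$ have radius of convergence $\rho>0$. It is $\log$-admissible if there exist functions $a,b:[0,\rho)\to[0,\infty)$, $\delta:[0,\rho)\to(0,\pi/2)$ and $R:[0,\rho)\times(-\pi/2,\pi/2)\to\mathbb{C}$ such that: (1) (approximation) for all $|\varphi|\le\delta(r)$, $g(re^{i\varphi})=g(r)+i\varphi a(r)-\frac{\varphi^2}{2}b(r)+R(r,\varphi)$, where $R(r,\varphi)=o(\varphi^3\delta(r)^{-3})$ uniformly, i.e. $|R(r,\varphi)|\le\epsilon(r)|\varphi|^3\delta(r)^{-3}$ for some function $\epsilon:[0,\rho)\to[0,\infty)$ with $\epsilon(r)\to0$ as $r\to\rho$; (2) (divergence) $a(r)\to\infty$, $b(r)\to\infty$ and $\delta(r)\to0$ as $r\to\rho$; (3) (width of convergence) for every $\epsilon>0$, $\epsilon\,\delta(r)^2b(r)-\log b(r)\to\infty$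 as $r\to\rho$; (4) (monotonicity) for all $\varphi\in[-\pi,\pi]$ with $|\varphi|>\delta(r)$, $\Re g(re^{i\varphi})\le\Re g(re^{\pm i\delta(r)})$. The associated functions are then $a(r)=rg'(r)$ and $b(r)=rg'(r)+r^2g''(r)$; $a$ is strictly increasing and real analytic on $[0,\rho)$ from $0$ to $\infty$, so $r_x$ is well defined and is a real analytic function of $x$.
   Formalization: The formal theorem also assumes that some weight θ_j with j ≥ 2 is nonzero; this excludes only g(t) = θ_1 t, which meets all stated hypotheses (ρ = ∞) but has K_{0n} = n almost surely and g(r_n) + nη_1(n) = 0, so no normal limit exists. *)

(* Defs.v *)
From HB Require Import structures.
From mathcomp Require Import all_boot all_order all_algebra all_fingroup.
From mathcomp Require Import complex.
From mathcomp Require Import all_classical all_reals all_analysis.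

Set Implicit Arguments.
Unset Strict Implicit.
Unset Printing Implicit Defensive.

Import Order.TTheory GRing.Theory Num.Theory.
Import numFieldNormedType.Exports.

Local Open Scope classical_set_scope.
Local Open Scope complex_scope.
Local Open Scope ring_scope.

(** * Cycle counts and the generalized Ewens measure *)

(* [porbits s] includes the fixed points of [s] as singleton orbits. *)
Definition cycle_count n (j : nat) (s : 'S_n) : nat :=
  #|[set C in porbits s | #|C| == j]|.

Definition total_cycles n (s : 'S_n) : nat :=
  (\sum_(1 <= j < n.+1) cycle_count j s)%N.

(* Weights are indexed by the cycle lengths j >= 1; [theta 0] is never used. *)
Definition ewens_weight (R : realType) (theta : nat -> R) n (s : 'S_n) : R :=
  \prod_(1 <= j < n.+1) theta j ^+ cycle_count j s.

Definition ewens_h (R : realType) (theta : nat -> R) (n : nat) : R :=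
  (n`!%:R)^-1 * \sum_(s : 'S_n) ewens_weight theta s.

(* This is a probability measure on 'S_n exactly when [0 < ewens_h theta n];
   it is the zero measure when [ewens_h theta n = 0], since [0^-1 = 0]. *)
Definition ewens_prob (R : realType) (theta : nat -> R) n (A : {set 'S_n}) : R :=
  \sum_(s in A) ewens_weight theta s / (ewens_h theta n * n`!%:R).

(* Convergence in distribution of laws on the real line with distribution
   functions [F n] to [mu]: convergence of the distribution functions at every
   continuity point of the limiting one. *)
Definition cvg_in_distribution (R : realType) (F : nat -> R -> R)
    (mu : set R -> \bar R) : Prop :=
  forall x : R, mu [set x] = 0%E ->
    (F n x)%:E @[n --> \oo] --> mu `]-oo, x]%classic.

(** * Power series *)

Definition power_sum (K : numFieldType) (c : nat -> K) (z : K) : K :=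
  limn (series (fun k => c k * z ^+ k : K^o)).

(* Possibly [+oo]: entire functions are allowed. *)
Definition cvg_radius (R : realType) (c : nat -> R) : \bar R :=
  ereal_sup [set r%:E | r in [set r : R | 0 <= r /\ cvgn (pseries c r)]].

Definition in_range (R : realType) (rho : \bar R) (r : R) : Prop :=
  0 <= r /\ (r%:E < rho)%E.

(* The filter "r -> rho, r < rho"; the last branch is a dummy value, since a
   radius of convergence is nonnegative. *)
Definition to_radius (R : realType) (rho : \bar R) : set_system R :=
  match rho with
  | x%:E => at_left x
  | +oo%E => pinfty_nbhs R
  | -oo%E => ninfty_nbhs R
  end.

Definition polar (R : realType) (r phi : R) : R[i] :=
  (r * cos phi) +i* (r * sin phi).

Definition gR (R : realType) (c : nat -> R) (r : R) : R := power_sum c r.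

Definition gC (R : realType) (c : nat -> R) (z : R[i]) : R[i] :=
  power_sum (fun k => (c k)%:C) z.

(** * log-admissibility *)

(* The functions [a, b, delta, Rem] are only constrained on the domains
   [0, rho) and [0, rho) x (-pi/2, pi/2); their values elsewhere play no role. *)
Record log_admissible_data (R : realType) (c : nat -> R) (a b delta : R -> R)
    (Rem : R -> R -> R[i]) : Prop := {
  la_coef_ge0 : forall k, 0 <= c k ;
  la_radius_gt0 : (0 < cvg_radius c)%E ;
  la_a_ge0 : forall r, in_range (cvg_radius c) r -> 0 <= a r ;
  la_b_ge0 : forall r, in_range (cvg_radius c) r -> 0 <= b r ;
  la_delta_range : forall r, in_range (cvg_radius c) r ->
    0 < delta r < pi / 2 ;
  la_approximation : forall r phi : R, in_range (cvg_radius c) r ->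
    `|phi| <= delta r ->
    gC c (polar r phi) =
      (gR c r)%:C + (0 +i* (phi * a r)) - (phi ^+ 2 / 2 * b r)%:C + Rem r phi ;
  la_remainder : exists eps : R -> R,
    [/\ forall r, in_range (cvg_radius c) r -> 0 <= eps r,
        eps r @[r --> to_radius (cvg_radius c)] --> 0
      & forall r phi : R, in_range (cvg_radius c) r -> `|phi| <= delta r ->
          `|Rem r phi| <= (eps r * `|phi| ^+ 3 * delta r ^- 3)%:C] ;
  la_a_divergence : a r @[r --> to_radius (cvg_radius c)] --> +oo ;
  la_b_divergence : b r @[r --> to_radius (cvg_radius c)] --> +oo ;
  la_delta_cvg0 : delta r @[r --> to_radius (cvg_radius c)] --> 0 ;
  la_width : forall e : R, 0 < e ->
    e * delta r ^+ 2 * b r - ln (b r)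
      @[r --> to_radius (cvg_radius c)] --> +oo ;
  la_monotonicity : forall r phi : R, in_range (cvg_radius c) r ->
    - pi <= phi <= pi -> delta r < `|phi| ->
    complex.Re (gC c (polar r phi)) <= complex.Re (gC c (polar r (delta r))) /\
    complex.Re (gC c (polar r phi)) <= complex.Re (gC c (polar r (- delta r)))
}.

(* The power series with coefficients [c] is log-admissible, and [a], [b] are
   the associated functions. They are determined on [0, rho) by the
   approximation clause. *)
Definition log_admissible (R : realType) (c : nat -> R) (a b : R -> R) : Prop :=
  exists (delta : R -> R) (Rem : R -> R -> R[i]),
    log_admissible_data c a b delta Rem.

(** * The generating function of the weights and the saddle point *)

Definition g_coef (R : realType) (theta : nat -> R) (k : nat) : R :=
  if k is 0 then 0 else theta k / k%:R.

Definition saddle_point (R : realType) (rho : \bar R) (a : R -> R)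
    (rx : R -> R) : Prop :=
  forall x, 0 < x -> [/\ in_range rho (rx x), a (rx x) = x
    & forall r, in_range rho r -> a r = x -> r = rx x].

Definition eta1 (R : realType) (rx : R -> R) (x : R) : R :=
  - (x * derive1 rx x / rx x).

(* Main.v *)
Require Import Defs.
From HB Require Import structures.
From mathcomp Require Import all_boot all_order all_algebra all_fingroup.
From mathcomp Require Import complex.
From mathcomp Require Import all_classical all_reals all_analysis.
From mathcomp Require Import measurable_realfun.
From mathcomp Require Import ring lra zify.

Set Implicit Arguments.
Unset Strict Implicit.
Unset Printing Implicit Defensive.

Import Order.TTheory GRing.Theory Num.Theory.
Import numFieldNormedType.Exports.

Local Open Scope classical_set_scope.
Local Open Scope ring_scope.

(** Let w_k = c_k r^k, where c is the coefficient sequence of g, and let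
    m_p(r) be the moment sum_k k^p w_k, so that g = m_0, a = m_1, b = m_2. The
    limit law holds with mu_n = g(r_n) and sigma_n^2 = v(r_n), v = m_0 - m_1^2
    / m_2; since r_x' = r_x / b(r_x), this v(r_n) equals g(r_n) + n eta_1(n)
    exactly, and the two asymptotic clauses hold without error terms.

    Distribution functions are reached through moment generating functions
    ([mgf_cvg_below]), so the goal is E exp(tau (K - mu_n) / sigma_n) -->
    exp(tau^2 / 2). Multiplying all weights by u = e^s turns the mean of e^(s
    K) into a ratio h_n(u) / h_n(1) of normalization constants ([ewens_mgf]),
    and splitting a permutation at the cycle of one point gives n h_n(u) = u
    sum_j j c_j h_(n-j)(u) ([ewens_exp_rec]), that is sum_n h_n(u) t^n = exp(u
    g(t)).

    The saddle point method ([local_limit]) evaluates h_n(u) uniformly for u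
    in [1/2, 2]: if u a(r) = n, then h_n(u) is asymptotic to exp(u g(r)) /
    (r^n sqrt(2 pi u b(r))). With y = n e^(-s) the ratio h_n(e^s) / h_n(1) is
    therefore governed by Phi(s) = e^s g(r_y) - n ln r_y. The saddle point
    equation makes the derivatives collapse to Phi' = e^s g(r_y) and Phi'' =
    e^s v(r_y), so that Phi(s) - Phi(0) - s mu_n is close to s^2 sigma_n^2 / 2
    = tau^2 / 2 at s = tau / sigma_n, as soon as v(r_y) is close to v(r_n).

    That last point is the heart of the proof. The number v is the residual
    min_t sum_k w_k (1 - t k)^2 of a least squares fit, hence increasing in r,
    and between r_n and r_y it varies by a factor at most 1 + C |s| ln n
    ([residual_ratio]). As |s| is |tau| / sigma_n, what is needed is that
    v(r_n) / (ln n)^2 tends to infinity ([residual_large]). The width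
    condition of log-admissibility gives m_1^2 / m_2 >= A ln m_1 for every A,
    and integrating d m_0 / d (ln m_1) = m_1^2 / m_2 gives m_0 >= A (ln
    m_1)^2. If lam = m_1 / m_2 stays away from 0, r is at least a power of m_1
    and any two nonzero coefficients of g make v large. Otherwise let s < r be
    the radius at which lam was 8 times larger: the weights that fitted well
    at s fit badly at r, and v(r) is at least (m_1^2 / m_2)(s) (m_1(r) /
    m_1(s))^k / 32 ([residual_after_drop]). Either m_1(s) is small and this
    power suffices, or ln m_1(s) is comparable with ln m_1(r) and v(s) +
    (m_1^2 / m_2)(s) = m_0(s) is large enough. The bound on the second
    derivative of r_x enters as m_1 m_3 <= N m_2^2 ([regular_moments]), which
    controls how fast lam falls and m_2 grows. *)

(** * Series and power series *)

(** A record, so that the limit of a series is not unfolded into its filters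
    when lemmas are applied. *)
Record sums_to (R : realType) (u : nat -> R) (l : R) : Prop :=
  SumsTo { sums_toP : series u @ \oo --> l }.

Section SumsTo.
Variable R : realType.
Implicit Types (u v : nat -> R) (l m a : R).

Lemma sums_to_unique u l m : sums_to u l -> sums_to u m -> l = m.
Proof. by move=> [ul] [um]; apply: (cvg_unique _ ul um). Qed.

Lemma sums_toE u l : sums_to u l -> limn (series u) = l.
Proof. by move=> [/cvg_lim]; exact. Qed.

Lemma sums_to_cvg u l : sums_to u l -> cvgn (series u).
Proof. by move=> [ul]; apply/cvg_ex; exists l. Qed.

Lemma sums_to_lim u : cvgn (series u) -> sums_to u (limn (series u)).
Proof. by []. Qed.

Lemma sums_to_ext u v l : sums_to u l -> u =1 v -> sums_to v l.
Proof. by move=> + /funext <-. Qed.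

Lemma sums_toD u v l m :
  sums_to u l -> sums_to v m -> sums_to (fun k => u k + v k) (l + m).
Proof.
move=> [ul] [vm]; split; rewrite (_ : series _ = series u + series v).
  exact: cvgD.
by apply/funext => n; rewrite /series /= big_split.
Qed.

Lemma sums_toZ a u l : sums_to u l -> sums_to (fun k => a * u k) (a * l).
Proof.
move=> [ul]; split; rewrite (_ : series _ = (fun n => a * series u n)).
  exact: cvgMr.
by apply/funext => n; rewrite /series /= mulr_sumr.
Qed.

Lemma sums_toN u l : sums_to u l -> sums_to (fun k => - u k) (- l).
Proof.
move=> ul; rewrite -mulN1r; apply: (sums_to_ext (sums_toZ (-1) ul)) => k.
by rewrite mulN1r.
Qed.

Lemma sums_toB u v l m :
  sums_to u l -> sums_to v m -> sums_to (fun k => u k - v k) (l - m).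
Proof. by move=> ul /sums_toN; exact: sums_toD. Qed.

Lemma sums_to_le u v l m : (forall k, u k <= v k) ->
  sums_to u l -> sums_to v m -> l <= m.
Proof.
move=> uv [ul] [vm]; apply: (ler_cvg_to ul vm).
by apply: nearW => n; apply: ler_sum => k _.
Qed.

Lemma sums_to0 : sums_to (fun=> 0 : R) 0.
Proof.
split; rewrite (_ : series _ = (fun=> 0)); first exact: cvg_cst.
by apply/funext => n; rewrite /series /= big1.
Qed.

Lemma sums_to_ge0 u l : (forall k, 0 <= u k) -> sums_to u l -> 0 <= l.
Proof. by move=> u0; apply: sums_to_le sums_to0. Qed.

Lemma sums_to_partial u l n : (forall k, 0 <= u k) -> sums_to u l ->
  \sum_(0 <= k < n) u k <= l.
Proof.
move=> u0 ul; rewrite -(sums_toE ul).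
apply: (@nondecreasing_cvgn_le R (series u)); last exact: sums_to_cvg ul.
by apply/nondecreasing_seqP => k; rewrite /series /= big_nat_recr//= lerDl.
Qed.

Lemma sums_to_term u l n : (forall k, 0 <= u k) -> sums_to u l -> u n <= l.
Proof.
move=> u0 ul; apply: le_trans (sums_to_partial n.+1 u0 ul).
by rewrite big_nat_recr//= lerDr sumr_ge0.
Qed.

Lemma sums_to_cmp u v m : (forall k, `|u k| <= v k) -> sums_to v m ->
  exists l, sums_to u l.
Proof.
move=> uv vm; have cu : cvgn (series u).
  apply: normed_cvg; apply: (@series_le_cvg R _ v) => // [k|k|].
  - by rewrite normr_ge0.
  - exact: le_trans (uv k).
  - exact: sums_to_cvg vm.
by exists (limn (series u)).
Qed.

Lemma sums_to_norm_le u v l m : (forall k, `|u k| <= v k) ->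
  sums_to u l -> sums_to v m -> `|l| <= m.
Proof.
move=> uv ul vm; rewrite ler_norml; apply/andP; split.
- apply: (@sums_to_le (fun k => - v k) u) => // [k|]; last exact: sums_toN.
  by have := uv k; rewrite ler_norml => /andP[].
- apply: (@sums_to_le u v) => // k; exact: le_trans (ler_norm _) (uv k).
Qed.

End SumsTo.

Section PowerSums.
Variable R : realType.
Implicit Types (f c : nat -> R) (r s : R) (rho : \bar R).

(** Absolute convergence at every point of the range; being stable under the
    operator t d/dt, it lets power series be differentiated repeatedly. *)
Record abs_on rho f : Prop := AbsOn {
  abs_onP : forall r, in_range rho r -> cvgn (pseries (fun k => `|f k|) r) }.

Definition psum f r : R := limn (pseries f r).

(** The action of t d/dt on coefficients. *)
Definition dcoef f : nat -> R := fun k => k%:R * f k.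

Lemma range_open rho r : in_range rho r -> exists2 s, r < s & in_range rho s.
Proof.
move=> [r0]; case: rho => [x| |] //=.
- rewrite lte_fin => rx; exists ((r + x) / 2); first lra.
  by split; [lra | rewrite lte_fin; lra].
- by move=> _; exists (r + 1); [lra | split; [lra | exact: ltry]].
Qed.

Lemma range_le rho r s : 0 <= s -> s <= r -> in_range rho r -> in_range rho s.
Proof.
move=> s0 sr [_ rr]; split => //; apply: le_lt_trans rr; by rewrite lee_fin.
Qed.

Lemma abs_on_radius c : (forall k, 0 <= c k) -> abs_on (cvg_radius c) c.
Proof.
move=> c0; split => r [r0]; rewrite /cvg_radius => /ereal_sup_gt [_ [s [s0 cs] <-]].
rewrite lte_fin => rs.
by apply: (is_cvg_pseries_inside_norm cs); rewrite !ger0_norm.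
Qed.

Lemma psum_sums rho f r : abs_on rho f -> in_range rho r ->
  sums_to (fun k => f k * r ^+ k) (psum f r).
Proof.
move=> af rr; rewrite /psum; apply: sums_to_lim.
have r0 : 0 <= r by case: rr.
have h k : `|f k * r ^+ k| <= `|f k| * r ^+ k.
  by rewrite normrM normrX (ger0_norm r0).
by have [l /sums_to_cvg] := sums_to_cmp h (sums_to_lim (abs_onP af rr)).
Qed.

(** The price of a factor k is a slightly larger radius: this is what makes
    term by term differentiation possible inside the range. *)
Lemma nat_pow_bound r s k : 0 <= r -> r <= s ->
  k%:R * r ^+ k * (s - r) <= r * s ^+ k.
Proof.
move=> r0 rs; elim: k => [|k ih]; first by rewrite !mul0r mulr1.
rewrite !exprS -nat1r.
have rk0 : 0 <= r ^+ k by exact: exprn_ge0.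
have sk : r ^+ k <= s ^+ k by apply: lerXn2r; rewrite ?nnegrE// (le_trans r0).
have h2 : r ^+ k * (s - r) <= s ^+ k * (s - r) by apply: ler_wpM2r => //; lra.
have h1 : r * (k%:R * r ^+ k * (s - r)) <= r * (r * s ^+ k).
  exact: ler_wpM2l.
have h3 : r * (r ^+ k * (s - r)) <= r * (s ^+ k * (s - r)) by exact: ler_wpM2l.
lra.
Qed.

Lemma abs_on_dcoef rho f : abs_on rho f -> abs_on rho (dcoef f).
Proof.
move=> af; split => r rr; have [s rs sr] := range_open rr.
have r0 : 0 <= r by case: rr.
have hk k : `| `|dcoef f k| * r ^+ k| <= r / (s - r) * (`|f k| * s ^+ k).
  rewrite /dcoef normrM normr_id normrM normr_nat.
  rewrite (ger0_norm (exprn_ge0 _ r0)).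
  have h := nat_pow_bound k r0 (ltW rs).
  rewrite mulrAC; have sr0 : 0 < s - r by lra.
  have -> : r / (s - r) * (`|f k| * s ^+ k) = (r * s ^+ k / (s - r)) * `|f k|.
    by field; lra.
  by rewrite ler_wpM2r// ler_pdivlMr.
have [l h] := sums_to_cmp hk (sums_toZ (r / (s - r)) (sums_to_lim (abs_onP af sr))).
exact: sums_to_cvg h.
Qed.

Lemma dcoef_diffs f r n :
  series (fun k => dcoef f k * r ^+ k) n.+1
  = r * series (fun k => pseries_diffs f k * r ^+ k) n.
Proof.
rewrite /series /= big_nat_recl//= /dcoef !mul0r add0r mulr_sumr.
by apply: eq_bigr => i _; rewrite /pseries_diffs exprS mulrCA.
Qed.

Lemma psum_diffs rho f r : abs_on rho f -> in_range rho r -> 0 < r ->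
  sums_to (fun k => pseries_diffs f k * r ^+ k) (psum (dcoef f) r / r).
Proof.
move=> af rr r0; have [h] := psum_sums (abs_on_dcoef af) rr.
have {}h : series (fun k => dcoef f k * r ^+ k) n.+1 @[n --> \oo]
    --> psum (dcoef f) r by rewrite cvg_shiftS.
split; rewrite (_ : series _ = (fun n => r^-1 *
  series (fun k => dcoef f k * r ^+ k) n.+1)).
  by rewrite mulrC; apply: cvgMr.
by apply/funext => n; rewrite dcoef_diffs mulKf ?gt_eqF.
Qed.

Lemma abs_on_diffs rho f : abs_on rho f -> abs_on rho (pseries_diffs f).
Proof.
move=> af; split => r rr; have [s rs sr] := range_open rr.
have r0 : 0 <= r by case: rr.
have s0 : 0 < s by lra.
have af' : abs_on rho (fun k => `|f k|).
  by split=> x xr; have := abs_onP af xr; under [fun k => `| `|_| |]eq_fun do rewrite normr_id.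
have h := psum_diffs af' sr s0.
apply: (@is_cvg_pseries_inside _ _ s); last by rewrite (ger0_norm r0) gtr0_norm.
rewrite /pseries (_ : (fun i => _) = fun k => pseries_diffs (fun k => `|f k|) k * s ^+ k).
  exact: sums_to_cvg h.
by apply/funext => k; rewrite /pseries_diffs normrM normr_nat.
Qed.

Lemma abs_on_cvg rho f r : abs_on rho f -> in_range rho r ->
  cvgn (pseries f r).
Proof. by move=> af /(psum_sums af) /sums_to_cvg. Qed.

Lemma is_derive_psum_at rho f r : abs_on rho f -> in_range rho r ->
  is_derive r (1 : R) (psum f) (psum (pseries_diffs f) r).
Proof.
move=> af rr; have [s rs sr] := range_open rr; have r0 : 0 <= r by case: rr.
have ad := abs_on_diffs af.
apply: (@pseries_snd_diffs _ f s r).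
- exact: (abs_on_cvg af sr).
- exact: (abs_on_cvg ad sr).
- exact: (abs_on_cvg (abs_on_diffs ad) sr).
by rewrite (ger0_norm r0) gtr0_norm//; lra.
Qed.

Lemma is_derive_psum rho f r : abs_on rho f -> in_range rho r -> 0 < r ->
  is_derive r (1 : R) (psum f) (psum (dcoef f) r / r).
Proof.
move=> af rr r0; rewrite -(sums_toE (psum_diffs af rr r0)).
exact: is_derive_psum_at af rr.
Qed.
End PowerSums.

(** * Power series in polar coordinates *)

Lemma power_sum_cvg (K : numFieldType) (c : nat -> K) (z l : K) :
  series (fun k => c k * z ^+ k : K^o) @ \oo --> (l : K^o) -> power_sum c z = l.
Proof. by move=> h; apply: cvg_lim => //; exact: norm_hausdorff. Qed.

Section Polar.
Variable R : realType.
Implicit Types (c : nat -> R) (r phi : R) (rho : \bar R).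
Local Open Scope complex_scope.

Lemma polarX r phi k :
  polar r phi ^+ k = (r ^+ k * cos (k%:R * phi)) +i* (r ^+ k * sin (k%:R * phi)).
Proof.
elim: k => [|k ih]; first by rewrite !expr0 mul0r cos0 sin0 mulr1 mulr0.
rewrite exprS ih /polar /=; apply/eqP; rewrite eq_complex /=; apply/andP.
rewrite -!natr1 !mulrDl !mul1r cosD sinD exprS.
by split; apply/eqP; ring.
Qed.

Lemma complex_cvg (x y : nat -> R) a b : x @ \oo --> a -> y @ \oo --> b ->
  (fun n => x n +i* y n : R[i]^o) @ \oo --> (a +i* b : R[i]^o).
Proof.
move=> xa yb; apply/cvgrPdist_lt => e e0.
have [er ee] : 0 < complex.Re e /\ e = (complex.Re e)%:C.
  case: e e0 => er ei; rewrite ltcE /= => /andP[/eqP -> ?]; split => //.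
have e2 : 0 < complex.Re e / 2 by lra.
near=> n.
have hx : `|a - x n| < complex.Re e / 2.
  near: n; move/cvgrPdist_lt : xa; exact.
have hy : `|b - y n| < complex.Re e / 2.
  near: n; move/cvgrPdist_lt : yb; exact.
have -> : (a +i* b) - (x n +i* y n) = (a - x n)%:C + 'i%C * (b - y n)%:C.
  by apply/eqP; rewrite eq_complex /=; apply/andP; split; apply/eqP; ring.
apply: le_lt_trans (ler_normD _ _) _.
rewrite normrM complexiE normCi mul1r !normc_def /= !expr0n /= !addr0 !sqrtr_sqr.
rewrite -rmorphD ee ltcR; lra.
Unshelve. all: by end_near.
Qed.

Definition cosum c r phi := psum (fun k => c k * cos (k%:R * phi)) r.
Definition sinsum c r phi := psum (fun k => c k * sin (k%:R * phi)) r.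

Lemma abs_on_mul rho c (t : nat -> R) : (forall k, `|t k| <= 1) ->
  abs_on rho c -> abs_on rho (fun k => c k * t k).
Proof.
move=> t1 ac; split => r rr; have r0 : 0 <= r by case: rr.
have h k : `| `|c k * t k| * r ^+ k| <= `|c k| * r ^+ k.
  rewrite normrM normr_id (ger0_norm (exprn_ge0 _ r0)) ler_wpM2r ?exprn_ge0//.
  by rewrite normrM ler_piMr.
by have [l /sums_to_cvg] := sums_to_cmp h (sums_to_lim (abs_onP ac rr)).
Qed.

Lemma cos_norm_le1 (x : R) : `|cos x| <= 1.
Proof. by rewrite ler_norml cos_geN1 cos_le1. Qed.

Lemma sin_norm_le1 (x : R) : `|sin x| <= 1.
Proof. by rewrite ler_norml sin_geN1 sin_le1. Qed.

Lemma abs_on_cos rho c phi : abs_on rho c ->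
  abs_on rho (fun k => c k * cos (k%:R * phi)).
Proof. by apply: abs_on_mul => k; exact: cos_norm_le1. Qed.

Lemma abs_on_sin rho c phi : abs_on rho c ->
  abs_on rho (fun k => c k * sin (k%:R * phi)).
Proof. by apply: abs_on_mul => k; exact: sin_norm_le1. Qed.

Lemma gC_polar rho c r phi : abs_on rho c -> in_range rho r ->
  gC c (polar r phi) = cosum c r phi +i* sinsum c r phi.
Proof.
move=> ac rr; rewrite /gC; apply: power_sum_cvg.
have [hc] := psum_sums (abs_on_cos phi ac) rr.
have [hs] := psum_sums (abs_on_sin phi ac) rr.
apply: cvg_trans (complex_cvg hc hs); apply: near_eq_cvg; apply: nearW => n.
rewrite /series /=; elim: n => [|n ih]; first by rewrite !big_nil.
rewrite !big_nat_recr//= -ih polarX; apply/eqP.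
by rewrite eq_complex /=; apply/andP; split; apply/eqP; ring.
Qed.

Lemma gR_psum c r : gR c r = psum c r.
Proof. by []. Qed.

End Polar.

(** * Elementary trigonometric bounds and limits at the radius of convergence *)

Section TrigBounds.
Variable R : realType.
Implicit Types y : R.

Lemma sin_lipschitz y : `|sin y| <= `|y|.
Proof.
wlog y0 : y / 0 <= y => [h|].
  have [/h//|y0] := leP 0 y.
  by rewrite -normrN -sinN -[leRHS]normrN; apply: h; rewrite oppr_ge0 ltW.
have [->|yn0] := eqVneq y 0; first by rewrite sin0.
have yp : 0 < y by rewrite lt0r yn0.
have [z _] := @MVT R sin cos 0 y yp (fun x _ => is_derive_sin x)
  (continuous_subspaceT (@continuous_sin R)).
rewrite sin0 !subr0 => ->; rewrite normrM ler_piMl//.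
exact: cos_norm_le1.
Qed.

Lemma one_minus_cosE y : 1 - cos y = 2 * sin (y / 2) ^+ 2.
Proof.
have -> : cos y = cos (y / 2 + y / 2) by congr cos; lra.
rewrite cosD -!expr2 cos2sin2; ring.
Qed.

Lemma one_minus_cos_le y : 1 - cos y <= y ^+ 2 / 2.
Proof.
rewrite one_minus_cosE.
have h : sin (y / 2) ^+ 2 <= (y / 2) ^+ 2.
  rewrite -(real_normK (num_real (sin (y / 2)))) -(real_normK (num_real (y / 2))).
  by apply: lerXn2r; rewrite ?nnegrE//; exact: sin_lipschitz.
rewrite exprMn in h; lra.
Qed.

Lemma one_minus_cos_ge0 y : 0 <= 1 - cos y.
Proof. by rewrite subr_ge0 cos_le1. Qed.

Lemma one_minus_cos_le_norm y : 1 - cos y <= `|y|.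
Proof.
have h2 := one_minus_cos_le y; rewrite -(real_normK (num_real y)) in h2.
have := cos_geN1 y; have := normr_ge0 y.
have [h|h] := leP (`|y|) 2.
  have : `|y| ^+ 2 <= 2 * `|y| by rewrite expr2 ler_wpM2r.
  lra.
lra.
Qed.

Lemma sin_sub_id_bound y : `|sin y - y| <= `|y| ^+ 3 / 2.
Proof.
wlog y0 : y / 0 <= y => [h|].
  have [/h//|y0] := leP 0 y.
  by rewrite -(normrN (sin y - y)) opprD -sinN -(normrN y); apply: h; rewrite oppr_ge0 ltW.
have [->|yn0] := eqVneq y 0; first by rewrite sin0 subrr normr0 expr0n/= mul0r.
have yp : 0 < y by rewrite lt0r yn0.
have df (x : R) : is_derive x (1:R) (fun z => sin z - z) (cos x - 1).
  by apply: is_deriveB.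
have [z + +] := @MVT R (fun z => sin z - z) (fun x => cos x - 1) 0 y yp (fun x _ => df x)
  (derivable_within_continuous (fun x _ => @ex_derive _ _ _ _ _ _ _ (df x))).
rewrite in_itv/= sin0 !subr0 => /andP[z0 zy] ->.
rewrite normrM (ger0_norm y0) distrC ger0_norm ?one_minus_cos_ge0//.
rewrite exprSr mulrAC ler_wpM2r//; apply: le_trans (one_minus_cos_le z) _.
by rewrite ler_wpM2r// lerXn2r ?nnegrE ?ltW.
Qed.

Lemma cos_quadratic_bound y : `|1 - cos y - y ^+ 2 / 2| <= y ^+ 4 / 8.
Proof.
rewrite one_minus_cosE; set t := y / 2; have -> : y = 2 * t by rewrite /t; lra.
have -> : 2 * sin t ^+ 2 - (2 * t) ^+ 2 / 2 = 2 * ((sin t - t) * (sin t + t)).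
  by field.
have -> : (2 * t) ^+ 4 / 8 = 2 * ((`|t| ^+ 3 / 2) * (2 * `|t|)).
  have -> : 2 * (`|t| ^+ 3 / 2 * (2 * `|t|)) = 2 * `|t| ^+ 4 by field.
  by rewrite -normrX ger0_norm ?exprn_even_ge0//; field.
rewrite normrM (ger0_norm (ler0n _ 2)) ler_wpM2l// normrM ler_pM//.
  exact: sin_sub_id_bound.
apply: le_trans (ler_normD _ _) _; have := sin_lipschitz t; lra.
Qed.

End TrigBounds.

(** The filter [to_radius rho], phrased through points of the range so that
    finite and infinite radii are treated alike. *)
Definition near_radius (R : realType) (rho : \bar R) (P : R -> Prop) :=
  exists2 r0, in_range rho r0 & forall r, in_range rho r -> r0 < r -> P r.

#[global] Instance to_radius_filter (R : realType) (rho : \bar R) :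
  Filter (to_radius rho).
Proof. by case: rho => [x| |] /=; typeclasses eauto. Qed.

Section NearRadius.
Variables (R : realType) (rho : \bar R).
Implicit Types P Q : R -> Prop.

Lemma near_radius_and P Q : near_radius rho P -> near_radius rho Q ->
  near_radius rho (fun r => P r /\ Q r).
Proof.
move=> [r0 rr0 hP] [r1 rr1 hQ]; exists (Num.max r0 r1).
  by case: (leP r0 r1).
by move=> r rr; rewrite gt_max => /andP[h0 h1]; split; [exact: hP|exact: hQ].
Qed.

Lemma near_radius_mono P Q : (forall r, in_range rho r -> 0 < r -> P r -> Q r) ->
  near_radius rho P -> near_radius rho Q.
Proof.
move=> h [r0 rr0 hP]; exists r0 => // r rr r0r; apply: h => //; last exact: hP.
by apply: le_lt_trans r0r; case: rr0.
Qed.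

Lemma near_radius_ex P : near_radius rho P ->
  exists r, [/\ in_range rho r, 0 < r & P r].
Proof.
move=> [r0 rr0 hP]; have [s rs sr] := range_open rr0.
by exists s; split => //; [apply: le_lt_trans rs; case: rr0 | exact: hP].
Qed.

Lemma near_radiusP P : (0 < rho)%E ->
  (\forall r \near to_radius rho, P r) -> near_radius rho P.
Proof.
rewrite /to_radius /near_radius /in_range; case: rho => [x| |]//.
- rewrite lte_fin => x0 [e /= e0 he]; exists (Num.max 0 (x - e / 2)).
    by split; rewrite ?lte_fin ?le_max ?gt_max ?lexx//; apply/andP; split => //; lra.
  move=> r [r0]; rewrite lte_fin gt_max => rx /andP[_ h]; apply: he => //.
  by rewrite /= ger0_norm; lra.
- move=> _ [m [_ hm]]; exists (Num.max 0 m); first by split; rewrite ?ltry// le_max lexx.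
  by move=> r _; rewrite gt_max => /andP[_ h]; apply: hm.
Qed.

End NearRadius.

(** * Moments, and real form of log-admissibility *)

Section Moments.
Variables (R : realType) (c : nat -> R) (rho : \bar R).
Hypothesis ac : abs_on rho c.
Implicit Types r s phi : R.

(** The moments of the weights c_k r^k: [mom c 0], [mom c 1] and [mom c 2] are
    g, a and b. *)
Definition mom p r := psum (iter p (@dcoef R) c) r.

Lemma iter_dcoef p k : iter p (@dcoef R) c k = k%:R ^+ p * c k.
Proof. by elim: p => [|p ih] /=; rewrite ?mul1r// /dcoef ih exprS mulrA. Qed.

Lemma abs_on_iter p : abs_on rho (iter p (@dcoef R) c).
Proof. by elim: p => //= p; exact: abs_on_dcoef. Qed.

Lemma mom_sums p r : in_range rho r ->
  sums_to (fun k => c k * r ^+ k * k%:R ^+ p) (mom p r).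
Proof.
move=> rr; apply: (sums_to_ext (psum_sums (abs_on_iter p) rr)) => k.
by rewrite iter_dcoef; ring.
Qed.

Lemma is_derive_mom p r : in_range rho r -> 0 < r ->
  is_derive r (1 : R) (mom p) (mom p.+1 r / r).
Proof. exact: is_derive_psum (abs_on_iter p). Qed.

Hypothesis c_ge0 : forall k, 0 <= c k.

Lemma mom_ge0 p r : in_range rho r -> 0 <= mom p r.
Proof.
move=> rr; apply: sums_to_ge0 (mom_sums p rr) => k.
by rewrite !mulr_ge0 ?exprn_ge0//; case: rr.
Qed.

Lemma cosum_sums r phi : in_range rho r ->
  sums_to (fun k => c k * r ^+ k * cos (k%:R * phi)) (cosum c r phi).
Proof.
move=> rr; apply: (sums_to_ext (psum_sums (abs_on_cos phi ac) rr)) => k.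
by rewrite mulrAC.
Qed.

Lemma sinsum_sums r phi : in_range rho r ->
  sums_to (fun k => c k * r ^+ k * sin (k%:R * phi)) (sinsum c r phi).
Proof.
move=> rr; apply: (sums_to_ext (psum_sums (abs_on_sin phi ac) rr)) => k.
by rewrite mulrAC.
Qed.

(** With [cosum_expansion], this identifies a and b as the first coefficients
    of the expansion of g along a circle. *)
Lemma sinsum_expansion r phi : in_range rho r ->
  `|sinsum c r phi - phi * mom 1 r| <= `|phi| ^+ 3 / 2 * mom 3 r.
Proof.
move=> rr; have r0 : 0 <= r by case: rr.
apply: (sums_to_norm_le _ (sums_toB (sinsum_sums phi rr)
  (sums_toZ phi (mom_sums 1 rr)))
  (sums_toZ (`|phi| ^+ 3 / 2) (mom_sums 3 rr))) => k.
have w0 : 0 <= c k * r ^+ k by rewrite mulr_ge0// exprn_ge0.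
have -> : c k * r ^+ k * sin (k%:R * phi) - phi * (c k * r ^+ k * k%:R ^+ 1)
  = (c k * r ^+ k) * (sin (k%:R * phi) - k%:R * phi) by ring.
rewrite normrM (ger0_norm w0).
have -> : `|phi| ^+ 3 / 2 * (c k * r ^+ k * k%:R ^+ 3)
  = (c k * r ^+ k) * (`|k%:R * phi| ^+ 3 / 2).
  by rewrite normrM normr_nat; ring.
by rewrite ler_wpM2l// sin_sub_id_bound.
Qed.

Lemma cosum_expansion r phi : in_range rho r ->
  `|mom 0 r - cosum c r phi - phi ^+ 2 / 2 * mom 2 r| <= phi ^+ 4 / 8 * mom 4 r.
Proof.
move=> rr; have r0 : 0 <= r by case: rr.
apply: (sums_to_norm_le _ (sums_toB (sums_toB (mom_sums 0 rr)
  (cosum_sums phi rr)) (sums_toZ (phi ^+ 2 / 2) (mom_sums 2 rr)))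
  (sums_toZ (phi ^+ 4 / 8) (mom_sums 4 rr))) => k.
have w0 : 0 <= c k * r ^+ k by rewrite mulr_ge0// exprn_ge0.
have -> : c k * r ^+ k * k%:R ^+ 0 - c k * r ^+ k * cos (k%:R * phi)
  - phi ^+ 2 / 2 * (c k * r ^+ k * k%:R ^+ 2)
  = (c k * r ^+ k) * (1 - cos (k%:R * phi) - (k%:R * phi) ^+ 2 / 2) by field.
rewrite normrM (ger0_norm w0).
have -> : phi ^+ 4 / 8 * (c k * r ^+ k * k%:R ^+ 4)
  = (c k * r ^+ k) * ((k%:R * phi) ^+ 4 / 8) by field.
by rewrite ler_wpM2l// cos_quadratic_bound.
Qed.

Lemma one_minus_cosum_le r phi : in_range rho r ->
  mom 0 r - cosum c r phi <= `|phi| * mom 1 r.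
Proof.
move=> rr; have r0 : 0 <= r by case: rr.
apply: (sums_to_le _ (sums_toB (mom_sums 0 rr) (cosum_sums phi rr))
  (sums_toZ (`|phi|) (mom_sums 1 rr))) => k.
have w0 : 0 <= c k * r ^+ k by rewrite mulr_ge0// exprn_ge0.
have -> : c k * r ^+ k * k%:R ^+ 0 - c k * r ^+ k * cos (k%:R * phi)
  = (c k * r ^+ k) * (1 - cos (k%:R * phi)) by ring.
have -> : `|phi| * (c k * r ^+ k * k%:R ^+ 1) = (c k * r ^+ k) * `|k%:R * phi|.
  by rewrite normrM normr_nat; ring.
by rewrite ler_wpM2l// one_minus_cos_le_norm.
Qed.

End Moments.

(** The content of log-admissibility on real and imaginary parts. The errors
    are bounded by eps alone because |phi| <= delta makes the factor |phi /
    delta|^3 at most 1. *)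
Record saddle_data (R : realType) (c : nat -> R) (rho : \bar R)
    (delta eps : R -> R) : Prop := {
  sd_delta : forall r, in_range rho r -> 0 < delta r < pi / 2 ;
  sd_eps_ge0 : forall r, in_range rho r -> 0 <= eps r ;
  sd_eps : forall e, 0 < e -> near_radius rho (fun r => eps r < e) ;
  sd_delta0 : forall e, 0 < e -> near_radius rho (fun r => delta r < e) ;
  sd_re : forall r phi, in_range rho r -> `|phi| <= delta r ->
    `|mom c 0 r - cosum c r phi - phi ^+ 2 / 2 * mom c 2 r| <= eps r ;
  sd_im : forall r phi, in_range rho r -> `|phi| <= delta r ->
    `|sinsum c r phi - phi * mom c 1 r| <= eps r ;
  sd_a : forall M, near_radius rho (fun r => M < mom c 1 r) ;
  sd_b : forall M, near_radius rho (fun r => M < mom c 2 r) ;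
  sd_width : forall e M, 0 < e ->
    near_radius rho (fun r => M < e * delta r ^+ 2 * mom c 2 r - ln (mom c 2 r)) ;
  sd_mono : forall r phi, in_range rho r -> - pi <= phi <= pi ->
    delta r < `|phi| -> cosum c r phi <= cosum c r (delta r) }.

Lemma le0_of_le_small (R : realType) (x C d : R) : 0 < d ->
  (forall t, 0 < t -> t <= d -> x <= C * t) -> x <= 0.
Proof.
move=> d0 h; rewrite leNgt; apply/negP => x0.
have C0 : 0 < C by have := h d d0 (lexx _); have := d0; nra.
pose t := Num.min d (x / (2 * C)).
have t0 : 0 < t by rewrite /t lt_min d0 divr_gt0//; lra.
have td : t <= d by rewrite /t ge_min lexx.
have tx : t <= x / (2 * C) by rewrite /t ge_min lexx orbT.
have := h t t0 td; have : C * t <= C * (x / (2 * C)) by rewrite ler_wpM2l// ltW.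
have -> : C * (x / (2 * C)) = x / 2 by field; lra.
lra.
Qed.

Section FromAdmissible.
Variables (R : realType) (c : nat -> R) (a b : R -> R).
Local Open Scope complex_scope.
Let rho := cvg_radius c.

Lemma normc_ge_re_im (z : R[i]) (e : R) : `|z| <= e%:C ->
  `|complex.Re z| <= e /\ `|complex.Im z| <= e.
Proof.
case: z => x y; rewrite normc_def lecR /= => h.
by split; apply: le_trans h; rewrite -[leLHS]sqrtr_sqr ler_wsqrtr//
  ?lerDl ?lerDr sqr_ge0.
Qed.

(** The functions a and b are recovered by letting phi tend to 0 at fixed r:
    the remainder is O(phi^3), so they agree with the Taylor coefficients of
    g(r e^(i phi)). *)
Lemma saddle_data_of_log_admissible : log_admissible c a b ->
  [/\ forall k, 0 <= c k, (0 < rho)%E,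
      forall r, in_range rho r -> a r = mom c 1 r /\ b r = mom c 2 r
    & exists delta eps, saddle_data c rho delta eps].
Proof.
move=> [delta [Rem []]]; rewrite -/rho => c0 rho0 _ _ dr app [eps [eps0 epscv epsb]].
move=> adiv bdiv dcv width mono.
have ac : abs_on rho c := abs_on_radius c0.
have key r phi : in_range rho r -> `|phi| <= delta r ->
    `|mom c 0 r - cosum c r phi - phi ^+ 2 / 2 * b r|
      <= eps r * `|phi| ^+ 3 * delta r ^- 3 /\
    `|sinsum c r phi - phi * a r| <= eps r * `|phi| ^+ 3 * delta r ^- 3.
  move=> rr pd; have := app r phi rr pd; have := epsb r phi rr pd.
  rewrite (gC_polar phi ac rr) gR_psum => /normc_ge_re_im.
  case: (Rem r phi) => x y /= [hx hy] /eqP; rewrite eq_complex /= => /andP[/eqP -> /eqP ->].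
  split.
    by rewrite /mom /= -normrN; apply: le_trans hx; rewrite le_eqVlt; apply/orP; left; apply/eqP; congr `|_|; ring.
  by apply: le_trans hy; rewrite le_eqVlt; apply/orP; left; apply/eqP; congr `|_|; ring.
have ab r : in_range rho r -> a r = mom c 1 r /\ b r = mom c 2 r.
  move=> rr; have /andP[d0 _] := dr r rr.
  set E := eps r * delta r ^- 3.
  have E0 : 0 <= E by rewrite mulr_ge0 ?eps0// invr_ge0 exprn_ge0// ltW.
  have h t : 0 < t -> t <= delta r ->
      `|a r - mom c 1 r| <= (delta r * (E + mom c 3 r / 2)) * t /\
      `|b r - mom c 2 r| <= (2 * E + delta r * mom c 4 r / 4) * t.
    move=> t0 td; have td' : `|t| <= delta r by rewrite gtr0_norm.
    have [k2 k1] := key r t rr td'.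
    have s1 := sinsum_expansion ac c0 t rr.
    have s2 := cosum_expansion ac c0 t rr.
    have m3 := mom_ge0 ac c0 3 rr; have m4 := mom_ge0 ac c0 4 rr.
    rewrite !(gtr0_norm t0) in k1 k2 s1.
    have Ee : eps r * t ^+ 3 * delta r ^- 3 = E * t ^+ 3 by rewrite /E; ring.
    rewrite Ee in k1 k2; split.
      have : t * `|a r - mom c 1 r| <= (E + mom c 3 r / 2) * t ^+ 3.
        rewrite -{1}(gtr0_norm t0) -normrM.
        have -> : t * (a r - mom c 1 r) = (sinsum c r t - t * mom c 1 r)
          - (sinsum c r t - t * a r) by ring.
        apply: le_trans (ler_normB _ _) _; lra.
      have -> : (E + mom c 3 r / 2) * t ^+ 3 = t * ((E + mom c 3 r / 2) * t * t) by ring.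
      rewrite ler_pM2l// => /le_trans; apply.
      rewrite [leRHS]mulrAC -[leLHS]mulrA [leLHS]mulrC ler_wpM2r//; last by rewrite ler_pM2r.
      by rewrite addr_ge0// divr_ge0.
    have : t ^+ 2 / 2 * `|b r - mom c 2 r| <= E * t ^+ 3 + t ^+ 4 / 8 * mom c 4 r.
      have t2 : 0 <= t ^+ 2 / 2 by rewrite divr_ge0// exprn_ge0// ltW.
      rewrite -{1}(ger0_norm t2) -normrM.
      have -> : t ^+ 2 / 2 * (b r - mom c 2 r) =
        (mom c 0 r - cosum c r t - t ^+ 2 / 2 * mom c 2 r)
          - (mom c 0 r - cosum c r t - t ^+ 2 / 2 * b r) by ring.
      apply: le_trans (ler_normB _ _) _; lra.
    have -> : E * t ^+ 3 + t ^+ 4 / 8 * mom c 4 r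
      = t ^+ 2 / 2 * (2 * E * t + t * t / 4 * mom c 4 r) by field.
    rewrite ler_pM2l; last by rewrite divr_gt0// exprn_gt0.
    move=> /le_trans; apply.
    have : t * (t * mom c 4 r) <= delta r * (t * mom c 4 r).
      by rewrite ler_wpM2r// mulr_ge0// ltW.
    lra.
  split; apply/eqP; rewrite -subr_eq0 -normr_le0.
  - apply: (@le0_of_le_small _ _ (delta r * (E + mom c 3 r / 2)) _ d0) => t t0 td.
    by have [] := h t t0 td.
  - apply: (@le0_of_le_small _ _ (2 * E + delta r * mom c 4 r / 4) _ d0) => t t0 td.
    by have [] := h t t0 td.
have ratio (r phi : R) : in_range rho r -> `|phi| <= delta r ->
    eps r * `|phi| ^+ 3 * delta r ^- 3 <= eps r.
  move=> rr pd; have /andP[d0 _] := dr r rr.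
  rewrite -mulrA ler_piMr ?eps0// ler_pdivrMr ?exprn_gt0// mul1r.
  by apply: lerXn2r; rewrite ?nnegrE// ltW.
have toy (f : R -> R) (M : R) : f r @[r --> to_radius rho] --> +oo -> near_radius rho (fun r => M < f r).
  by move=> fy; apply: near_radiusP rho0 _; exact: (proj1 (cvgryPgt _) fy M).
split => //; exists delta, eps; split => //.
- move=> e e0; apply: (near_radius_mono (P := fun r => `|eps r| < e)) => [r _ _|].
    exact/le_lt_trans/ler_norm.
  by apply: near_radiusP rho0 _; exact: (proj1 (cvgr0Pnorm_lt _) epscv e e0).
- move=> e e0; apply: (near_radius_mono (P := fun r => `|delta r| < e)) => [r _ _|].
    exact/le_lt_trans/ler_norm.
  by apply: near_radiusP rho0 _; exact: (proj1 (cvgr0Pnorm_lt _) dcv e e0).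
- move=> r phi rr pd; have [_ <-] := ab r rr.
  by have [h _] := key r phi rr pd; apply: le_trans h _; exact: ratio.
- move=> r phi rr pd; have [<- _] := ab r rr.
  by have [_ h] := key r phi rr pd; apply: le_trans h _; exact: ratio.
- move=> M; apply: near_radius_mono (toy _ M adiv) => r rr _.
  by have [-> _] := ab r rr.
- move=> M; apply: near_radius_mono (toy _ M bdiv) => r rr _.
  by have [_ ->] := ab r rr.
- move=> e M e0; apply: near_radius_mono (toy _ M (width e e0)) => r rr _.
  by have [_ ->] := ab r rr.
- move=> r phi rr pp dp; have [h _] := mono r phi rr pp dp.
  by rewrite !(gC_polar _ ac rr)/= in h.
Qed.

End FromAdmissible.

(** * Geometry of the saddle point *)

Section Monotone.
Variable R : realType.

Lemma is_derive_nondecreasing (f df : R -> R) (x y : R) : x <= y ->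
  (forall z, x <= z <= y -> is_derive z (1 : R) f (df z) /\ 0 <= df z) ->
  f x <= f y.
Proof.
move=> xy h; rewrite -subr_ge0.
have hd z : z \in `[x, y] -> is_derive z (1:R) f (df z).
  by rewrite in_itv/= => /h[].
have [z zxy ->] := @MVT_segment R f df x y xy
  (fun z zi => hd z (subset_itv_oo_cc zi))
  (derivable_within_continuous (fun z zi => @ex_derive _ _ _ _ _ _ _ (hd z zi))).
rewrite in_itv/= in zxy; have [_ d0] := h z zxy.
by rewrite mulr_ge0// subr_ge0.
Qed.

Lemma expR_ge_quad (x : R) : 0 <= x -> 1 + x ^+ 2 / 2 <= expR x.
Proof. by move=> x0; have := expR_ge1Dxn 1 x0; rewrite factS. Qed.

Lemma expR_sub1_le (x : R) : expR x - 1 <= x * expR x.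
Proof.
have h := expR_ge1Dx (- x); have e0 := expR_gt0 x.
have : expR x * (1 + - x) <= expR x * expR (- x) by rewrite ler_pM2l.
rewrite expRxMexpNx_1; lra.
Qed.

Lemma expR1_le4 : expR 1 <= 4 :> R.
Proof.
have h : expR (1/2) <= 2 :> R.
  have := @expR_ge1Dx R (- (1/2)); have e0 := @expR_gt0 R (1/2).
  move=> h; have : expR (1/2) * (1 + - (1/2)) <= expR (1/2) * expR (- (1/2)) :> R.
    by rewrite ler_pM2l.
  rewrite expRxMexpNx_1; lra.
have -> : (1 : R) = 1/2 + 1/2 by lra.
rewrite expRD; have := @expR_ge0 R (1/2); nra.
Qed.

Lemma expR_neg72_le : expR (1 / 2) * expR (- 4) <= 1 / 4 :> R.
Proof.
rewrite -expRD (_ : 1 / 2 + - 4 = - (7 / 2)); last lra.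
rewrite expRN -[leLHS]div1r ler_pdivrMr ?expR_gt0//.
have := expR_ge1Dx (7 / 2 : R); lra.
Qed.

End Monotone.

(** The termwise inequality behind [residual_after_drop], for mu = lam(s) k. Only al
    <= mu <= 4 matters: elsewhere the left side is nonpositive, because of the
    subtracted exponential for small mu and of the square for large mu. *)
Lemma drop_bound (R : realType) (al T mu y z : R) : 0 <= T -> 0 < al -> 0 <= mu ->
  mu / 8 * T <= y -> (mu < al -> z <= 1 / 2) ->
  1 / 16 * expR (al / 8 * T) * (mu - mu ^+ 2 / 4 - mu * expR (1 / 2 - z))
    <= expR y * (1 - mu / 8) ^+ 2.
Proof.
move=> T0 al0 mu0 hy hz; set B := mu - _ - _.
have rhs0 : 0 <= expR y * (1 - mu / 8) ^+ 2.
  by rewrite mulr_ge0 ?expR_ge0// sqr_ge0.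
have E0 := expR_ge0 (al / 8 * T).
have B0 : B <= 0 -> 1 / 16 * expR (al / 8 * T) * B <= expR y * (1 - mu / 8) ^+ 2.
  by move=> B0; apply: le_trans rhs0; rewrite mulr_ge0_le0// mulr_ge0.
have eB0 : 0 <= mu * expR (1 / 2 - z) by rewrite mulr_ge0 ?expR_ge0.
have mu2 := sqr_ge0 mu.
have [mal|mal] := ltP mu al.
  apply: B0; have : 1 <= expR (1 / 2 - z).
    by rewrite -[leLHS]expR0 ler_expR subr_ge0 hz.
  move=> /(ler_wpM2l mu0); rewrite /B; clear -mu2; lra.
have [m4|m4] := ltP 4 mu.
  apply: B0; rewrite /B.
  have : 4 * mu <= mu ^+ 2 by rewrite expr2 ler_wpM2r// ltW.
  clear -eB0; lra.
have hE : expR (al / 8 * T) <= expR y.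
  by rewrite ler_expR; apply: le_trans hy; rewrite ler_wpM2r// ler_pM2r.
have sq : 1 / 4 <= (1 - mu / 8) ^+ 2.
  have h2 : 1 / 2 <= 1 - mu / 8 by clear -m4; lra.
  by have := ler_pM _ _ h2 h2; rewrite -expr2 expr2 mulrACA; clear; lra.
have B4 : B <= 4 by rewrite /B; clear -eB0 mu2 m4; lra.
apply: le_trans (_ : expR (al / 8 * T) * (1 / 4) <= _); last by apply: ler_pM.
have -> : expR (al / 8 * T) * (1 / 4) = 1 / 16 * expR (al / 8 * T) * 4.
  by field.
by rewrite ler_wpM2l// mulr_ge0.
Qed.

Lemma exp_beats_sq (R : realType) (k A : R) : 0 < k -> 0 <= A ->
  exists X : R, forall x, X <= x -> A * x ^+ 2 <= expR (k * x).
Proof.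
move=> k0 A0; exists (6 * A / k ^+ 3) => x hx.
have k3 : 0 < k ^+ 3 by rewrite exprn_gt0.
have x0 : 0 <= x by apply: le_trans hx; rewrite divr_ge0 ?mulr_ge0// ltW.
have kx : 0 <= k * x by rewrite mulr_ge0// ltW.
have := expR_ge1Dxn 2 kx; rewrite (_ : 3`!%:R = 6 :> R)// exprMn.
rewrite ler_pdivrMr// in hx.
have : 6 * A * x ^+ 2 <= x * k ^+ 3 * x ^+ 2 by rewrite ler_wpM2r// sqr_ge0.
have -> : x * k ^+ 3 * x ^+ 2 = k ^+ 3 * x ^+ 3 by ring.
lra.
Qed.

(** The termwise inequality behind [residual_ratio], for mu = lam(r) k. Up to M = 2
    x / k the factor e^(mu h) is at most 1 + 4 M h; beyond M the exponential
    e^(k mu) absorbs everything with e^(-x) to spare. *)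
Lemma ratio_bound (R : realType) (k x h mu : R) : 0 < k -> 0 <= h -> 0 <= mu ->
  1 <= 2 * x / k -> 2 * x / k * h <= 1 -> h <= k / 4 ->
  expR (mu * h) * (1 - mu) ^+ 2 <= (1 + 4 * (2 * x / k) * h) * (1 - mu) ^+ 2
    + h * (32 / k ^+ 2) * expR (- x) * mu * expR (k * mu).
Proof.
set M := 2 * x / k; set C' := 32 / k ^+ 2 => k0 h0 mu0 M1 Mh h4.
have C'0 : 0 < C' by rewrite divr_gt0// exprn_gt0.
set S := (1 - mu) ^+ 2; have S0 : 0 <= S by exact: sqr_ge0.
have muh0 : 0 <= mu * h by exact: mulr_ge0.
have e0 := expR_ge0 (mu * h).
have C'ge0 := ltW C'0.
have tail0 : 0 <= h * C' * expR (- x) * mu * expR (k * mu).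
  rewrite mulr_ge0 ?expR_ge0// mulr_ge0// mulr_ge0 ?expR_ge0//.
  exact: mulr_ge0.
have es1 := expR_sub1_le (mu * h).
have [mM|Mm] := leP mu M.
  have mh1 : mu * h <= M * h by rewrite ler_wpM2r.
  have e4 : expR (mu * h) <= 4.
    by apply: le_trans (@expR1_le4 R); rewrite ler_expR (le_trans mh1).
  have h2 : mu * h * expR (mu * h) <= M * h * 4 by apply: ler_pM.
  have : expR (mu * h) <= 1 + 4 * M * h by clear -h2 es1; lra.
  by move=> /(ler_wpM2r S0) h3; clear -tail0 h3; lra.
suff big : (expR (mu * h) - 1) * S <= h * C' * expR (- x) * mu * expR (k * mu).
  have M0 : 0 <= M := le_trans ler01 M1.
  have t0 : 0 <= 4 * M * h * S.
    by apply: mulr_ge0 => //; apply: mulr_ge0 => //; exact: mulr_ge0.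
  clear -big t0; lra.
have Sm : S <= mu ^+ 2.
  have mu1 : 1 <= mu by rewrite (le_trans M1)// ltW.
  by rewrite /S sqrrB expr1n mul1r -mulr_natr; clear -mu1; lra.
have mu2 : mu ^+ 2 <= C' * expR (k / 4 * mu).
  have y0 : 0 <= k / 4 * mu by rewrite mulr_ge0// divr_ge0// ltW.
  have := expR_ge_quad y0; set E := expR _ => hE.
  have -> : mu ^+ 2 = C' * ((k / 4 * mu) ^+ 2 / 2) by rewrite /C'; field; rewrite gt_eqF.
  by rewrite ler_wpM2l ?ltW//; clear -hE; lra.
have hmu : expR (mu * h) <= expR (k / 4 * mu).
  by rewrite ler_expR mulrC ler_wpM2r.
have E2 : expR (k / 4 * mu) * expR (k / 4 * mu) <= expR (- x) * expR (k * mu).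
  rewrite -!expRD ler_expR.
  have : k * M <= k * mu by rewrite ler_wpM2l// ltW.
  rewrite /M (_ : k * (2 * x / k) = 2 * x); last by field; rewrite gt_eqF.
  clear; lra.
set E := expR (k / 4 * mu) in mu2 hmu E2.
have E0 : 0 <= E by exact: expR_ge0.
apply: le_trans (_ : (mu * h * E) * (C' * E) <= _).
  apply: ler_pM => //.
  - by rewrite subr_ge0 -[leLHS]expR0 ler_expR.
  - by apply: le_trans es1 _; rewrite ler_wpM2l.
  - exact: le_trans mu2.
have -> : mu * h * E * (C' * E) = mu * h * C' * (E * E) by ring.
have -> : h * C' * expR (- x) * mu * expR (k * mu) = mu * h * C' * (expR (- x) * expR (k * mu)) by ring.
by rewrite ler_wpM2l//; apply: mulr_ge0.
Qed.

Section SaddleGeometry.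
Variables (R : realType) (c : nat -> R) (rho : \bar R).
Hypothesis c_ge0 : forall k, 0 <= c k.
Hypothesis c0 : c 0%N = 0.
Hypothesis c_ex : exists2 j, (1 <= j)%N & 0 < c j.
Hypothesis ac : abs_on rho c.
Implicit Types r s D : R.

Notation m := (mom c).
Definition pos_range r := in_range rho r /\ 0 < r.
(** The slope of ln r as a function of ln m_1, and the optimal t in min_t
    sum_k w_k (1 - t k)^2. *)
Definition lam r := m 1 r / m 2 r.
(** What remains of the mass m_0 after the least squares fit of the constant 1
    by multiples of k; this is the variance of the limit law. *)
Definition residual r := m 0 r - m 1 r ^+ 2 / m 2 r.
(** The part of m_0 explained by that fit, and the derivative of m_0 with
    respect to ln m_1. *)
Definition fitted r := m 1 r ^+ 2 / m 2 r.

Lemma pos_range_le r s : 0 < s -> s <= r -> pos_range r -> pos_range s.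
Proof. by move=> s0 sr [rr r0]; split => //; apply: range_le sr rr; exact: ltW. Qed.

Lemma mass_ge0 r k : pos_range r -> 0 <= c k * r ^+ k.
Proof. by move=> [_ r0]; rewrite mulr_ge0// exprn_ge0// ltW. Qed.

Lemma msum p r : pos_range r -> sums_to (fun k => c k * r ^+ k * k%:R ^+ p) (m p r).
Proof. by move=> [rr _]; exact: (mom_sums ac p rr). Qed.

Lemma msum_exp p r D : pos_range r -> pos_range (r * expR D) ->
  sums_to (fun k => c k * r ^+ k * expR (k%:R * D) * k%:R ^+ p) (m p (r * expR D)).
Proof.
move=> rr rr'; apply: (sums_to_ext (msum p rr')) => k.
by rewrite exprMn -expRM_natl; ring.
Qed.

Lemma m_gt0 p r : pos_range r -> 0 < m p r.
Proof.
move=> rr; have [j j1 cj] := c_ex; have [_ r0] := rr.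
have h k : 0 <= c k * r ^+ k * k%:R ^+ p.
  by rewrite mulr_ge0 ?mass_ge0// exprn_ge0.
apply: lt_le_trans (sums_to_term j h (msum p rr)).
by rewrite !mulr_gt0 ?exprn_gt0// ltr0n.
Qed.

Lemma mass_mono r s k : pos_range r -> pos_range s -> r <= s ->
  c k * r ^+ k <= c k * s ^+ k.
Proof.
move=> [_ r0] [_ s0] rs; rewrite ler_wpM2l//.
by apply: lerXn2r => //; rewrite nnegrE ltW.
Qed.

Lemma m_mono p r s : pos_range s -> pos_range r -> r <= s -> m p r <= m p s.
Proof.
move=> ss rr rs; apply: sums_to_le (msum p rr) (msum p ss) => k.
by rewrite ler_wpM2r ?exprn_ge0// mass_mono.
Qed.

Lemma m_succ_le p r : pos_range r -> m p r <= m p.+1 r.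
Proof.
move=> rr; apply: sums_to_le (msum p rr) (msum p.+1 rr) => k.
case: k => [|k]; first by rewrite c0 !mul0r.
rewrite ler_wpM2l ?mass_ge0// exprS ler_peMl ?exprn_ge0//.
by rewrite -[1]/(1%:R) ler_nat.
Qed.

Lemma lam_gt0 r : pos_range r -> 0 < lam r.
Proof. by move=> rr; rewrite divr_gt0 ?m_gt0. Qed.

Lemma lam_le1 r : pos_range r -> lam r <= 1.
Proof. by move=> rr; rewrite ler_pdivrMr ?m_gt0// mul1r m_succ_le. Qed.

Lemma lamM r : pos_range r -> lam r * m 2 r = m 1 r.
Proof. by move=> rr; rewrite /lam divfK// gt_eqF// m_gt0. Qed.

Lemma fittedE r : pos_range r -> fitted r = lam r * m 1 r.
Proof. by move=> rr; rewrite /fitted /lam expr2 mulrAC. Qed.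

Lemma residual_fitted r : residual r + fitted r = m 0 r.
Proof. by rewrite /residual /fitted subrK. Qed.

Lemma quad_sum t r : pos_range r ->
  sums_to (fun k => c k * r ^+ k * (1 - t * k%:R) ^+ 2)
    (m 0 r - 2 * t * m 1 r + t ^+ 2 * m 2 r).
Proof.
move=> rr; apply: (sums_to_ext (sums_toD (sums_toB (msum 0 rr)
  (sums_toZ (2 * t) (msum 1 rr))) (sums_toZ (t ^+ 2) (msum 2 rr)))) => k.
ring.
Qed.

Lemma residual_sum r : pos_range r ->
  sums_to (fun k => c k * r ^+ k * (1 - lam r * k%:R) ^+ 2) (residual r).
Proof.
move=> rr; have := quad_sum (lam r) rr; congr (sums_to _ _).
by rewrite /residual /lam; field; rewrite gt_eqF// m_gt0.
Qed.

Lemma residual_min t r : pos_range r -> residual r <= m 0 r - 2 * t * m 1 r + t ^+ 2 * m 2 r.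
Proof.
move=> rr; have b0 := m_gt0 2 rr.
rewrite -subr_ge0 (_ : _ - _ = m 2 r * (t - lam r) ^+ 2).
  by rewrite mulr_ge0 ?sqr_ge0// ltW.
by rewrite /residual /lam; field; rewrite gt_eqF.
Qed.

Lemma residual_ge0 r : pos_range r -> 0 <= residual r.
Proof.
move=> rr; apply: sums_to_ge0 (residual_sum rr) => k.
by rewrite mulr_ge0 ?mass_ge0// sqr_ge0.
Qed.

(** A minimum over t of sums whose weights c_k r^k all increase with r. *)
Lemma residual_mono r s : pos_range s -> pos_range r -> r <= s -> residual r <= residual s.
Proof.
move=> ss rr rs; apply: le_trans (residual_min (lam s) rr) _.
apply: sums_to_le (quad_sum (lam s) rr) (residual_sum ss) => k.
by rewrite ler_wpM2r ?sqr_ge0// mass_mono.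
Qed.

(** Jensen's inequality for exp under the probability proportional to k c_k
    r^k, whose mean is 1 / lam. *)
Lemma jensen r D : pos_range r -> pos_range (r * expR D) ->
  m 1 r * expR (D / lam r) <= m 1 (r * expR D).
Proof.
move=> rr rr'; have a0 := m_gt0 1 rr; have b0 := m_gt0 2 rr.
have h := sums_toZ (expR (D / lam r)) (sums_toD
  (sums_toZ (1 - D / lam r) (msum 1 rr)) (sums_toZ D (msum 2 rr))).
have -> : m 1 r * expR (D / lam r) = expR (D / lam r) *
    ((1 - D / lam r) * m 1 r + D * m 2 r).
  by rewrite /lam; field; rewrite !gt_eqF.
apply: sums_to_le h (msum_exp 1 rr rr') => k.
have -> : expR (D / lam r) * ((1 - D / lam r) * (c k * r ^+ k * k%:R ^+ 1)
    + D * (c k * r ^+ k * k%:R ^+ 2))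
  = c k * r ^+ k * k%:R * (expR (D / lam r) * (1 + (k%:R * D - D / lam r))).
  ring.
rewrite expr1 [leRHS]mulrAC; apply: ler_wpM2l.
  exact: mulr_ge0 (mass_ge0 k rr) _.
have -> : expR (k%:R * D) = expR (D / lam r) * expR (k%:R * D - D / lam r).
  by rewrite -expRD addrC subrK.
by rewrite ler_wpM2l ?expR_ge0// expR_ge1Dx.
Qed.

Definition log_m1 r := ln (m 1 r).

Lemma log_m1K r : pos_range r -> expR (log_m1 r) = m 1 r.
Proof. by move=> rr; rewrite lnK// posrE m_gt0. Qed.

(** [jensen] on logarithmic scales. Exchanging r and s yields the converse
    bound, so that ln r is a concave function of ln m_1 with slope lam. *)
Lemma ln_r_le r s : pos_range r -> pos_range s -> ln s - ln r <= lam r * (log_m1 s - log_m1 r).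
Proof.
move=> rr ss; have [_ r0] := rr; have [_ s0] := ss.
have l0 := lam_gt0 rr.
have es : s = r * expR (ln s - ln r).
  by rewrite expRB !lnK ?posrE// mulrCA divff ?mulr1// gt_eqF.
have := jensen (D := ln s - ln r) rr; rewrite -es => /(_ ss).
rewrite -ler_ln ?posrE ?mulr_gt0 ?expR_gt0 ?m_gt0//.
rewrite lnM ?posrE ?expR_gt0 ?m_gt0// expRK -lerBrDl.
by rewrite ler_pdivrMr// mulrC.
Qed.

Lemma log_m1_lt r s : pos_range r -> pos_range s -> r < s -> log_m1 r < log_m1 s.
Proof.
move=> rr ss rs; have [_ r0] := rr; have [_ s0] := ss.
have : 0 < ln s - ln r by rewrite subr_gt0 ltr_ln.
have l0 := lam_gt0 rr.
by move=> /lt_le_trans /(_ (ln_r_le rr ss)); rewrite pmulr_rgt0// subr_gt0.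
Qed.

Lemma log_m1_le r s : pos_range r -> pos_range s -> r <= s -> log_m1 r <= log_m1 s.
Proof.
by move=> rr ss; rewrite le_eqVlt => /orP[/eqP ->//|/(log_m1_lt rr ss)/ltW].
Qed.

Lemma log_m1_lt_inv r s : pos_range r -> pos_range s -> log_m1 r < log_m1 s -> r < s.
Proof.
by move=> rr ss h; rewrite ltNge; apply: contraTN h => /(log_m1_le ss rr); rewrite -leNgt.
Qed.

Lemma ln_r_ge r s : pos_range r -> pos_range s -> lam s * (log_m1 s - log_m1 r) <= ln s - ln r.
Proof. by move=> rr ss; have := ln_r_le ss rr; lra. Qed.

Lemma lam_noninc r s : pos_range r -> pos_range s -> r <= s -> lam s <= lam r.
Proof.
rewrite le_eqVlt => rr ss /orP[/eqP ->//|rs].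
have L := log_m1_lt rr ss rs.
have := ln_r_le rr ss; have := ln_r_ge rr ss => h1 h2.
by have := le_trans h1 h2; rewrite ler_pM2r// subr_gt0.
Qed.

Lemma is_derive_m p r : pos_range r -> is_derive r (1 : R) (m p) (m p.+1 r / r).
Proof. by move=> [rr r0]; exact: (is_derive_mom ac p rr r0). Qed.

Lemma is_derive_lnm p r : pos_range r ->
  is_derive r (1 : R) (fun x => ln (m p x)) (m p.+1 r / (r * m p r)).
Proof.
move=> rr; have [_ r0] := rr; have m0 := m_gt0 p rr.
have h := @is_derive1_comp R (@ln R) (m p) r _ _ (is_derive1_ln m0) (is_derive_m p rr).
by apply: is_derive_eq h _; field; rewrite !gt_eqF.
Qed.

End SaddleGeometry.

(** * Growth of the residual variance *)

Section Variance.
Variables (R : realType) (c : nat -> R) (rho : \bar R) (delta eps : R -> R).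
Hypothesis c_ge0 : forall k, 0 <= c k.
Hypothesis c0 : c 0%N = 0.
Hypothesis c_two : exists j l, [/\ (1 <= j < l)%N, 0 < c j & 0 < c l].
Hypothesis ac : abs_on rho c.
Hypothesis sd : saddle_data c rho delta eps.
Hypothesis m1_onto : forall x, 0 < x -> exists2 r, pos_range rho r & mom c 1 r = x.
Hypothesis reg_var : exists N : nat, near_radius rho
  (fun r => mom c 1 r * mom c 3 r <= N%:R * mom c 2 r ^+ 2).
Implicit Types r s D A : R.

Notation m := (mom c).
Notation in_rho := (pos_range rho).
Notation lam := (lam c).
Notation residual := (residual c).
Notation fitted := (fitted c).
Notation log_m1 := (log_m1 c).

Lemma c_ex : exists2 j, (1 <= j)%N & 0 < c j.
Proof. by have [j [l [/andP[j1 _] cj _]]] := c_two; exists j. Qed.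

Local Notation m_gt0 := (m_gt0 c_ge0 c_ex ac).
Local Notation lam_gt0 := (lam_gt0 c_ge0 c_ex ac).
Local Notation log_m1K := (log_m1K c_ge0 c_ex ac).
Local Notation log_m1_le := (log_m1_le c_ge0 c_ex ac).

Local Notation lamM := (lamM c_ge0 c_ex ac).
Local Notation m_mono := (m_mono c_ge0 ac).

Definition at_radius (P : R -> Prop) :=
  exists2 r0, in_rho r0 & forall r, in_rho r -> r0 <= r -> P r.

Lemma near_at_radius P : near_radius rho P -> at_radius P.
Proof.
move=> [r0 rr0 h]; have [s rs sr] := range_open rr0.
have s0 : 0 < s by apply: le_lt_trans rs; case: rr0.
by exists s => // r [rr _] sr'; apply: h => //; exact: lt_le_trans rs _.
Qed.

Lemma at_radius_and P Q : at_radius P -> at_radius Q -> at_radius (fun r => P r /\ Q r).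
Proof.
move=> [r rr hP] [s ss hQ]; exists (Num.max r s); first by case: (leP r s).
by move=> t tt; rewrite ge_max => /andP[h1 h2]; split; [exact: hP|exact: hQ].
Qed.

Lemma at_radius_mono (P Q : R -> Prop) : (forall r, in_rho r -> P r -> Q r) -> at_radius P -> at_radius Q.
Proof. by move=> h [r rr hP]; exists r => // s ss rs; apply: h => //; exact: hP. Qed.

Lemma log_m1_large A : at_radius (fun r => A <= log_m1 r).
Proof.
apply: at_radius_mono (near_at_radius (sd_a sd (expR A))) => r rr h.
by rewrite -ler_expR (log_m1K rr) ltW.
Qed.

(** The function N ln m_1 - ln m_2 is nondecreasing: its derivative has the
    sign of N m_2^2 - m_1 m_3. *)
Lemma m2_growth : exists2 N : nat, (1 <= N)%N & at_radius (fun r => forall s, in_rho s -> r <= s ->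
  m 2 s <= m 2 r * expR (N%:R * (log_m1 s - log_m1 r))).
Proof.
have [N /near_at_radius[r0 rr0 h]] := reg_var.
exists N.+1 => //; exists r0 => // r rr r0r s ss rs.
have rs0 : 0 <= log_m1 s - log_m1 r by rewrite subr_ge0 log_m1_le.
pose f x := N%:R * ln (m 1 x) - ln (m 2 x).
have fmono : f r <= f s.
  apply: (@is_derive_nondecreasing _ _ (fun z =>
    N%:R * (m 2 z / (z * m 1 z)) - m 3 z / (z * m 2 z))) => // z /andP[rz zs].
  have r0z : 0 < r by case: rr.
  have zz : in_rho z by apply: pos_range_le zs ss; exact: lt_le_trans rz.
  have z0 : 0 < z by case: zz.
  have d1 := is_derive_lnm c_ge0 c_ex ac 1 zz.
  have d2 := is_derive_lnm c_ge0 c_ex ac 2 zz.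
  split; first by apply: is_deriveB; apply: (is_deriveZ N%:R d1).
  have m1 := m_gt0 1 zz; have m2 := m_gt0 2 zz.
  have -> : N%:R * (m 2 z / (z * m 1 z)) - m 3 z / (z * m 2 z)
    = (N%:R * m 2 z ^+ 2 - m 1 z * m 3 z) / (z * m 1 z * m 2 z).
    by field; rewrite !gt_eqF.
  by rewrite divr_ge0 ?mulr_ge0 ?(ltW z0) ?(ltW m1) ?(ltW m2)// subr_ge0 h// (le_trans r0r).
have m2r := m_gt0 2 rr; have m2s := m_gt0 2 ss.
rewrite -ler_ln ?posrE ?mulr_gt0 ?expR_gt0//.
rewrite lnM ?posrE ?expR_gt0// expRK.
rewrite /f -/(log_m1 r) -/(log_m1 s) in fmono.
rewrite -natr1 mulrDl mul1r; nra.
Qed.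

(** At phi = delta, Re g has fallen by delta^2 m_2 / 2 up to eps, but it
    cannot fall by more than delta m_1 since 1 - cos y <= y. Hence delta m_2
    <= 4 m_1. *)
Lemma fitted_lower : at_radius (fun r => delta r ^+ 2 * m 2 r <= 16 * fitted r).
Proof.
have e1 := near_at_radius (sd_eps sd (e := 1) ltr01).
have e2 := near_at_radius (sd_width sd 4 (e := 1) ltr01).
have e3 := near_at_radius (sd_b sd 1).
apply: at_radius_mono (at_radius_and e1 (at_radius_and e2 e3)) => r rr [h1 [h2 h3]].
have [irr r0] := rr.
have /andP[d0 _] := sd_delta sd irr.
have a0 := m_gt0 1 rr; have b0 := m_gt0 2 rr.
have lb : 0 <= ln (m 2 r) by rewrite ln_ge0// ltW.
rewrite mul1r in h2.
have dd : `|delta r| <= delta r by rewrite gtr0_norm.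
have k1 := sd_re sd irr dd.
have k2 := one_minus_cosum_le ac c_ge0 (delta r) irr.
rewrite (gtr0_norm d0) in k2.
move: k1; rewrite ler_norml => /andP[k1 _].
have key : delta r * m 2 r <= 4 * m 1 r.
  rewrite -(ler_pM2l d0); lra.
have -> : 16 * fitted r = (4 * m 1 r) ^+ 2 / m 2 r.
  by rewrite /fitted; field; rewrite gt_eqF.
rewrite ler_pdivlMr// -mulrA -expr2 -exprMn.
by apply: lerXn2r; rewrite // nnegrE mulr_ge0// ltW.
Qed.

(** The width condition makes delta^2 m_2 larger than any multiple of ln m_2
    >= ln m_1. *)
Lemma fitted_large A : 0 < A -> at_radius (fun r => A * log_m1 r <= fitted r).
Proof.
move=> A0; have e0 : 0 < (16 * A)^-1 by rewrite invr_gt0 mulr_gt0.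
have e1 := near_at_radius (sd_width sd 0 e0).
have e2 := near_at_radius (sd_a sd 1).
apply: at_radius_mono (at_radius_and (at_radius_and e1 e2) fitted_lower) => r rr [[h1 h2] h3].
have a0 := m_gt0 1 rr; have b0 := m_gt0 2 rr.
have lb : log_m1 r <= ln (m 2 r).
  by rewrite ler_ln ?posrE//; exact: (m_succ_le c_ge0 c0 ac 1 rr).
have : A * ln (m 2 r) <= A * ((16 * A)^-1 * delta r ^+ 2 * m 2 r).
  by rewrite ler_wpM2l// ?ltW//; lra.
have -> : A * ((16 * A)^-1 * delta r ^+ 2 * m 2 r) = delta r ^+ 2 * m 2 r / 16.
  by field; rewrite gt_eqF.
have : A * log_m1 r <= A * ln (m 2 r) by rewrite ler_wpM2l// ltW.
lra.
Qed.

(** Integrates [fitted_large] against d ln m_1, since the derivative of m_0 is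
    m_1^2 / m_2 times that of ln m_1. *)
Lemma m0_large A : 0 < A -> at_radius (fun r => A * log_m1 r ^+ 2 <= m 0 r).
Proof.
move=> A0; have A4 : 0 < 4 * A by lra.
have [r0 rr0 h] := fitted_large A4.
pose f x := m 0 x - 2 * A * ln (m 1 x) ^+ 2.
have [r1 rr1 h1] := log_m1_large (1 + `|f r0| / A).
exists (Num.max r0 r1); first by case: (leP r0 r1).
move=> r rr; rewrite ge_max => /andP[r0r r1r].
have fmono : f r0 <= f r.
  apply: (@is_derive_nondecreasing _ _ (fun z =>
    m 1 z / z - 2 * A * (2 * ln (m 1 z) * (m 2 z / (z * m 1 z))))) => // z /andP[rz zs].
  have r0z : 0 < r0 by case: rr0.
  have zz : in_rho z by apply: pos_range_le zs rr; exact: lt_le_trans rz.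
  have z0 : 0 < z by case: zz.
  have d1 := is_derive_lnm c_ge0 c_ex ac 1 zz.
  have d2 := is_derive_m ac 0 zz.
  have m1 := m_gt0 1 zz; have m2 := m_gt0 2 zz.
  split.
    have d3 := is_deriveZ (2 * A) (is_deriveX 2 d1).
    have d4 := is_deriveB d2 d3.
    have -> : f = m 0 - (2 * A) \*: (fun x => ln (m 1 x)) ^+ 2.
      by apply/funext => x; rewrite /f fctE.
    apply: (is_derive_eq d4); rewrite /= /GRing.scale /=; ring.
  have := h z zz rz; rewrite -/(log_m1 z) /fitted => hz.
  have -> : m 1 z / z - 2 * A * (2 * log_m1 z * (m 2 z / (z * m 1 z)))
    = (m 1 z ^+ 2 / m 2 z - 4 * A * log_m1 z) * (m 2 z / (z * m 1 z)).
    by field; rewrite !gt_eqF.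
  by rewrite mulr_ge0 ?subr_ge0// divr_ge0 ?mulr_ge0 ?ltW.
have x1 := h1 r rr r1r.
have fa : f r0 >= - `|f r0| by rewrite lerNl -normrN ler_norm.
have n0 : 0 <= `|f r0| / A by rewrite divr_ge0// ltW.
have : A * (`|f r0| / A) <= A * log_m1 r ^+ 2.
  rewrite ler_wpM2l ?ltW//; nra.
rewrite mulrCA divff ?gt_eqF// mulr1 => hA.
move: fmono; rewrite {2}/f -/(log_m1 r); lra.
Qed.

Lemma lam_lower : exists2 N : R, 1 <= N & at_radius (fun r => forall s, in_rho s -> r <= s ->
  lam r * expR ((1 - N) * (log_m1 s - log_m1 r)) <= lam s /\
  m 2 s <= m 2 r * expR (N * (log_m1 s - log_m1 r))).
Proof.
have [N N1 h] := m2_growth; exists N%:R; first by rewrite -[1]/(1%:R) ler_nat.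
apply: at_radius_mono h => r rr h s ss rs; split; last exact: h.
have m2r := m_gt0 2 rr; have m2s := m_gt0 2 ss.
rewrite /(lam s) ler_pdivlMr//.
apply: le_trans (_ : lam r * expR ((1 - N%:R) * (log_m1 s - log_m1 r)) *
  (m 2 r * expR (N%:R * (log_m1 s - log_m1 r))) <= _).
  by rewrite ler_wpM2l ?h// mulr_ge0 ?expR_ge0// ltW// lam_gt0.
rewrite mulrACA lamM// -expRD -mulrDl subrK mul1r expRB !log_m1K//.
by rewrite mulrCA divff ?mulr1// gt_eqF// m_gt0.
Qed.

(** Up to the radius where m_1 has grown by the factor e, lam keeps a fixed
    proportion of its value, so ln r gains at least a multiple of lam along
    the way. *)
Lemma exp_moment : exists2 k, 0 < k & at_radius (fun r =>
  in_rho (r * expR (k * lam r)) /\ m 1 (r * expR (k * lam r)) <= expR 1 * m 1 r).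
Proof.
have [N N1 h] := lam_lower; exists (expR (1 - N)); first exact: expR_gt0.
apply: at_radius_mono h => r rr h; have [_ r0] := rr.
have a0 := m_gt0 1 rr; have l0 := lam_gt0 rr.
have [s ss es] := m1_onto (mulr_gt0 (expR_gt0 1) a0).
have [_ s0] := ss.
have xs : log_m1 s = 1 + log_m1 r by rewrite /log_m1 es lnM ?posrE ?expR_gt0// expRK.
have rs : r < s by apply: (log_m1_lt_inv c_ge0 c_ex ac rr ss); rewrite xs; lra.
have [hl _] := h s ss (ltW rs).
have D := ln_r_ge c_ge0 c_ex ac rr ss.
rewrite xs addrK mulr1 in hl; rewrite xs addrK mulr1 in D.
have le_s : r * expR (expR (1 - N) * lam r) <= s.
  rewrite -ler_ln ?posrE ?mulr_gt0 ?expR_gt0// lnM ?posrE ?expR_gt0// expRK.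
  rewrite mulrC; lra.
have rr' : in_rho (r * expR (expR (1 - N) * lam r)).
  by apply: pos_range_le le_s ss; rewrite mulr_gt0 ?expR_gt0.
by split => //; rewrite -es; exact: m_mono.
Qed.

(** Weights with k of order 1 / lam(s) carry most of the fitted part at s. At
    r they satisfy lam(r) k <= 1/2, hence are badly fitted, while each has
    been multiplied by e^(k (ln r - ln s)), a power of m_1(r) / m_1(s). Small
    k is excluded by comparing s with an earlier radius t at which m_1 was e^4
    times smaller. *)
Lemma residual_after_drop : exists2 k, 0 < k & at_radius (fun s => forall r, in_rho r -> s <= r ->
  lam s = 8 * lam r -> fitted s * expR (k * (log_m1 r - log_m1 s)) <= 32 * residual r).
Proof.
have [N N1 [r0 rr0 h]] := lam_lower.
(* al (ln s - ln t) <= lam(s) / 2 for the radius t with m_1(t) = e^(-4)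
   m_1(s): this is the worst case of the decay of lam over 4 units of ln m_1.
   *)
pose al := expR (- (4 * (N - 1))) / 8.
have al0 : 0 < al by rewrite divr_gt0 ?expR_gt0.
exists (al / 8); first by rewrite divr_gt0.
have [r1 rr1 h1] := log_m1_large (log_m1 r0 + 4).
exists (Num.max r0 r1); first by case: (leP r0 r1).
move=> s ss; rewrite ge_max => /andP[r0s /h1 -/(_ ss) xs] r rr sr ls.
have [_ s0] := ss; have [_ r_0] := rr.
have a0 := m_gt0 1 ss; have l0 := lam_gt0 ss; have b0 := m_gt0 2 ss.
have [t tt et] := m1_onto (mulr_gt0 (expR_gt0 (- 4)) a0).
have xt : log_m1 t = log_m1 s - 4 by rewrite /log_m1 et lnM ?posrE ?expR_gt0// expRK addrC.
have r0t : r0 <= t.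
  rewrite leNgt; apply/negP => /(log_m1_lt c_ge0 c_ex ac tt rr0); lra.
have ts : t <= s by rewrite ltW// (log_m1_lt_inv c_ge0 c_ex ac tt ss)//; lra.
have lt0 := lam_gt0 tt.
have [hl _] := h t tt r0t s ss ts.
have D3 := ln_r_le c_ge0 c_ex ac tt ss.
have D := ln_r_ge c_ge0 c_ex ac ss rr.
have [_ t0] := tt.
set D3v := ln s - ln t in D3; set Dv := ln r - ln s in D.
have es : s * expR (- D3v) = t.
  by rewrite /D3v opprB expRB !lnK ?posrE// mulrCA divff ?mulr1// gt_eqF.
have er : s * expR Dv = r.
  by rewrite /Dv expRB !lnK ?posrE// mulrCA divff ?mulr1// gt_eqF.
have Tge0 : 0 <= log_m1 r - log_m1 s by rewrite subr_ge0 log_m1_le.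
set T := log_m1 r - log_m1 s in D Tge0 *.
have alD : al * D3v <= lam s / 2.
  rewrite (_ : log_m1 s - log_m1 t = 4) in hl D3; last by rewrite xt; lra.
  have : al * D3v <= al * (lam t * 4) by rewrite ler_wpM2l// ltW.
  have -> : al * (lam t * 4) = lam t * expR ((1 - N) * 4) / 2.
    by rewrite /al (_ : - (4 * (N - 1)) = (1 - N) * 4); [lra|ring].
  lra.
have s1 := msum ac 1 ss; have s2 := msum ac 2 ss.
have s3 := msum_exp ac 1 (D := - D3v) ss; rewrite es in s3.
have {}s3 := s3 tt.
have lhs := sums_toZ (1 / 16 * expR (al / 8 * T)) (sums_toB (sums_toB
  (sums_toZ (lam s) s1) (sums_toZ (lam s ^+ 2 / 4) s2))
  (sums_toZ (expR (1 / 2) * lam s) s3)).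
have rhs := residual_sum c_ge0 c_ex ac rr.
(* The bracket is at least half of m_1^2 / m_2 at s: its three terms are 1,
   1/4 and at most 1/4 times that quantity, as e^(1/2 - 4) <= 1/4. *)
suff key : 1 / 16 * expR (al / 8 * T) * (lam s * m 1 s - lam s ^+ 2 / 4 * m 2 s
    - expR (1 / 2) * lam s * m 1 t) <= residual r.
  have q0 : 0 <= fitted s by rewrite /fitted divr_ge0// ?sqr_ge0// ltW.
  have e72 := @expR_neg72_le R.
  have -> : fitted s * expR (al / 8 * T) = 32 * (1 / 16 * expR (al / 8 * T) * (fitted s / 2)).
    by field.
  rewrite ler_wpM2l//; apply: le_trans key; rewrite ler_wpM2l//.
  have -> : lam s ^+ 2 / 4 * m 2 s = fitted s / 4.
    by rewrite /fitted /lam; field; rewrite gt_eqF.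
  have -> : expR (1 / 2) * lam s * m 1 t = expR (1/2) * expR (-4) * fitted s.
    by rewrite et (fittedE c ss); ring.
  rewrite -(fittedE c ss).
  have : expR (1/2) * expR (-4) * fitted s <= 1/4 * fitted s by rewrite ler_wpM2r.
  lra.
apply: sums_to_le lhs rhs => k; have w0 := mass_ge0 c_ge0 k ss.
have -> : c k * r ^+ k = c k * s ^+ k * expR (k%:R * Dv).
  by rewrite -er exprMn -expRM_natl mulrA.
set w := c k * s ^+ k in w0 *; set mu := lam s * k%:R.
have mu0 : 0 <= mu by rewrite mulr_ge0// ltW.
have lr : lam r * k%:R = mu / 8 by rewrite /mu ls; field.
have -> : 1 / 16 * expR (al / 8 * T) * (lam s * (w * k%:R ^+ 1) - lam s ^+ 2 / 4 * (w * k%:R ^+ 2)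
   - expR (1 / 2) * lam s * (w * expR (k%:R * - D3v) * k%:R ^+ 1))
  = w * (1 / 16 * expR (al / 8 * T) * (mu - mu ^+ 2 / 4
     - mu * (expR (1/2) * expR (k%:R * - D3v)))).
  by rewrite /mu; field.
rewrite -[leRHS]mulrA ler_wpM2l// lr -expRD mulrN.
apply: drop_bound => //.
  by rewrite -lr mulrAC mulrC ler_wpM2l// mulrC.
move=> mal.
have : mu * D3v <= al * D3v.
  by rewrite ler_wpM2r ?(ltW mal)// /D3v subr_ge0 ler_ln.
have -> : mu * D3v = lam s * (k%:R * D3v) by rewrite /mu mulrA.
by move=> /le_trans/(_ alD); rewrite ler_pM2l// mul1r.
Qed.

(** If lam >= l, then ln r >= l ln m_1 up to a constant. For two indices j <
    j' with nonzero coefficients, 1 - lam j and 1 - lam j' differ by at least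
    l, so that one of them is at least l / 2 in absolute value and already
    gives a residual of order r. *)
Lemma residual_large_lam_ge A l : 0 < A -> 0 < l ->
  (forall r, in_rho r -> l <= lam r) -> at_radius (fun r => A * log_m1 r ^+ 2 <= residual r).
Proof.
move=> A0 l0 hl; have [j [j' [/andP[j1 jj'] cj cj']]] := c_two.
have [r1 rr1 _] := log_m1_large 0.
have [_ r10] := rr1.
pose cm := Num.min (c j) (c j').
have cm0 : 0 < cm by rewrite lt_min cj cj'.
pose K := cm * l ^+ 2 / 4 * (r1 * expR (- (l * log_m1 r1))).
have K0 : 0 < K by rewrite !mulr_gt0 ?expR_gt0// exprn_gt0.
have [X hX] := exp_beats_sq l0 (ltW (divr_gt0 A0 K0)).
have [r2 rr2 h2] := log_m1_large (Num.max X (log_m1 r1 - ln r1 / l)).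
exists (Num.max r1 r2); first by case: (leP r1 r2).
move=> r rr; rewrite ge_max => /andP[r1r r2r].
have := h2 r rr r2r; rewrite ge_max => /andP[xX xl].
have [_ r0] := rr.
have D := ln_r_ge c_ge0 c_ex ac rr1 rr.
have xx : 0 <= log_m1 r - log_m1 r1 by rewrite subr_ge0 log_m1_le.
have hr : l * (log_m1 r - log_m1 r1) + ln r1 <= ln r.
  have : l * (log_m1 r - log_m1 r1) <= lam r * (log_m1 r - log_m1 r1) by rewrite ler_wpM2r// hl.
  lra.
have rge1 : 1 <= r.
  rewrite -ler_ln ?posrE// ln1; apply: le_trans hr.
  have : l * (log_m1 r1 - ln r1 / l) <= l * log_m1 r by rewrite ler_wpM2l// ltW.
  by rewrite mulrBr mulrCA divff ?gt_eqF// mulr1; lra.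
have rgeE : r1 * expR (- (l * log_m1 r1)) * expR (l * log_m1 r) <= r.
  rewrite -mulrA -expRD -[leRHS]lnK ?posrE// -{1}(lnK (x := r1)) ?posrE// -expRD.
  rewrite ler_expR; lra.
(* A single index i >= 1 that is badly fitted gives a residual of order r. *)
have hw i : (1 <= i)%N -> cm <= c i -> l ^+ 2 / 4 <= (1 - lam r * i%:R) ^+ 2 ->
    cm * l ^+ 2 / 4 * r <= residual r.
  move=> i1 ci hi.
  have h k : 0 <= c k * r ^+ k * (1 - lam r * k%:R) ^+ 2.
    by rewrite mulr_ge0 ?sqr_ge0// mulr_ge0// exprn_ge0// ltW.
  apply: le_trans (sums_to_term i h (residual_sum c_ge0 c_ex ac rr)).
  have -> : cm * l ^+ 2 / 4 * r = cm * r * (l ^+ 2 / 4) by ring.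
  have l2 : 0 <= l ^+ 2 / 4 by rewrite divr_ge0// sqr_ge0.
  apply: ler_pM => //; first by rewrite mulr_ge0 ?ltW.
  apply: ler_pM => //; [exact: ltW|exact: ltW|].
  by case: i i1 {ci hi} => // i _; rewrite exprS ler_peMr ?exprn_ege1// ltW.
have main : cm * l ^+ 2 / 4 * r <= residual r.
  have lr := hl r rr.
  set u := 1 - lam r * j%:R; set u' := 1 - lam r * j'%:R.
  have uu : l <= u - u'.
    rewrite (_ : u - u' = lam r * (j'%:R - j%:R)); last by rewrite /u /u'; ring.
    have : 1 <= j'%:R - j%:R :> R by rewrite lerBrDr nat1r ler_nat.
    move=> h1; apply: le_trans lr _; rewrite ler_peMr// ltW// lam_gt0//.
  have [hu|hu] := leP (l / 2) u.
    apply: (hw j) => //; first by rewrite /cm ge_min lexx.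
    rewrite -/u; nra.
  apply: (hw j'); first exact: leq_trans j1 (ltnW jj').
    by rewrite /cm ge_min lexx orbT.
  rewrite -/u'; nra.
apply: le_trans main; apply: le_trans (_ : K * expR (l * log_m1 r) <= _).
  have := hX _ xX; rewrite mulrAC ler_pdivrMr//; lra.
by rewrite /K -mulrA ler_wpM2l// divr_ge0// mulr_ge0 ?sqr_ge0// ltW.
Qed.

Lemma lam_continuous r s : in_rho r -> in_rho s -> {within `[r, s], continuous lam}.
Proof.
move=> rr ss; have r0 : 0 < r by case: rr.
apply: derivable_within_continuous => z; rewrite in_itv/= => /andP[rz zs].
have zz : in_rho z by apply: pos_range_le zs ss; exact: lt_le_trans rz.
have d1 := is_derive_m ac 1 zz; have d2 := is_derive_m ac 2 zz.
apply: derivableM; first exact: ex_derive.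
by apply: derivableV; [rewrite gt_eqF// m_gt0 | exact: ex_derive].
Qed.

(** When lam tends to 0, the intermediate value theorem provides s with lam(s)
    = 8 lam(r). If ln m_1(s) < ln m_1(r) / 2, the exponential factor of
    [residual_after_drop] wins. Otherwise v(s) <= v(r) and m_1^2 / m_2 (s) <= 32
    v(r) add up to m_0(s), which [m0_large] bounds below. *)
Lemma residual_large A : 0 < A -> at_radius (fun r => A * log_m1 r ^+ 2 <= residual r).
Proof.
move=> A0.
(* lam is nonincreasing, so it is bounded below by a positive constant or
   tends to 0. *)
have [[l [l0 hl]]|nl] := pselect (exists l, 0 < l /\ forall r, in_rho r -> l <= lam r).
  exact: residual_large_lam_ge hl.
have lam_small l : 0 < l -> exists2 r, in_rho r & lam r < l.
  move=> l0; apply: contrapT => h; apply: nl; exists l; split => // r rr.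
  by rewrite leNgt; apply/negP => hr; apply: h; exists r.
have A132 : 0 < 132 * A by lra.
have [k k0 hd] := residual_after_drop.
have [r1 rr1 h1] := at_radius_and (at_radius_and hd (m0_large A132))
  (at_radius_and (log_m1_large 1) (fitted_large ltr01)).
have A32 : 0 <= 32 * A by lra.
have k2 : 0 < k / 2 by rewrite divr_gt0.
have [X hX] := exp_beats_sq k2 A32.
have [r3 rr3 h3] := log_m1_large X.
have l8 : 0 < lam r1 / 8 by rewrite divr_gt0// lam_gt0.
have [r2 rr2 l2] := lam_small _ l8.
exists (Num.max r1 (Num.max r2 r3)); first by case: leP => // _; case: leP.
move=> r rr; rewrite !ge_max => /and3P[r1r r2r r3r].
have lr := lam_gt0 rr.
have lr2 := lam_noninc c_ge0 c_ex ac rr2 rr r2r.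
have [s s1 ls] : exists2 s, s \in `[r1, r] & lam s = 8 * lam r.
  apply: IVT => //; first exact: lam_continuous.
  have lr1 : lam r <= lam r1 by lra.
  by rewrite (min_idPr lr1) (max_idPl lr1); lra.
move: s1; rewrite in_itv/= => /andP[r1s sr].
have ss : in_rho s by apply: pos_range_le sr rr; case: rr1 => _ /lt_le_trans; apply.
have [[hdr hm] [x1 hq]] := h1 s ss r1s.
have v1 := hdr r rr sr ls.
have v2 := residual_mono c_ge0 c_ex ac rr ss sr.
have vqs := residual_fitted c s.
have xs_r := log_m1_le ss rr sr.
have xX := h3 r rr r3r.
have q1 : 1 <= fitted s by lra.
have e1 : expR (k * (log_m1 r - log_m1 s)) <= 32 * residual r.
  by apply: le_trans v1; rewrite ler_peMl// expR_ge0.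
have [hx|hx] := leP (log_m1 r / 2) (log_m1 s).
  have : fitted s <= 32 * residual r.
    apply: le_trans v1; rewrite ler_peMr//; first lra.
    by rewrite -[leLHS]expR0 ler_expR mulr_ge0 ?subr_ge0// ltW.
  have : (log_m1 r / 2) ^+ 2 <= log_m1 s ^+ 2 by rewrite lerXn2r ?nnegrE//; lra.
  rewrite expr_div_n; nra.
have : expR (k / 2 * log_m1 r) <= expR (k * (log_m1 r - log_m1 s)).
  rewrite ler_expR (_ : k / 2 * log_m1 r = k * (log_m1 r / 2)); last by rewrite mulrAC mulrA.
  rewrite ler_wpM2l ?(ltW k0)//; lra.
by move=> /le_trans/(_ e1)/(le_trans (hX _ xX)); rewrite -mulrA ler_pM2l.
Qed.

(** Keeping at s the optimal t of r, the weights are multiplied by at most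
    e^(lam(r) k h) with h = ln m_1(s) - ln m_1(r). Those with lam(r) k of
    order ln m_1 cost the factor 1 + O(h ln m_1); the contribution of larger k
    is controlled by [exp_moment] and is O(h), negligible since v >= 1. *)
Lemma residual_ratio : exists2 C, 0 < C & at_radius (fun r => forall s, in_rho s -> r <= s ->
  C * (log_m1 s - log_m1 r) * log_m1 r <= 1 ->
  residual s <= residual r * (1 + C * (log_m1 s - log_m1 r) * log_m1 r)).
Proof.
have [k k0 hk] := exp_moment.
have kV : 0 < k^-1 by rewrite invr_gt0.
pose C' := 32 / k ^+ 2.
have C'0 : 0 < C' by rewrite divr_gt0// exprn_gt0.
(* 8 / k is the cost of the bulk of the weights (4 M h with M = 2 x / k), 4 C'
   that of the tail. *)
pose C := 8 / k + 4 * C'.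
have C0 : 0 < C by rewrite /C; have : 0 < 8 / k; [rewrite divr_gt0 | lra].
exists C => //.
apply: at_radius_mono (at_radius_and hk (at_radius_and (log_m1_large (1 + k)) (residual_large ltr01))).
move=> r rr [[rr' hm] [x1 v1]] s ss rs.
set h := log_m1 s - log_m1 r; set x := log_m1 r in x1 v1 *.
have h0 : 0 <= h by rewrite subr_ge0 log_m1_le.
have x1' : 1 <= x by lra.
have vge1 : 1 <= residual r by apply: le_trans v1; rewrite mul1r expr2; nra.
move=> Ch.
have hx0 : 0 <= h * x by rewrite mulr_ge0//; lra.
have kC : 8 / k * (h * x) <= 1.
  by apply: le_trans Ch; rewrite -[leRHS]mulrA ler_wpM2r// /C lerDl mulr_ge0// ltW.
pose M := 2 * x / k.
have Mh : M * h <= 1.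
  rewrite /M; have -> : 2 * x / k * h = 1/4 * (8 / k * (h * x)) by field; rewrite gt_eqF.
  by move: kC; set y := 8 / k * (h * x); lra.
have M1 : 1 <= M by rewrite /M ler_pdivlMr//; lra.
have h4 : h <= k / 4.
  have : 8 / k * h <= 1.
    have k8 : 0 <= 8 / k by rewrite divr_ge0// ltW.
    by apply: le_trans kC; apply: ler_wpM2l => //; rewrite ler_peMr.
  rewrite mulrAC ler_pdivrMr// mul1r; lra.
have [_ r0] := rr; have [_ s0] := ss.
have D := ln_r_le c_ge0 c_ex ac rr ss; rewrite -/h in D.
set Dv := ln s - ln r in D.
have er : r * expR Dv = s.
  by rewrite /Dv expRB !lnK ?posrE// mulrCA divff ?mulr1// gt_eqF.
have l0 := lam_gt0 rr.
have s1 := residual_sum c_ge0 c_ex ac rr.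
have s2 := msum_exp ac 1 (D := k * lam r) rr rr'.
(* At s the suboptimal multiplier lam(r) is kept. *)
have lhs := quad_sum ac (lam r) ss.
have rhs := sums_toD (sums_toZ (1 + 4 * M * h) s1)
  (sums_toZ (h * C' * expR (- x) * lam r) s2).
suff key : residual s <= (1 + 4 * M * h) * residual r + h * C' * expR (- x) * lam r * m 1 (r * expR (k * lam r)).
  apply: le_trans key _; rewrite mulrDl mul1r [leRHS]mulrDr mulr1 -addrA lerD2l.
  have ll := lam_le1 c_ge0 c0 c_ex ac rr.
  have : h * C' * expR (- x) * lam r * m 1 (r * expR (k * lam r)) <= h * C' * expR (- x) * 1 * (4 * m 1 r).
    have a0 := m_gt0 1 rr.
    have p0 := mulr_ge0 (mulr_ge0 h0 (ltW C'0)) (expR_ge0 (- x)).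
    apply: ler_pM; [exact: mulr_ge0 p0 (ltW l0) | exact: ltW (m_gt0 1 rr') | |].
      exact: ler_wpM2l.
    by apply: le_trans hm _; rewrite ler_wpM2r ?(ltW a0)//; exact: expR1_le4.
  have -> : h * C' * expR (- x) * 1 * (4 * m 1 r) = 4 * C' * h.
    by rewrite -(log_m1K rr) -/x expRN; field; rewrite gt_eqF// expR_gt0.
  move=> h5.
  have -> : residual r * (C * h * x) = (8 / k * (h * x)) * residual r + 4 * C' * (h * x) * residual r.
    by rewrite /C; ring.
  have -> : 4 * M * h * residual r = 8 / k * (h * x) * residual r.
    by rewrite /M; field; rewrite gt_eqF.
  rewrite lerD2l; apply: le_trans h5 _.
  have : 1 <= x * residual r by nra.
  have C'h : 0 <= 4 * C' * h := mulr_ge0 (mulr_ge0 (ler0n _ 4) (ltW C'0)) h0.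
  move=> /(ler_wpM2l C'h); rewrite mulr1 => /le_trans; apply.
  by rewrite le_eqVlt; apply/orP; left; apply/eqP; ring.
apply: le_trans (residual_min c_ge0 c_ex ac (lam r) ss) _.
apply: sums_to_le lhs rhs => i; have w0 := mass_ge0 c_ge0 i rr.
rewrite -er exprMn -expRM_natl.
rewrite [c i * (_ * _)]mulrA; set w := c i * r ^+ i in w0 *.
set mu := lam r * i%:R.
have mu0 : 0 <= mu by rewrite mulr_ge0// ltW.
have iD : i%:R * Dv <= mu * h.
  have -> : mu * h = i%:R * (lam r * h) by rewrite /mu; ring.
  by rewrite ler_wpM2l.
have ik : i%:R * (k * lam r) = k * mu by rewrite /mu; ring.
rewrite expr1 ik.
have -> : (1 + 4 * M * h) * (w * (1 - mu) ^+ 2) +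
    h * C' * expR (- x) * lam r * (w * expR (k * mu) * i%:R)
  = w * ((1 + 4 * M * h) * (1 - mu) ^+ 2 + h * C' * expR (- x) * mu * expR (k * mu)).
  by rewrite /mu; ring.
rewrite -[leLHS]mulrA ler_wpM2l//.
apply: le_trans (_ : expR (mu * h) * (1 - mu) ^+ 2 <= _).
  by rewrite ler_wpM2r ?sqr_ge0// ler_expR.
exact: ratio_bound.
Qed.

End Variance.

(** * Cauchy products *)

Section CauchyProduct.
Variable R : realType.
Implicit Types (F : nat -> nat -> R) (N : nat).

Definition square_sum F N := \sum_(0 <= j < N) \sum_(0 <= k < N) F j k.
Definition triangle_sum F N :=
  \sum_(0 <= n < N) \sum_(0 <= j < n.+1) F j (n - j)%N.

Lemma triangle_sumE F N : triangle_sum F N =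
  \sum_(0 <= j < N) \sum_(0 <= k < N) (if (j + k < N)%N then F j k else 0).
Proof.
rewrite /triangle_sum.
transitivity (\sum_(0 <= n < N) \sum_(0 <= j < N) (if (j <= n)%N then F j (n - j)%N else 0)).
  apply: eq_big_nat => n /andP[_ nN].
  by rewrite (big_nat_widen 0 n.+1 N)//= big_mkcond.
rewrite exchange_big_nat/=; apply: eq_big_nat => j /andP[_ jN].
rewrite (@big_cat_nat _ _ _ j)//=; last exact: ltnW.
rewrite big_nat big1 ?add0r; last by move=> i /andP[_ ij]; rewrite leqNgt ij.
rewrite [RHS](@big_cat_nat _ _ _ (N - j))//=; last exact: leq_subr.
rewrite [X in _ = _ + X]big_nat [X in _ = _ + X]big1 ?addr0; last first.
  by move=> i /andP[ij _]; rewrite ltnNge -leq_subLR ij.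
rewrite -{1}(add0n j) big_addn; apply: eq_big_nat => i /andP[_ ij].
by rewrite leq_addl addnK -ltn_subRL ij.
Qed.

Lemma triangle_le_square F N : (forall j k, 0 <= F j k) ->
  triangle_sum F N <= square_sum F N.
Proof.
move=> F0; rewrite triangle_sumE; apply: ler_sum => j _; apply: ler_sum => k _.
by case: ifP.
Qed.

Lemma square_le_triangle F N : (forall j k, 0 <= F j k) ->
  square_sum F N <= triangle_sum F (N + N).
Proof.
move=> F0; rewrite triangle_sumE [leRHS](@big_cat_nat _ _ _ N)//= ?leq_addl//.
rewrite -[leLHS]addr0; apply: lerD; last first.
  by apply: sumr_ge0 => j _; apply: sumr_ge0 => k _; case: ifP.
rewrite /square_sum !big_nat; apply: ler_sum => j /andP[_ jN].
rewrite [leRHS](@big_cat_nat _ _ _ N)//= ?leq_addl//.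
rewrite -[leLHS]addr0; apply: lerD; last by apply: sumr_ge0 => k _; case: ifP.
rewrite !big_nat; apply: ler_sum => k /andP[_ kN]; case: ifPn => //.
by move=> /negP h; exfalso; apply: h; lia.
Qed.

(** A dominated array loses no more than its majorant when a square of indices
    is cut down to a triangle. Both sides are sums over the same missing
    indices. *)
Lemma triangle_square_dist F G N : (forall j k, `|G j k| <= F j k) ->
  `|square_sum G N - triangle_sum G N| <= square_sum F N - triangle_sum F N.
Proof.
move=> GF; rewrite !triangle_sumE /square_sum -!sumrB.
apply: le_trans (ler_norm_sum _ _ _) _; apply: ler_sum => j _.
rewrite -!sumrB; apply: le_trans (ler_norm_sum _ _ _) _; apply: ler_sum => k _.
by case: ifP; rewrite ?subrr ?normr0// !subr0.
Qed.

Lemma square_sumE (a b : nat -> R) N :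
  square_sum (fun j k => a j * b k) N = series a N * series b N.
Proof.
rewrite /square_sum /series /= mulr_suml; apply: eq_bigr => j _.
by rewrite mulr_sumr.
Qed.

(** Mertens' theorem for a dominated array G in place of the product array,
    which serves for cos((j + k) phi) and sin((j + k) phi). *)
Lemma cauchy_twisted (a b : nat -> R) la lb (G : nat -> nat -> R) (l : R) :
  (forall k, 0 <= a k) -> (forall k, 0 <= b k) ->
  sums_to a la -> sums_to b lb ->
  (forall j k, `|G j k| <= a j * b k) -> square_sum G @ \oo --> l ->
  sums_to (fun n => \sum_(0 <= j < n.+1) G j (n - j)%N) l.
Proof.
move=> a0 b0 [sa] [sb] Gab Gl; pose F j k := a j * b k.
have F0 j k : 0 <= F j k by exact: mulr_ge0.
have sF : square_sum F @ \oo --> la * lb.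
  rewrite (_ : square_sum F = fun N => series a N * series b N); first exact: cvgM.
  by apply/funext => N; rewrite square_sumE.
have tmono : nondecreasing_seq (triangle_sum F).
  apply/nondecreasing_seqP => N; rewrite /triangle_sum [leRHS]big_nat_recr//= lerDl.
  by apply: sumr_ge0 => j _.
have sle N : square_sum F N <= la * lb.
  rewrite square_sumE; apply: ler_pM; try exact: sumr_ge0.
    exact: sums_to_partial a0 (SumsTo sa).
  exact: sums_to_partial b0 (SumsTo sb).
have tF : triangle_sum F @ \oo --> la * lb.
  apply/cvgrPdist_lt => e e0.
  have [N _ hN] := proj1 (cvgrPdist_lt _ _) sF e e0.
  exists (N + N)%N => // M /= NM.
  have h1 := hN N (leqnn N); have h2 := square_le_triangle N F0.
  have h3 := tmono _ _ NM; have h4 := triangle_le_square M F0; have h5 := sle M.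
  rewrite ger0_norm in h1; last by rewrite subr_ge0.
  rewrite ger0_norm; last by rewrite subr_ge0 (le_trans h4).
  lra.
have tG : triangle_sum G @ \oo --> l.
  have d0 : square_sum F N - triangle_sum F N @[N --> \oo] --> 0.
    by rewrite -(subrr (la * lb)); exact: cvgB.
  have dG : square_sum G N - triangle_sum G N @[N --> \oo] --> 0.
    apply/cvgr0Pnorm_lt => e e0.
    have [N _ hN] := proj1 (cvgr0Pnorm_lt _) d0 e e0.
    exists N => // M NM; apply: le_lt_trans (hN M NM).
    apply: le_trans (triangle_square_dist M Gab) _; exact: ler_norm.
  rewrite -(subr0 l) (_ : triangle_sum G = fun N =>
    square_sum G N - (square_sum G N - triangle_sum G N)); first exact: cvgB.
  by apply/funext => N; rewrite subKr.
by split.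
Qed.

End CauchyProduct.

(** * Coefficients of exp(u g) on circles *)

Section ExpSeries.
Variables (R : realType) (c : nat -> R) (rho : \bar R) (u : R) (h : nat -> R).
Hypothesis c_ge0 : forall k, 0 <= c k.
Hypothesis c0 : c 0%N = 0.
Hypothesis ac : abs_on rho c.
Hypothesis u_ge0 : 0 <= u.
Hypothesis h_ge0 : forall k, 0 <= h k.
Hypothesis h0 : h 0%N = 1.
Hypothesis h_rec : forall n, n%:R * h n =
  u * \sum_(0 <= j < n.+1) dcoef c j * h (n - j)%N.
Implicit Types r phi : R.

Lemma dcoef_ge0 j : 0 <= dcoef c j.
Proof. by rewrite mulr_ge0. Qed.

Lemma h_rec_pow r n : n%:R * (h n * r ^+ n) =
  u * \sum_(0 <= j < n.+1) (dcoef c j * r ^+ j) * (h (n - j)%N * r ^+ (n - j)).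
Proof.
rewrite mulrA h_rec -mulrA mulr_suml; congr (_ * _).
apply: eq_big_nat => j /andP[_ jn]; rewrite mulrACA -exprD subnKC//.
Qed.

(** Summing the recursion bounds sum_(n < N) n h_n r^n by u a P_N, where P_N
    is a partial sum of sum h_n r^n. For n >= K > 2 u a the factor n shows
    that these terms carry at most half of P_N, whence P_N <= 2 P_K. *)
Lemma abs_on_h : abs_on rho h.
Proof.
split => r rr; have r0 : 0 <= r by case: rr.
pose P := series (fun k => h k * r ^+ k).
have hr0 k : 0 <= h k * r ^+ k by rewrite mulr_ge0 ?exprn_ge0.
have dr0 k : 0 <= dcoef c k * r ^+ k by rewrite mulr_ge0 ?exprn_ge0// dcoef_ge0.
have P0 N : 0 <= P N by exact: sumr_ge0.
have sa := psum_sums (abs_on_dcoef ac) rr; set a := psum _ _ in sa.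
have a0 : 0 <= a by exact: sums_to_ge0 sa.
have Pmono : nondecreasing_seq P.
  by apply/nondecreasing_seqP => N; rewrite /P /series /= big_nat_recr//= lerDl.
have hT N : \sum_(0 <= n < N) n%:R * (h n * r ^+ n) <= u * (a * P N).
  under eq_bigr do rewrite h_rec_pow.
  rewrite -mulr_sumr ler_wpM2l//.
  have := @triangle_le_square R (fun j k => (dcoef c j * r ^+ j) * (h k * r ^+ k)) N
    (fun j k => mulr_ge0 (dr0 j) (hr0 k)).
  move=> /le_trans; apply; rewrite square_sumE ler_wpM2r//.
  exact: sums_to_partial dr0 sa.
(* Indices n >= K satisfy n >= 2 u a. *)
pose K := Num.bound (2 * (u * a)).
have KE : 2 * (u * a) < K%:R by apply: archi_boundP; rewrite mulr_ge0// mulr_ge0.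
have bnd N : P N <= 2 * P K.
  have [NK|KN] := leqP N K.
    by apply: le_trans (Pmono _ _ NK) _; rewrite ler_peMl// ler1n.
  have : K%:R * (P N - P K) <= u * (a * P N).
    apply: le_trans (hT N).
    rewrite /P /series /= (@big_cat_nat _ _ _ K 0 N)//=; last exact: ltnW.
    rewrite [X in _ * X]addrC addKr (@big_cat_nat _ _ _ K 0 N)//=; last exact: ltnW.
    rewrite -[leLHS]add0r; apply: lerD; first by apply: sumr_ge0 => k _; rewrite mulr_ge0.
    rewrite mulr_sumr !big_nat; apply: ler_sum => k /andP[Kk _].
    by rewrite ler_wpM2r// ler_nat.
  have K0 : 0 < K%:R :> R by apply: le_lt_trans KE; rewrite mulr_ge0// mulr_ge0.
  have : 2 * (u * a) * P N <= K%:R * P N by rewrite ler_wpM2r// ltW.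
  move=> h1 h2; rewrite -(ler_pM2l K0); lra.
rewrite /pseries (_ : (fun i => `|h i| * r ^+ i) = fun k => h k * r ^+ k); last first.
  by apply/funext => k; rewrite ger0_norm.
by apply: nondecreasing_is_cvgn => //; exists (2 * P K) => _ [N _ <-].
Qed.

Let X r phi := psum (fun k => h k * cos (k%:R * phi)) r.
Let Y r phi := psum (fun k => h k * sin (k%:R * phi)) r.
Let U1 r phi := psum (dcoef (fun k => c k * cos (k%:R * phi))) r.
Let V1 r phi := psum (dcoef (fun k => c k * sin (k%:R * phi))) r.

Lemma twisted_product r (G : nat -> nat -> R) l : in_range rho r ->
  (forall j k, `|G j k| <= (dcoef c j * r ^+ j) * (h k * r ^+ k)) ->
  square_sum G @ \oo --> l ->
  sums_to (fun n => u * \sum_(0 <= j < n.+1) G j (n - j)%N) (u * l).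
Proof.
move=> rr Gb Gl; have r0 : 0 <= r by case: rr.
apply: sums_toZ.
apply: cauchy_twisted (psum_sums (abs_on_dcoef ac) rr) (psum_sums abs_on_h rr) Gb Gl.
  by move=> k; rewrite mulr_ge0 ?exprn_ge0// dcoef_ge0.
by move=> k; rewrite mulr_ge0 ?exprn_ge0.
Qed.

(** Real part of the differential equation z H'(z) = u z g'(z) H(z) at z = r
    e^(i phi), where H is the power series with coefficients h; [ode_sin] is
    the imaginary part. *)
Lemma ode_cos r phi : in_range rho r ->
  psum (dcoef (fun k => h k * cos (k%:R * phi))) r
  = u * (U1 r phi * X r phi - V1 r phi * Y r phi).
Proof.
move=> rr; have r0 : 0 <= r by case: rr.
have ahc := abs_on_cos phi abs_on_h; have ahs := abs_on_sin phi abs_on_h.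
have acc := abs_on_dcoef (abs_on_cos phi ac).
have acs := abs_on_dcoef (abs_on_sin phi ac).
have [sX] := psum_sums ahc rr; have [sY] := psum_sums ahs rr.
have [sU] := psum_sums acc rr; have [sV] := psum_sums acs rr.
apply: sums_to_unique (psum_sums (abs_on_dcoef ahc) rr) _.
pose G j k := (dcoef c j * r ^+ j) * (h k * r ^+ k) * cos ((j + k)%:R * phi).
apply: (@sums_to_ext _ (fun n => u * \sum_(0 <= j < n.+1) G j (n - j)%N)); last first.
  move=> n; rewrite /dcoef mulrA [_ * (h n) ]mulrC.
  have := h_rec_pow r n; rewrite mulrA => hn.
  rewrite -!mulrA [cos _ * _]mulrC !mulrA [h n * _]mulrC hn -mulrA mulr_suml.
  congr (_ * _); apply: eq_big_nat => j /andP[_ jn].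
  by rewrite /G subnKC.
apply: (twisted_product rr).
  move=> j k; rewrite /G normrM ger0_norm; last first.
    by rewrite !mulr_ge0 ?exprn_ge0// dcoef_ge0.
  by rewrite ler_piMr ?cos_norm_le1// !mulr_ge0 ?exprn_ge0// dcoef_ge0.
rewrite (_ : square_sum G = fun N =>
    series (fun k => dcoef (fun k => c k * cos (k%:R * phi)) k * r ^+ k) N *
    series (fun k => h k * cos (k%:R * phi) * r ^+ k) N -
    series (fun k => dcoef (fun k => c k * sin (k%:R * phi)) k * r ^+ k) N *
    series (fun k => h k * sin (k%:R * phi) * r ^+ k) N).
  exact: cvgB (cvgM sU sX) (cvgM sV sY).
apply/funext => N; rewrite -!square_sumE /square_sum.
rewrite -sumrB; apply: eq_bigr => j _; rewrite -sumrB; apply: eq_bigr => k _.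
by rewrite /G /dcoef natrD mulrDl cosD; ring.
Qed.

Lemma ode_sin r phi : in_range rho r ->
  psum (dcoef (fun k => h k * sin (k%:R * phi))) r
  = u * (V1 r phi * X r phi + U1 r phi * Y r phi).
Proof.
move=> rr; have r0 : 0 <= r by case: rr.
have ahc := abs_on_cos phi abs_on_h; have ahs := abs_on_sin phi abs_on_h.
have acc := abs_on_dcoef (abs_on_cos phi ac).
have acs := abs_on_dcoef (abs_on_sin phi ac).
have [sX] := psum_sums ahc rr; have [sY] := psum_sums ahs rr.
have [sU] := psum_sums acc rr; have [sV] := psum_sums acs rr.
apply: sums_to_unique (psum_sums (abs_on_dcoef ahs) rr) _.
pose G j k := (dcoef c j * r ^+ j) * (h k * r ^+ k) * sin ((j + k)%:R * phi).
apply: (@sums_to_ext _ (fun n => u * \sum_(0 <= j < n.+1) G j (n - j)%N)); last first.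
  move=> n; rewrite /dcoef mulrA [_ * (h n) ]mulrC.
  have := h_rec_pow r n; rewrite mulrA => hn.
  rewrite -!mulrA [sin _ * _]mulrC !mulrA [h n * _]mulrC hn -mulrA mulr_suml.
  congr (_ * _); apply: eq_big_nat => j /andP[_ jn].
  by rewrite /G subnKC.
apply: (twisted_product rr).
  move=> j k; rewrite /G normrM ger0_norm; last first.
    by rewrite !mulr_ge0 ?exprn_ge0// dcoef_ge0.
  by rewrite ler_piMr ?sin_norm_le1// !mulr_ge0 ?exprn_ge0// dcoef_ge0.
rewrite (_ : square_sum G = fun N =>
    series (fun k => dcoef (fun k => c k * sin (k%:R * phi)) k * r ^+ k) N *
    series (fun k => h k * cos (k%:R * phi) * r ^+ k) N +
    series (fun k => dcoef (fun k => c k * cos (k%:R * phi)) k * r ^+ k) N *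
    series (fun k => h k * sin (k%:R * phi) * r ^+ k) N).
  exact: cvgD (cvgM sV sX) (cvgM sU sY).
apply/funext => N; rewrite -!square_sumE /square_sum /=.
rewrite -big_split; apply: eq_bigr => j _ /=; rewrite -big_split; apply: eq_bigr => k _.
by rewrite /G /dcoef natrD mulrDl sinD /=; ring.
Qed.

Lemma psum0 (f : nat -> R) : psum f 0 = f 0%N.
Proof.
apply: sums_toE; split; apply: cvg_near_cst.
exists 1%N => // n /= n1; rewrite /series /= big_ltn// expr0 mulr1 big_nat big1 ?addr0//.
by move=> i /andP[i1 _]; rewrite expr0n gtn_eqF//= mulr0.
Qed.

Lemma const_on_range (G : R -> R) r : in_range rho r ->
  (forall x, in_range rho x -> derivable G x 1) ->
  (forall x, in_range rho x -> 0 < x -> is_derive x (1 : R) G 0) ->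
  G r = G 0.
Proof.
move=> rr Gd dG0; have r0 : 0 <= r by case: rr.
have sub x : x \in `[0, r] -> in_range rho x.
  by rewrite in_itv/= => /andP[x0 xr]; exact: range_le xr rr.
have hd x : x \in `]0, r[ -> is_derive x (1 : R) G (cst 0 x).
  move=> log_m1; have := log_m1; rewrite in_itv/= => /andP[x0 xr].
  by apply: dG0 => //; apply: sub; exact: subset_itv_oo_cc.
have [x _ /eqP] := MVT_segment r0 hd
  (derivable_within_continuous (fun x log_m1 => Gd x (sub x log_m1))).
by rewrite mul0r subr_eq0 => /eqP.
Qed.

(** The identity H = exp(u g) at z = r e^(i phi), in real coordinates.
    Multiplying H by exp(- u g) gives two functions of r with zero derivative,
    whose values at r = 0 are 1 and 0. *)
Lemma exp_series r phi : in_range rho r ->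
  X r phi = expR (u * cosum c r phi) * cos (u * sinsum c r phi) /\
  Y r phi = expR (u * cosum c r phi) * sin (u * sinsum c r phi).
Proof.
move=> rr.
pose U := psum (fun k => c k * cos (k%:R * phi)).
pose V := psum (fun k => c k * sin (k%:R * phi)).
pose X' := psum (fun k => h k * cos (k%:R * phi)).
pose Y' := psum (fun k => h k * sin (k%:R * phi)).
have ahc := abs_on_cos phi abs_on_h; have ahs := abs_on_sin phi abs_on_h.
have acc := abs_on_cos phi ac; have acs := abs_on_sin phi ac.
pose E := fun x => expR (- u * U x).
pose C := fun x => cos (u * V x).
pose S := fun x => sin (u * V x).
(* G + i H is the product of X + i Y and exp(- u (U + i V)). *)
pose G : R -> R := E * (X' * C + Y' * S).
pose H : R -> R := E * (Y' * C - X' * S).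
have gen (x dU dV dX dY : R) : is_derive x (1 : R) U dU -> is_derive x (1 : R) V dV ->
    is_derive x (1 : R) X' dX -> is_derive x (1 : R) Y' dY ->
    is_derive x (1 : R) G (E x * ((dX - u * (dU * X' x - dV * Y' x)) * C x
       + (dY - u * (dV * X' x + dU * Y' x)) * S x)) /\
    is_derive x (1 : R) H (E x * ((dY - u * (dV * X' x + dU * Y' x)) * C x
       - (dX - u * (dU * X' x - dV * Y' x)) * S x)).
  move=> hU hV hX hY.
  have hE : is_derive x (1 : R) E (- u * dU * E x).
    have h1 := is_deriveZ (- u) hU.
    apply: (is_derive_eq (@is_derive1_comp R (@expR R) (fun x => - u * U x) x _ _ (is_derive_expR _) h1)).
    by rewrite /E /GRing.scale /=; ring.
  have hu := is_deriveZ u hV.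
  have hC : is_derive x (1 : R) C (u * dV * - sin (u * V x)).
    apply: (is_derive_eq (@is_derive1_comp R (@cos R) (fun x => u * V x) x _ _ (is_derive_cos _) hu)).
    by rewrite /GRing.scale /=; ring.
  have hS : is_derive x (1 : R) S (u * dV * cos (u * V x)).
    apply: (is_derive_eq (@is_derive1_comp R (@sin R) (fun x => u * V x) x _ _ (is_derive_sin _) hu)).
    by rewrite /GRing.scale /=; ring.
  split.
    apply: (is_derive_eq (is_deriveM hE (is_deriveD (is_deriveM hX hC) (is_deriveM hY hS)))).
    rewrite /GRing.scale /= !fctE /C /S /E; ring.
  apply: (is_derive_eq (is_deriveM hE (is_deriveB (is_deriveM hY hC) (is_deriveM hX hS)))).
  rewrite /GRing.scale /= !fctE /C /S /E; ring.
have der x : in_range rho x -> derivable G x 1 /\ derivable H x 1.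
  move=> xr; have [dG dH] := gen x _ _ _ _ (is_derive_psum_at acc xr)
    (is_derive_psum_at acs xr) (is_derive_psum_at ahc xr) (is_derive_psum_at ahs xr).
  by split; exact: ex_derive.
have der0 x : in_range rho x -> 0 < x -> is_derive x (1 : R) G 0 /\ is_derive x (1 : R) H 0.
  move=> xr x0; have [dG dH] := gen x _ _ _ _ (is_derive_psum acc xr x0)
    (is_derive_psum acs xr x0) (is_derive_psum ahc xr x0) (is_derive_psum ahs xr x0).
  have oc := ode_cos phi xr; have os := ode_sin phi xr.
  by split; [apply: (is_derive_eq dG)|apply: (is_derive_eq dH)];
    rewrite oc os /U1 /V1 /X /Y -/(X' x) -/(Y' x); field; rewrite gt_eqF.
have G1 : G r = 1.
  rewrite (const_on_range rr (fun x xr => (der x xr).1) (fun x xr x0 => (der0 x xr x0).1)).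
  rewrite /G /E /C /S !fctE /U /V /X' /Y' !psum0 c0 h0 !mul0r !mulr0 cos0 sin0 expR0.
  ring.
have H0 : H r = 0.
  rewrite (const_on_range rr (fun x xr => (der x xr).2) (fun x xr x0 => (der0 x xr x0).2)).
  rewrite /H /E /C /S !fctE /U /V /X' /Y' !psum0 c0 h0 !mul0r !mulr0 cos0 sin0 expR0.
  ring.
have e0 : expR (u * U r) * E r = 1 by rewrite /E mulNr expRxMexpNx_1.
have cs : C r ^+ 2 + S r ^+ 2 = 1 by exact: cos2Dsin2.
rewrite /G /H !fctE in G1 H0.
rewrite /cosum /sinsum /X /Y -/(U r) -/(V r) -/(X' r) -/(Y' r) -/(C r) -/(S r).
split.
  transitivity (X' r * (C r ^+ 2 + S r ^+ 2) * (expR (u * U r) * E r)).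
    by rewrite cs e0 !mulr1.
  transitivity (expR (u * U r) * ((E r * (X' r * C r + Y' r * S r)) * C r
    - (E r * (Y' r * C r - X' r * S r)) * S r)); first ring.
  by rewrite G1 H0 mul1r mul0r subr0.
transitivity (Y' r * (C r ^+ 2 + S r ^+ 2) * (expR (u * U r) * E r)).
  by rewrite cs e0 !mulr1.
transitivity (expR (u * U r) * ((E r * (X' r * C r + Y' r * S r)) * S r
  + (E r * (Y' r * C r - X' r * S r)) * C r)); first ring.
by rewrite G1 H0 mul1r mul0r addr0.
Qed.

End ExpSeries.

(** * Comparison of integrals with Gaussian integrals *)

Section RealIntegrable.
Context d (T : measurableType d) (R : realType) (mu : {measure set T -> \bar R}).
Implicit Types (f g : T -> R) (D : set T).

Lemma integrable_realZ D f (a : R) : measurable D -> mu.-integrable D (EFin \o f) ->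
  mu.-integrable D (EFin \o (fun x => a * f x)).
Proof.
move=> mD fi; have := integrableZl mD a fi.
by congr (mu.-integrable D _).
Qed.

Lemma integrable_realD D f g : measurable D -> mu.-integrable D (EFin \o f) ->
  mu.-integrable D (EFin \o g) -> mu.-integrable D (EFin \o (fun x => f x + g x)).
Proof.
move=> mD fi gi; have := integrableD mD fi gi.
by congr (mu.-integrable D _).
Qed.

Lemma integrable_realB D f g : measurable D -> mu.-integrable D (EFin \o f) ->
  mu.-integrable D (EFin \o g) -> mu.-integrable D (EFin \o (fun x => f x - g x)).
Proof.
move=> mD fi gi; have := integrableB mD fi gi.
by congr (mu.-integrable D _).
Qed.

End RealIntegrable.

Section FourierGauss.
Variable R : realType.
Notation mu := (@lebesgue_measure R).
Implicit Types (B x : R) (f g : R -> R).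

Definition gauss B x := expR (- (B * x ^+ 2 / 2)).

Lemma gaussE B : 0 < B ->
  gauss B = (fun x => Num.sqrt (2 * pi / B) * normal_pdf 0 (Num.sqrt B^-1) x).
Proof.
move=> B0; apply/funext => x.
have s0 : Num.sqrt B^-1 != 0 :> R by rewrite gt_eqF// sqrtr_gt0 invr_gt0.
rewrite normal_pdfE// /normal_peak /normal_fun subr0 sqr_sqrtr ?invr_ge0 ?ltW//.
rewrite mulrA (_ : B^-1 * pi *+ 2 = 2 * pi / B); last by rewrite -mulr_natl; ring.
rewrite divff ?mul1r; last first.
  by rewrite gt_eqF// sqrtr_gt0 divr_gt0// mulr_gt0// pi_gt0.
rewrite /gauss; congr expR; rewrite -mulr_natl; field; rewrite gt_eqF//.
Qed.

Lemma gauss_integrable B : 0 < B -> mu.-integrable setT (EFin \o gauss B).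
Proof.
move=> B0; rewrite (gaussE B0).
by apply: integrable_realZ => //; exact: integrable_normal_pdf.
Qed.

Lemma gauss_integral B : 0 < B -> \int[mu]_x gauss B x = Num.sqrt (2 * pi / B).
Proof.
move=> B0; rewrite (gaussE B0) RintegralZl//; last exact: integrable_normal_pdf.
by rewrite /Rintegral integral_normal_pdf mulr1.
Qed.

Let I : set R := `[- pi, pi]%classic.

Lemma integrable_I f : continuous f -> mu.-integrable I (EFin \o f).
Proof.
move=> cf; apply: continuous_compact_integrable; first exact: segment_compact.
exact: continuous_subspaceT.
Qed.

Lemma integral_I_cst (a : R) : \int[mu]_(x in I) a = 2 * pi * a.
Proof.
have p0 := pi_gt0 R.
have e : mu I = (2 * pi)%:E.
  rewrite /I lebesgue_measure_itv /= lte_fin ifT; last lra.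
  by rewrite -EFinD; congr EFin; ring.
transitivity (a * fine (mu I)); first by rewrite Rintegral_cst; [ | exact: measurable_itv].
by rewrite e mulrC.
Qed.

Lemma sin_nat_pi n : sin (n%:R * pi) = 0 :> R.
Proof.
elim: n => [|n ih]; first by rewrite mul0r sin0.
by rewrite -natr1 mulrDl mul1r sinDpi ih oppr0.
Qed.

Lemma continuous_cosZ (m : R) : continuous (fun x => cos (m * x)).
Proof.
move=> x; apply: continuous_comp; last exact: continuous_cos.
by apply: continuousM; [exact: cvg_cst | exact: cvg_id].
Qed.

Lemma integral_I_cos (m : R) : m != 0 -> sin (m * pi) = 0 ->
  \int[mu]_(x in I) cos (m * x) = 0.
Proof.
move=> m0 smp; have p0 := pi_gt0 R.
have dF (x : R) : is_derive x (1 : R) (fun x => m^-1 * sin (m * x)) (cos (m * x)).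
  have h1 := is_deriveZ m (is_derive_id x (1 : R)).
  have h2 := @is_derive1_comp R (@sin R) (fun x => m * x) x _ _ (is_derive_sin _) h1.
  apply: (is_derive_eq (is_deriveZ m^-1 h2)).
  by rewrite /GRing.scale /=; field.
have cF : continuous (fun x => m^-1 * sin (m * x)).
  move=> x; apply: differentiable_continuous; apply/derivable1_diffP; exact: ex_derive.
rewrite /Rintegral (@continuous_FTC2 _ _ (fun x => m^-1 * sin (m * x))).
- by rewrite mulrN sinN smp !mulr0 oppr0 mulr0 subee.
- lra.
- apply: continuous_subspaceT; exact: continuous_cosZ.
- split => [x _||]; first exact: ex_derive.
    exact/cvg_at_right_filter/cF.
  exact/cvg_at_left_filter/cF.
- by move=> x _; rewrite derive1E; apply: derive_val.
Qed.

(** Outside [-d, d] a Gaussian of inverse variance B is at most e^(-B d^2 / 4)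
    times the Gaussian of inverse variance B / 2. This yields one integrable
    majorant of f - gauss on the whole line. *)
Lemma gauss_compare f B eta M d : continuous f -> 0 < B -> 0 <= eta -> 0 <= M ->
  0 <= d <= pi ->
  (forall x, `|x| <= d -> `|f x - gauss B x| <= eta * gauss B x + M) ->
  (forall x, d < `|x| -> `|x| <= pi -> `|f x| <= M) ->
  `|\int[mu]_(x in I) f x - Num.sqrt (2 * pi / B)| <=
    eta * Num.sqrt (2 * pi / B) + 2 * pi * M
    + expR (- (B * d ^+ 2 / 4)) * Num.sqrt (4 * pi / B).
Proof.
move=> cf B0 eta0 M0 /andP[d0 dpi] hin hout.
have B2 : 0 < B / 2 by rewrite divr_gt0.
have -> : 4 * pi / B = 2 * pi / (B / 2) by field; rewrite gt_eqF.
rewrite -!gauss_integral// -integral_I_cst.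
have mI : measurable (I : set (measurableTypeR R)) by exact: measurable_itv.
have iI : mu.-integrable setT (EFin \o (f \_ I)).
  by rewrite -restrict_EFin; exact: (proj1 (integrable_mkcond _ mI) (integrable_I cf)).
have iM : mu.-integrable setT (EFin \o ((fun=> M) \_ I)).
  rewrite -restrict_EFin; apply: (proj1 (integrable_mkcond _ mI)).
  by apply: (integrable_I (f := fun=> M)) => x; exact: cvg_cst.
have ig := gauss_integrable B0; have ig2 := gauss_integrable B2.
set E := expR _.
rewrite [\int[mu]_(x in I) f x]Rintegral_mkcond [\int[mu]_(x in I) M]Rintegral_mkcond.
have ie1 : mu.-integrable setT (EFin \o (fun x => eta * gauss B x)).
  exact: integrable_realZ.
have ie2 : mu.-integrable setT (EFin \o (fun x => E * gauss (B / 2) x)).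
  exact: integrable_realZ.
have ie3 : mu.-integrable setT (EFin \o (fun x => eta * gauss B x + ((fun=> M) \_ I) x)).
  exact: integrable_realD.
have ie4 : mu.-integrable setT (EFin \o (fun x => eta * gauss B x + ((fun=> M) \_ I) x + E * gauss (B / 2) x)).
  exact: integrable_realD.
have id1 : mu.-integrable setT (EFin \o (fun x => (f \_ I) x - gauss B x)).
  exact: integrable_realB.
rewrite -RintegralB// -!RintegralZl// -!RintegralD//.
apply: le_trans (le_normr_Rintegral _ id1) _ => //.
apply: le_Rintegral => //.
  exact: integrable_norm.
move=> x _ /=.
have gx0 : 0 <= gauss B x by exact: expR_ge0.
have gx2 : 0 <= gauss (B / 2) x by exact: expR_ge0.
have E0 : 0 <= E by exact: expR_ge0.
have hIx : (x \in I) = (`|x| <= pi).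
  by apply/idP/idP; rewrite inE /I /= in_itv /= ler_norml.
have far : d < `|x| -> gauss B x <= E * gauss (B / 2) x.
  move=> dx; rewrite /gauss /E -expRD ler_expR.
  have : d ^+ 2 <= x ^+ 2.
    rewrite -[leRHS](real_normK (num_real x)); apply: lerXn2r; rewrite ?nnegrE//.
    exact: ltW.
  move=> /(ler_wpM2l (ltW B0)); lra.
rewrite !patchE hIx; case: ifPn => [xpi|xpi].
  have [xd|xd] := leP `|x| d.
    by apply: le_trans (hin x xd) _; rewrite lerDl mulr_ge0.
  apply: le_trans (ler_normB _ _) _; rewrite (ger0_norm gx0).
  apply: lerD; last exact: far.
  by apply: le_trans (hout x xd xpi) _; rewrite lerDr mulr_ge0.
rewrite sub0r normrN ger0_norm// addr0; apply: le_trans (far _) _.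
  by rewrite -ltNge in xpi; exact: le_lt_trans xpi.
by rewrite lerDr mulr_ge0.
Qed.

End FourierGauss.

(** * Local limit theorem for the coefficients of exp(u g) *)

Section LocalBounds.
Variable R : realType.
Implicit Types (u v : nat -> R) (x y z : R).

Lemma sums_to_tail u v l m N : (forall k, `|u k| <= v k) ->
  sums_to u l -> sums_to v m ->
  `|l - \sum_(0 <= k < N) u k| <= m - \sum_(0 <= k < N) v k.
Proof.
move=> uv [ul] vm; have v0 k : 0 <= v k by exact: le_trans (uv k).
have h : `|series u n - series u N| @[n --> \oo] --> `|l - series u N|.
  by apply: cvg_norm; apply: cvgB => //; exact: cvg_cst.
have -> : m - \sum_(0 <= k < N) v k = m - series v N by [].
apply: (ler_cvg_to h (cvg_cst (m - series v N))).
exists N => // n /= Nn; rewrite /series /= (@big_cat_nat _ _ _ N 0 n)//=.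
rewrite [X in `|X|]addrC addKr; apply: le_trans (ler_norm_sum _ _ _) _.
rewrite lerBrDr addrC; apply: le_trans (sums_to_partial n v0 vm).
by rewrite [leRHS](@big_cat_nat _ _ _ N 0 n)//= lerD2l; apply: ler_sum.
Qed.

Lemma expR_sub1_norm x z : `|x| <= z -> `|expR x - 1| <= z * expR z.
Proof.
move=> xz; have z0 : 0 <= z by exact: le_trans xz.
have e1 : 1 <= expR z by rewrite -[leLHS]expR0 ler_expR.
have [x0|x0] := leP 0 x.
  rewrite ger0_norm ?subr_ge0 -1?[leLHS]expR0 ?ler_expR//.
  apply: le_trans (expR_sub1_le x) _.
  by rewrite ger0_norm// in xz; apply: ler_pM; rewrite ?expR_ge0// ler_expR.
rewrite ler0_norm; last by rewrite subr_le0 -[leRHS]expR0 ler_expR ltW.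
rewrite ltr0_norm// in xz; have := expR_ge1Dx x.
have : z * 1 <= z * expR z by rewrite ler_wpM2l.
lra.
Qed.

Lemma exp_cos_close x y z : `|x| <= z -> `|y| <= z -> z <= 1 ->
  `|expR x * cos y - 1| <= 8 * z.
Proof.
move=> xz yz z1; have z0 : 0 <= z by exact: le_trans xz.
have ez : expR z <= 4 by apply: le_trans (@expR1_le4 R); rewrite ler_expR.
have ex : expR x <= 4 by apply: le_trans ez; rewrite ler_expR (le_trans (ler_norm x)).
have -> : expR x * cos y - 1 = (expR x - 1) - expR x * (1 - cos y) by ring.
apply: le_trans (ler_normB _ _) _.
have h1 := expR_sub1_norm xz.
have h2 : z * expR z <= z * 4 by rewrite ler_wpM2l.
rewrite normrM (ger0_norm (expR_ge0 x)) (ger0_norm (one_minus_cos_ge0 y)).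
have h3 : expR x * (1 - cos y) <= 4 * z.
  apply: ler_pM; rewrite ?expR_ge0 ?one_minus_cos_ge0//.
  exact: le_trans (one_minus_cos_le_norm y) yz.
lra.
Qed.

End LocalBounds.

Lemma sqrt_normalize (R : realType) (B x b1 b2 b3 : R) : 0 < B ->
  `|2 * pi * x - Num.sqrt (2 * pi / B)| <=
    b1 * Num.sqrt (2 * pi / B) + 2 * pi * b2 + b3 * Num.sqrt (4 * pi / B) ->
  0 <= b3 ->
  `|x * Num.sqrt (2 * pi * B) - 1| <= b1 + Num.sqrt (2 * pi * B) * b2 + 2 * b3.
Proof.
move=> B0 h b30; have p0 := pi_gt0 R.
set s := Num.sqrt (2 * pi * B); set t := Num.sqrt (2 * pi / B) in h *.
have t0 : 0 < t by rewrite sqrtr_gt0 divr_gt0// mulr_gt0.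
have s0 : 0 < s by rewrite sqrtr_gt0 !mulr_gt0.
have st : s * t = 2 * pi.
  rewrite /s /t -sqrtrM ?mulr_ge0 ?ltW//.
  rewrite (_ : 2 * pi * B * (2 * pi / B) = (2 * pi) ^+ 2); last by field; rewrite gt_eqF.
  by rewrite sqrtr_sqr gtr0_norm// mulr_gt0.
have t2 : Num.sqrt (4 * pi / B) <= 2 * t.
  rewrite -[2]gtr0_norm// -sqrtr_sqr /t -sqrtrM ?sqr_ge0//; apply: ler_wsqrtr.
  have q0 : 0 <= pi / B by rewrite divr_ge0 ?ltW.
  by rewrite -!mulrA; move: q0; clear; lra.
have -> : x * s - 1 = (2 * pi * x - t) / t.
  by rewrite -st; field; rewrite gt_eqF.
rewrite normrM normfV (gtr0_norm t0) ler_pdivrMr//; apply: le_trans h _.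
rewrite -st (_ : (b1 + s * b2 + 2 * b3) * t = b1 * t + s * t * b2 + b3 * (2 * t)).
  by rewrite lerD2l; exact: ler_wpM2l.
by ring.
Qed.

Section TrigPolynomials.
Variable R : realType.
Notation mu := (@lebesgue_measure R).

Lemma trig_poly_continuous (p : nat -> R) (n N : nat) :
  continuous (fun x : R => \sum_(0 <= k < N) p k * cos ((k%:R - n%:R) * x)).
Proof.
elim: N => [|N ih] x.
  rewrite (_ : (fun x => _) = fun=> 0); first exact: cvg_cst.
  by apply/funext => y; rewrite big_nil.
rewrite (_ : (fun x => _) = fun x => \sum_(0 <= k < N) p k * cos ((k%:R - n%:R) * x)
   + p N * cos ((N%:R - n%:R) * x)); last by apply/funext => y; rewrite big_nat_recr.
apply: cvgD; first exact: ih.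
by apply: cvgM; [exact: cvg_cst | exact: continuous_cosZ].
Qed.

(** Orthogonality of cosines: integration over a period selects the
    coefficient of index n. *)
Lemma trig_poly_integral (p : nat -> R) (n N : nat) :
  \int[mu]_(x in `[- pi, pi]) (\sum_(0 <= k < N) p k * cos ((k%:R - n%:R) * x))
  = if (n < N)%N then 2 * pi * p n else 0.
Proof.
have mI : measurable (`[- pi, pi]%classic : set (measurableTypeR R)) by exact: measurable_itv.
elim: N => [|N ih].
  under eq_Rintegral do rewrite big_nil.
  by rewrite integral_I_cst mulr0.
under eq_Rintegral do rewrite big_nat_recr//=.
rewrite RintegralD//; last 2 first.
- by apply: integrable_I; exact: trig_poly_continuous.
- apply: integrable_I => x.
  by apply: cvgM; [exact: cvg_cst | exact: continuous_cosZ].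
rewrite ih RintegralZl//; last by apply: integrable_I; exact: continuous_cosZ.
have [nN|nN|->] := ltngtP n N.
- rewrite ltnS ltnW// integral_I_cos ?mulr0 ?addr0//.
    by rewrite subr_eq0 eqr_nat gtn_eqF.
  by rewrite mulrBl sinB !sin_nat_pi mul0r mulr0 subrr.
- rewrite ltnS leqNgt nN /= integral_I_cos ?mulr0 ?addr0//.
    by rewrite subr_eq0 eqr_nat ltn_eqF.
  by rewrite mulrBl sinB !sin_nat_pi mul0r mulr0 subrr.
rewrite ltnS leqnn add0r.
under eq_Rintegral do rewrite subrr mul0r cos0.
by rewrite integral_I_cst; ring.
Qed.

End TrigPolynomials.

Section LocalLimit.
Variables (R : realType) (c : nat -> R) (rho : \bar R) (delta eps : R -> R).
Hypothesis c_ge0 : forall k, 0 <= c k.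
Hypothesis c0 : c 0%N = 0.
Hypothesis c_ex : exists2 j, (1 <= j)%N & 0 < c j.
Hypothesis ac : abs_on rho c.
Hypothesis sd : saddle_data c rho delta eps.
Implicit Types (r u : R) (h : nat -> R).

(** The sequence of coefficients of exp(u g), characterized by its logarithmic
    derivative. *)
Definition exp_rec u h := [/\ forall k, 0 <= h k, h 0%N = 1 &
  forall n, n%:R * h n = u * \sum_(0 <= j < n.+1) dcoef c j * h (n - j)%N].

(** The numbers p_k = h_k r^k e^(- u g(r)) form a probability, and F(x) is the
    real part of the characteristic function of k - n. Near 0 it is nearly
    Gaussian, the linear term in x being cancelled by n = u a(r); away from 0
    it is small by monotonicity of Re g. Partial sums of the series replace F
    under the integral, at the cost of the tail tau of p. *)
Lemma local_point r u h n B : pos_range rho r -> 1 / 2 <= u -> u <= 2 ->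
  n%:R = u * mom c 1 r -> exp_rec u h -> eps r <= 1 / 2 ->
  B = u * mom c 2 r ->
  `|2 * pi * (h n * r ^+ n * expR (- (u * mom c 0 r))) - Num.sqrt (2 * pi / B)| <=
  16 * eps r * Num.sqrt (2 * pi / B)
  + 2 * pi * (4 * expR (- (u * (delta r ^+ 2 * mom c 2 r / 2))))
  + expR (- (B * delta r ^+ 2 / 4)) * Num.sqrt (4 * pi / B).
Proof.
move=> rr u1 u2 nE [h_ge0 h0 h_rec] e12 BE.
have [irr r0] := rr; have u0 : 0 < u by lra.
have b0 := m_gt0 c_ge0 c_ex ac 2 rr.
have B0 : 0 < B by rewrite BE mulr_gt0.
have eps0 := sd_eps_ge0 sd irr.
have /andP[d0 d2] := sd_delta sd irr.
have pi0 := pi_gt0 R.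
have ah := abs_on_h c_ge0 ac (ltW u0) h_ge0 h_rec.
have es phi := exp_series c_ge0 c0 ac (ltW u0) h_ge0 h0 h_rec phi irr.
set g := mom c 0 r in es *; set ug := expR (- (u * g)).
pose p k := h k * r ^+ k * ug.
have p0 k : 0 <= p k by rewrite !mulr_ge0 ?expR_ge0// exprn_ge0// ltW.
have cs0 : cosum c r 0 = g.
  rewrite /cosum /g /mom /= (_ : (fun k => c k * cos (k%:R * 0)) = c)//.
  by apply/funext => k; rewrite mulr0 cos0 mulr1.
have ss0 : sinsum c r 0 = 0.
  rewrite /sinsum; apply: sums_toE; apply: sums_to_ext (sums_to0 R) _ => k.
  by rewrite /= mulr0 sin0 mulr0 mul0r.
have sp : sums_to p 1.
  have [hX _] := es 0; rewrite cs0 ss0 mulr0 cos0 mulr1 in hX.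
  have := sums_toZ ug (psum_sums (abs_on_cos 0 ah) irr).
  have e1 : ug * expR (u * g) = 1 by rewrite mulrC expRxMexpNx_1.
  rewrite hX e1 => hs; apply: (sums_to_ext hs) => k.
  by rewrite mulr0 cos0 mulr1 mulrC.
pose F x := expR (- (u * (g - cosum c r x))) * cos (u * sinsum c r x - n%:R * x).
have sF x : sums_to (fun k => p k * cos ((k%:R - n%:R) * x)) (F x).
  have [hX hY] := es x.
  have := sums_toD (sums_toZ (ug * cos (n%:R * x)) (psum_sums (abs_on_cos x ah) irr))
    (sums_toZ (ug * sin (n%:R * x)) (psum_sums (abs_on_sin x ah) irr)).
  rewrite hX hY => hs.
  have -> : F x = ug * cos (n%:R * x) * (expR (u * cosum c r x) * cos (u * sinsum c r x))
     + ug * sin (n%:R * x) * (expR (u * cosum c r x) * sin (u * sinsum c r x)).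
    rewrite /F cosB (_ : - (u * (g - cosum c r x)) = - (u * g) + u * cosum c r x).
      by rewrite expRD -/ug; ring.
    by ring.
  by apply: (sums_to_ext hs) => k; rewrite /p mulrBl cosB; ring.
set M := 4 * expR _.
have M0 : 0 <= M by rewrite mulr_ge0 ?expR_ge0.
have Fin x : `|x| <= delta r -> `|F x - gauss B x| <= 16 * eps r * gauss B x.
  move=> xd; have hre := sd_re sd irr xd; have him := sd_im sd irr xd.
  set Er := - (mom c 0 r - cosum c r x - x ^+ 2 / 2 * mom c 2 r) in hre *.
  set Ei := sinsum c r x - x * mom c 1 r in him.
  have -> : F x = gauss B x * (expR (u * Er) * cos (u * Ei)).
    rewrite /F /gauss mulrA -expRD; congr (expR _ * cos _).
      by rewrite /Er BE /g; field.
    by rewrite nE /Ei; ring.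
  rewrite -{2}[gauss B x]mulr1 -mulrBr normrM ger0_norm ?expR_ge0// mulrC.
  rewrite ler_wpM2r ?expR_ge0//.
  have -> : 16 * eps r = 8 * (2 * eps r) by ring.
  have ue t : `|t| <= eps r -> `|u * t| <= 2 * eps r.
    by move=> ht; rewrite normrM gtr0_norm//; apply: ler_pM => //; exact: ltW.
  by apply: exp_cos_close; [rewrite ue// normrN | exact: ue | lra].
have Fout x : delta r < `|x| -> `|x| <= pi -> `|F x| <= M.
  move=> dx xpi; rewrite normrM ger0_norm ?expR_ge0//.
  have mono : cosum c r x <= cosum c r (delta r).
    by apply: (sd_mono sd irr) => //; rewrite -ler_norml.
  apply: le_trans (_ : expR (- (u * (g - cosum c r x))) <= _).
    by rewrite ler_piMr ?expR_ge0// cos_norm_le1.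
  have dd : `|delta r| <= delta r by rewrite gtr0_norm.
  have := sd_re sd irr dd; rewrite ler_norml => /andP[k1 _].
  have ue : u * eps r <= 1.
    have : u * eps r <= 2 * (1 / 2) by apply: ler_pM => //; exact: ltW.
    lra.
  apply: le_trans (_ : expR (1 + - (u * (delta r ^+ 2 * mom c 2 r / 2))) <= _).
    rewrite ler_expR.
    have : u * (delta r ^+ 2 * mom c 2 r / 2 - eps r) <= u * (g - cosum c r x).
      rewrite ler_wpM2l ?(ltW u0)// /g; lra.
    rewrite mulrBr; lra.
  by rewrite expRD /M ler_wpM2r ?expR_ge0// expR1_le4.
apply/ler_addgt0Pr => e e0.
pose e' := e / (2 * pi).
have e'0 : 0 < e' by rewrite divr_gt0// mulr_gt0.
have [N _ hN] := proj1 (cvgrPdist_lt _ _) (sums_toP sp) e' e'0.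
(* The truncation must keep the index n. *)
pose N' := maxn N n.+1.
pose tau := 1 - \sum_(0 <= k < N') p k.
have tau0 : 0 <= tau by rewrite subr_ge0; exact: sums_to_partial p0 sp.
have taue : tau <= e'.
  by apply: le_trans (ler_norm _) _; apply/ltW/hN; exact: leq_maxl.
pose f x := \sum_(0 <= k < N') p k * cos ((k%:R - n%:R) * x).
have fF x : `|f x - F x| <= tau.
  rewrite distrC; apply: sums_to_tail (sF x) sp => k.
  by rewrite normrM (ger0_norm (p0 k)) ler_piMr ?cos_norm_le1.
have Jf : \int[lebesgue_measure]_(x in `[- pi, pi]) f x = 2 * pi * p n.
  by rewrite /f trig_poly_integral leq_maxr.
have dpi : 0 <= delta r <= pi by apply/andP; split; lra.
have eta0 : 0 <= 16 * eps r by rewrite mulr_ge0.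
have := @gauss_compare R f B (16 * eps r) (M + tau) (delta r)
  (@trig_poly_continuous R p n N') B0 eta0 (addr_ge0 M0 tau0) dpi.
rewrite Jf => gc; apply: le_trans (gc _ _) _.
- move=> x xd; have -> : f x - gauss B x = (F x - gauss B x) + (f x - F x) by ring.
  apply: le_trans (ler_normD _ _) _; rewrite addrA; apply: lerD (fF x).
  by apply: le_trans (Fin x xd) _; rewrite lerDl.
- move=> x dx xpi; have -> : f x = F x + (f x - F x) by ring.
  by apply: le_trans (ler_normD _ _) _; apply: lerD (fF x); exact: Fout.
have : 2 * pi * tau <= e.
  by rewrite mulrC -ler_pdivlMr// mulr_gt0.
rewrite [2 * pi * (M + tau)]mulrDr => h1; clearbody M tau; clear -h1; lra.
Qed.

(** The first error term of [local_point] is a multiple of eps; the width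
    condition makes the other two small, even though the second is multiplied
    by sqrt(b) in the normalization. *)
Lemma local_limit e : 0 < e -> near_radius rho (fun r => pos_range rho r ->
  forall u h n, 1 / 2 <= u -> u <= 2 -> n%:R = u * mom c 1 r -> exp_rec u h ->
  `|h n * r ^+ n * expR (- (u * mom c 0 r)) * Num.sqrt (2 * pi * (u * mom c 2 r)) - 1|
    <= e).
Proof.
move=> e0.
(* The last two error terms will add up to 18 e^(-W/4), which is to be at most
   e / 2. *)
pose W := Num.max 0 (4 * ln (36 / e)).
have W0 : 0 <= W by rewrite le_max lexx.
have WE : 36 * expR (- (W / 4)) <= e.
  have : 36 / e <= expR (W / 4).
    rewrite -[leLHS]lnK ?posrE ?divr_gt0// ler_expR ler_pdivlMr// mulrC.
    by rewrite /W le_max lexx orbT.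
  rewrite expRN ler_pdivrMr// => h.
  by rewrite ler_pdivrMr ?expR_gt0// mulrC.
have half0 : 0 < 1 / 2 :> R by rewrite divr_gt0.
have e32 : 0 < Num.min (1 / 2) (e / 32) by rewrite lt_min half0 divr_gt0.
have n1 := sd_eps sd e32.
have n2 := sd_width sd W half0.
have n3 := sd_b sd 1.
apply: near_radius_mono (near_radius_and n1 (near_radius_and n2 n3)).
move=> r irr r0 [h1 [h2 h3]] rr u h n u1 u2 nE hrec.
move: h1; rewrite lt_min => /andP[eps12 eps32].
have u0 : 0 < u by apply: lt_le_trans u1.
have b0 := m_gt0 c_ge0 c_ex ac 2 rr.
have B0 : 0 < u * mom c 2 r by exact: mulr_gt0.
have lp := local_point rr u1 u2 nE hrec (ltW eps12) erefl.
apply: le_trans (sqrt_normalize B0 lp (expR_ge0 _)) _.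
set b := mom c 2 r in h2 h3 b0 B0 *; set d := delta r in h2 *.
have lb0 : 0 <= ln b by rewrite ln_ge0// ltW.
have db : 2 * (W + ln b) <= d ^+ 2 * b by lra.
have db0 : 0 <= d ^+ 2 * b by rewrite mulr_ge0 ?sqr_ge0// ltW.
have udb : 1 / 2 * (d ^+ 2 * b) <= u * (d ^+ 2 * b) by rewrite ler_wpM2r.
have t3 : expR (- (u * b * d ^+ 2 / 4)) <= expR (- (W / 4)).
  rewrite ler_expR; lra.
have t2 : expR (- (u * (d ^+ 2 * b / 2))) <= expR (- (ln b / 2)) * expR (- (W / 4)).
  rewrite -expRD ler_expR; lra.
have sb : Num.sqrt (2 * pi * (u * b)) <= 4 * expR (ln b / 2).
  have -> : expR (ln b / 2) = Num.sqrt b.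
    apply/eqP; rewrite -(@eqrXn2 _ 2)// ?sqrtr_ge0 ?expR_ge0//.
    rewrite sqr_sqrtr ?ltW// -expRM_natl mulrCA divff// mulr1.
    by rewrite lnK.
  rewrite -[4]gtr0_norm// -sqrtr_sqr -sqrtrM ?sqr_ge0//; apply: ler_wsqrtr.
  rewrite mulrA ler_wpM2r ?(ltW b0)//; have p4 := @pihalf_lt2 R; have p0 := pi_gt0 R.
  have : pi * u <= 4 * 2 by apply: ler_pM => //; [exact: ltW|exact: ltW|lra].
  by move=> h8; rewrite -mulrA expr2; lra.
have eb : expR (ln b / 2) * expR (- (ln b / 2)) = 1 by exact: expRxMexpNx_1.
set E := expR (- (W / 4)) in WE t2 t3.
have t2' : Num.sqrt (2 * pi * (u * b)) * (4 * expR (- (u * (d ^+ 2 * b / 2)))) <= 16 * E.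
  apply: le_trans (_ : 4 * expR (ln b / 2) * (4 * (expR (- (ln b / 2)) * E)) <= _).
    by apply: ler_pM; rewrite ?sqrtr_ge0 ?mulr_ge0 ?expR_ge0// ler_wpM2l.
  have -> : 4 * expR (ln b / 2) * (4 * (expR (- (ln b / 2)) * E))
    = 16 * (expR (ln b / 2) * expR (- (ln b / 2))) * E by ring.
  by rewrite eb mulr1.
lra.
Qed.

End LocalLimit.

(** * Cycle decomposition of permutations *)

Section CycleDecomposition.
Variable T : finType.
Implicit Types (s t : {perm T}) (A C D : {set T}) (x y : T).
Import GroupScope.
Local Open Scope group_scope.

Lemma porbit_agree s t A y : (forall z, z \in A -> s z \in A /\ s z = t z) ->
  y \in A -> porbit s y = porbit t y /\ porbit s y \subset A.
Proof.
move=> h yA; have it i : (s ^+ i) y \in A /\ (s ^+ i) y = (t ^+ i) y.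
  elim: i => [|i [iA ei]]; first by rewrite !expg0 !perm1.
  by rewrite !expgSr !permM -ei; have [] := h _ iA.
split; last by apply/fintype.subsetP => _ /porbitP[i ->]; have [] := it i.
by apply/setP => z; apply/porbitP/porbitP => -[i ->]; exists i; have [_ ->] := it i.
Qed.

Lemma porbit_sub A s x : perm_on A s -> x \in A -> porbit s x \subset A.
Proof.
by move=> sA xA; have [] := @porbit_agree s s A x
  (fun z zA => conj (etrans (perm_closed z sA) zA) erefl) xA.
Qed.

Lemma perm_porbit s x y : (s y \in porbit s x) = (y \in porbit s x).
Proof.
rewrite -!eq_porbit_mem; congr (_ == _).
by have := porbit_perm s 1 y; rewrite expg1.
Qed.

Lemma mem_astabs_perm A s : (forall y, (s y \in A) = (y \in A)) -> s \in 'N(A | 'P).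
Proof. by move=> h; apply/astabsP => y; exact: h. Qed.

Lemma restr_permP A s y : (forall y, (s y \in A) = (y \in A)) ->
  restr_perm A s y = if y \in A then s y else y.
Proof.
move=> h; case: ifPn => yA; first by rewrite restr_permE// mem_astabs_perm.
by rewrite (out_perm (restr_perm_on _ _)).
Qed.

End CycleDecomposition.

Section CycleWeights.
Variables (R : comNzRingType) (f : nat -> R).

(** Only the cycles inside A count: the points outside A are fixed by the
    permutations considered and would otherwise contribute spurious cycles of
    length 1. *)
Definition orbit_weight (T : finType) (A : {set T}) (s : {perm T}) : R :=
  \prod_(D in porbits s | D \subset A) f #|D|.

Definition weight_sum (T : finType) (A : {set T}) : R :=
  \sum_(s : {perm T} | perm_on A s) orbit_weight A s.

Definition full_cycles (T : finType) (x : T) (C : {set T}) :=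
  #|[set s : {perm T} | perm_on C s & porbit s x == C]%SET|.

Section Split.
Variables (T : finType) (A C : {set T}) (x : T).
Hypotheses (CA : C \subset A) (xC : x \in C).
Local Open Scope group_scope.

Lemma split_prod (s1 s2 : {perm T}) : perm_on C s1 -> perm_on (A :\: C) s2 ->
  (forall y, y \in C -> (s1 * s2) y \in C /\ (s1 * s2) y = s1 y) /\
  (forall y, y \in A :\: C -> (s1 * s2) y \in A :\: C /\ (s1 * s2) y = s2 y).
Proof.
move=> p1 p2; split => y yC; rewrite permM.
  have y1 : s1 y \in C by rewrite perm_closed.
  have -> : s2 (s1 y) = s1 y by rewrite (out_perm p2)// inE y1.
  by [].
have -> : s1 y = y by rewrite (out_perm p1)//; move: yC; rewrite inE => /andP[].
by rewrite perm_closed.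
Qed.

(** A permutation supported in A in which C is the orbit of x is the product
    of a cycle on C and a permutation supported in the complement of C in A.
    *)
Lemma weight_sum_orbit : (\sum_(s : {perm T} | perm_on A s && (porbit s x == C))
   orbit_weight A s = (full_cycles x C)%:R * f #|C| * weight_sum (A :\: C))%R.
Proof.
have stabC s : porbit s x == C -> forall y, (s y \in C) = (y \in C).
  by move=> /eqP <- y; exact: perm_porbit.
have stabAC s : perm_on A s -> porbit s x == C -> forall y, (s y \in A :\: C) = (y \in A :\: C).
  by move=> sA sC y; rewrite !inE stabC// perm_closed.
rewrite (reindex_onto (fun p : {perm T} * {perm T} => p.1 * p.2)
  (fun s => (restr_perm C s, restr_perm (A :\: C) s))) /=; last first.
  move=> s /andP[sA sC]; apply/permP => y; rewrite permM.
  rewrite (restr_permP _ (stabC s sC)); case: ifPn => yC.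
    rewrite (restr_permP _ (stabAC s sA sC)) inE (stabC s sC) yC /=//.
  rewrite (restr_permP _ (stabAC s sA sC)) inE yC /=.
  by case: ifPn => // yA; rewrite (out_perm sA).
pose P1 := fun s : {perm T} => perm_on C s && (porbit s x == C).
pose P2 := fun s : {perm T} => perm_on (A :\: C) s.
rewrite (eq_bigl (fun p => P1 p.1 && P2 p.2)); last first.
  move=> [s1 s2] /=; apply/idP/idP.
    move=> /andP[/andP[sA sC] /eqP[e1 e2]].
    have p1 : perm_on C s1 by rewrite -e1 restr_perm_on.
    have p2 : perm_on (A :\: C) s2 by rewrite -e2 restr_perm_on.
    have [h1 _] := split_prod p1 p2.
    by rewrite /P1 /P2 p1 p2 !andbT /= -(eqP sC); have [<- _] := porbit_agree h1 xC.
  move=> /andP[/andP[p1 sC] p2]; have [h1 h2] := split_prod p1 p2.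
  have sC' : porbit (s1 * s2) x == C by have [-> _] := porbit_agree h1 xC.
  have sA : perm_on A (s1 * s2).
    apply: perm_onM; first exact: fintype.subset_trans p1 CA.
    exact: fintype.subset_trans p2 (finset.subsetDl _ _).
  rewrite sA sC' /=; apply/eqP; congr (_, _); apply/permP => y.
    rewrite (restr_permP _ (stabC _ sC')); case: ifPn => yC; first by have [] := h1 y yC.
    by rewrite (out_perm p1).
  rewrite (restr_permP _ (stabAC _ sA sC')); case: ifPn => yC; first by have [] := h2 y yC.
  by rewrite (out_perm p2).
rewrite -(pair_big P1 P2 (fun s1 s2 => orbit_weight A (s1 * s2)))%R /=.
rewrite (eq_bigr (fun=> f #|C| * weight_sum (A :\: C)))%R; last first.
  move=> s1 /andP[p1 sC]; rewrite /weight_sum mulr_sumr; apply: eq_bigr => s2 p2.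
  have [h1 h2] := split_prod p1 p2.
  have [oC _] := porbit_agree h1 xC; rewrite (eqP sC) in oC.
  have oCs : C \in porbits (s1 * s2) by rewrite -oC; exact: imset_f.
  rewrite /orbit_weight (bigD1 C) /=; last by rewrite oCs CA.
  congr (_ * _)%R; apply: eq_bigl => D; apply/idP/idP.
    move=> /andP[/andP[/imsetP[y _ ->] DA] DC].
    have yA : y \in A by rewrite (fintype.subsetP DA)// porbit_id.
    have yC : y \notin C.
      by apply: contra DC => yC; rewrite -oC eq_porbit_mem oC.
    have yAC : y \in A :\: C by rewrite inE yC yA.
    have [e sub] := porbit_agree h2 yAC.
    by rewrite sub andbT e; exact: imset_f.
  move=> /andP[/imsetP[y _ ->] DA].
  have yAC : y \in A :\: C by rewrite (fintype.subsetP DA)// porbit_id.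
  have [<- sub] := porbit_agree h2 yAC.
  have -> : porbit (s1 * s2) y \in porbits (s1 * s2) by exact: imset_f.
  rewrite /= (fintype.subset_trans sub (finset.subsetDl _ _)) /=.
  apply/eqP => DC; move: yAC; rewrite inE => /andP[/negP yC _]; apply: yC.
  by rewrite -DC porbit_id.
rewrite sumr_const -mulrA mulr_natl; congr (_ *+ _)%R.
by rewrite /full_cycles; apply: eq_card => s; rewrite !inE.
Qed.

End Split.

Lemma weight_sum_split (T : finType) (A : {set T}) x : x \in A ->
  weight_sum A = \sum_(C : {set T} | (C \subset A) && (x \in C))
    (full_cycles x C)%:R * f #|C| * weight_sum (A :\: C).
Proof.
move=> xA; rewrite {1}/weight_sum.
rewrite (partition_big (fun s => porbit s x) (fun C => (C \subset A) && (x \in C))) /=.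
  by apply: eq_bigr => C /andP[CA xC]; exact: weight_sum_orbit.
by move=> s sA; rewrite (porbit_sub sA xA) porbit_id.
Qed.

Lemma card_subsets_with (T : finType) (A : {set T}) x j : x \in A ->
  #|[set C : {set T} | [&& C \subset A, x \in C & #|C| == j.+1]]%SET| = 'C(#|A|.-1, j).
Proof.
move=> xA; rewrite -[#|A|.-1]/(#|A|.-1) (_ : #|A|.-1 = #|A :\ x|%N); last first.
  by rewrite (cardsD1 x A) xA.
transitivity #|[set x |: B | B : {set T} in [set B : {set T} | (B \subset A :\ x) & (#|B| == j)]]%SET|; last first.
  rewrite card_in_imset ?cards_draws//.
  move=> B B'; rewrite !inE => /andP[BA _] /andP[BA' _] e.
  have xB : x \notin B by apply/negP => /(fintype.subsetP BA); rewrite !inE eqxx.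
  have xB' : x \notin B' by apply/negP => /(fintype.subsetP BA'); rewrite !inE eqxx.
  by rewrite -(finset.setU1K xB) e finset.setU1K.
apply: eq_card => C; rewrite !inE; apply/idP/imsetP.
  move=> /and3P[CA xC /eqP cC]; exists (C :\ x); last by rewrite finset.setD1K.
  rewrite inE finset.setSD//=; have := cardsD1 x C; rewrite xC cC add1n => -[->].
  by rewrite eqxx.
move=> [B]; rewrite inE => /andP[BA /eqP cB] ->.
have xB : x \notin B by apply/negP => /(fintype.subsetP BA); rewrite !inE eqxx.
rewrite finset.subUset finset.sub1set xA (fintype.subset_trans BA (finset.subD1set _ _)) finset.setU11 cardsU1 xB cB.
by rewrite add1n eqxx.
Qed.

Lemma sum_subsets_with (T : finType) (A : {set T}) x (F : nat -> R) : x \in A ->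
  \sum_(C : {set T} | (C \subset A) && (x \in C)) F #|C|
  = \sum_(0 <= j < #|A|) 'C(#|A|.-1, j)%:R * F j.+1.
Proof.
move=> xA; have A0 : (0 < #|A|)%N by apply/card_gt0P; exists x.
rewrite big_mkord.
pose idx (C : {set T}) : 'I_#|A| := insubd (Ordinal A0) #|C|.-1.
have idxE (C : {set T}) : C \subset A -> x \in C -> (val (idx C)).+1 = #|C|.
  move=> CA xC; have C0 : (0 < #|C|)%N by apply/card_gt0P; exists x.
  by rewrite val_insubd prednK//= (leq_trans _ (subset_leq_card CA)) ?prednK.
rewrite (partition_big idx xpredT)//=; apply: eq_bigr => j _.
rewrite -(card_subsets_with j xA) mulr_natl -sumr_const.
apply: eq_big => [C|C /andP[/andP[CA xC] /eqP <-]]; last by rewrite idxE.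
rewrite inE -andbA; case: (boolP (C \subset A)) => //= CA.
case: (boolP (x \in C)) => //= xC.
by rewrite -(idxE C)// eqSS.
Qed.

End CycleWeights.

Lemma weight_sum1 (R : comNzRingType) (T : finType) (A : {set T}) :
  weight_sum (fun=> 1 : R) A = ((#|A|)`!)%:R.
Proof.
rewrite /weight_sum (eq_bigr (fun=> 1)); last first.
  by move=> s _; rewrite /orbit_weight big1.
by rewrite sumr_const -(card_perm A); congr (_ *+ _); apply: eq_card => s; rewrite inE.
Qed.

Lemma bin_fact_fact n j : (j < n)%N ->
  ('C(n.-1, j) * (j`! * (n - j.+1)`!) = n.-1`!)%N.
Proof.
case: n => // n; rewrite ltnS => jn /=.
by rewrite subSS bin_fact.
Qed.

(** No enumeration of cycles is needed: for the weight 1, [weight_sum_split]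
    expresses |A|! through the numbers of full cycles of the subsets of A, and
    this system determines them by induction on |A|. *)
Lemma full_cyclesE (T : finType) (x : T) (C : {set T}) : x \in C ->
  full_cycles x C = (#|C|.-1)`!.
Proof.
have [n] := ubnP #|C|; elim: n C => // n ih A An xA.
have A0 : (0 < #|A|)%N by apply/card_gt0P; exists x.
have e1 : ((#|A|)`!)%:R = \sum_(C : {set T} | (C \subset A) && (x \in C))
    (full_cycles x C)%:R * ((#|A| - #|C|)`!)%:R :> int.
  rewrite -weight_sum1 (weight_sum_split _ xA); apply: eq_bigr => C /andP[CA xC].
  by rewrite mulr1 weight_sum1 cardsD (finset.setIidPr CA).
have e2 : ((#|A|)`!)%:R = \sum_(C : {set T} | (C \subset A) && (x \in C))
    ((#|C|.-1)`!)%:R * ((#|A| - #|C|)`!)%:R :> int.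
  rewrite (@sum_subsets_with int T A x (fun j => ((j.-1)`!)%:R * ((#|A| - j)`!)%:R))//=.
  rewrite (eq_big_nat _ _ (F2 := fun=> (#|A|.-1`!)%:R)); last first.
    by move=> j /andP[_ jA] /=; rewrite -!natrM bin_fact_fact.
  rewrite sumr_const_nat subn0 -mulrnA mulnC.
  by rewrite -{2}(prednK A0) -factS prednK.
have AA : (A \subset A) && (x \in A) by rewrite fintype.subxx.
move: e1; rewrite e2 (bigD1 A AA) [in RHS](bigD1 A AA) /= subnn !mulr1.
rewrite (eq_bigr (fun C : {set T} => (full_cycles x C)%:R * ((#|A| - #|C|)`!)%:R)); last first.
  move=> C /andP[/andP[CA xC] CnA]; rewrite ih//.
  have : (#|C| < #|A|)%N by apply: proper_card; rewrite finset.properEneq CnA.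
  by move=> h; rewrite ltnS in An; exact: leq_trans h An.
by move/addIr/eqP; rewrite eqr_nat => /eqP ->.
Qed.

Section WeightRecursion.
Variables (R : comNzRingType) (f : nat -> R).

Definition perm_weight n := weight_sum f [set: 'I_n]%SET.

Lemma weight_sum0 (T : finType) : weight_sum f (finset.set0 : {set T}) = 1.
Proof.
rewrite /weight_sum (big_pred1 1%g); last first.
  move=> s; apply/idP/eqP => [s0|->]; last exact: perm_on1.
  by apply/permP => y; rewrite (out_perm s0) ?inE// perm1.
rewrite /orbit_weight big_pred0// => D; apply/negP => /andP[/imsetP[y _ ->]].
by rewrite finset.subset0 => /eqP/setP/(_ y); rewrite porbit_id inE.
Qed.

Lemma weight_sum_rec (T : finType) (A : {set T}) x : x \in A ->
  (forall C : {set T}, C \subset A -> x \in C -> weight_sum f (A :\: C) = perm_weight (#|A| - #|C|)) ->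
  weight_sum f A = \sum_(0 <= j < #|A|) ('C(#|A|.-1, j) * j`!)%:R *
     (f j.+1 * perm_weight (#|A| - j.+1)).
Proof.
move=> xA h; rewrite (weight_sum_split _ xA).
rewrite (eq_bigr (fun C : {set T} => (#|C|.-1)`!%:R * (f #|C| * perm_weight (#|A| - #|C|)))).
  rewrite (@sum_subsets_with R T A x (fun j => (j.-1)`!%:R * (f j * perm_weight (#|A| - j))))//=.
  by apply: eq_bigr => j _; rewrite natrM mulrA.
by move=> C /andP[CA xC]; rewrite full_cyclesE// h// mulrA.
Qed.

(** The recursion on subsets mentions cardinals only, which allows the sums
    over {perm T} to be compared with those over 'S_n. *)
Lemma weight_sum_card n (T : finType) (A : {set T}) : #|A| = n ->
  weight_sum f A = perm_weight n.
Proof.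
have [m] := ubnP n; elim: m n T A => // m ih n T A nm An.
case: n An nm => [|n] An nm.
  rewrite (cards0_eq An) weight_sum0 /perm_weight.
  rewrite (_ : [set: 'I_0]%SET = finset.set0) ?weight_sum0//.
  by apply/setP => -[].
have [x xA] : exists x, x \in A by apply/card_gt0P; rewrite An.
have sub (T' : finType) (B C : {set T'}) y : #|B| = n.+1 -> C \subset B -> y \in C ->
    weight_sum f (B :\: C) = perm_weight (#|B| - #|C|).
  move=> cB CB yC; have C0 : (0 < #|C|)%N by apply/card_gt0P; exists y.
  have cBC : #|B :\: C| = (#|B| - #|C|)%N by rewrite cardsD (finset.setIidPr CB).
  rewrite -cBC; apply: ih => //; rewrite cBC cB.
  by move: C0 nm; set k := #|C|; lia.
rewrite (weight_sum_rec xA (fun C CA xC => sub _ _ _ _ An CA xC)).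
have cI : #|[set: 'I_n.+1]%SET| = n.+1 by rewrite cardsT card_ord.
rewrite /perm_weight (weight_sum_rec (finset.in_setT ord0) (fun C CA xC => sub _ _ _ _ cI CA xC)).
by rewrite An cI.
Qed.

Lemma perm_weight_rec n : perm_weight n.+1 =
  \sum_(0 <= j < n.+1) ('C(n, j) * j`!)%:R * (f j.+1 * perm_weight (n - j)).
Proof.
have cI : #|[set: 'I_n.+1]%SET| = n.+1 by rewrite cardsT card_ord.
have h (C : {set 'I_n.+1}) : C \subset [set: 'I_n.+1]%SET -> ord0 \in C ->
    weight_sum f ([set: 'I_n.+1]%SET :\: C) = perm_weight (#|[set: 'I_n.+1]%SET| - #|C|).
  by move=> CA _; apply: weight_sum_card; rewrite cardsD finset.setTI.
by rewrite {1}/perm_weight (weight_sum_rec (finset.in_setT ord0) h) cI.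
Qed.

End WeightRecursion.

(** * The Ewens generating function *)

Section EwensMeasure.
Variables (R : realType) (theta : nat -> R).
Hypothesis theta_ge0 : forall j, (1 <= j)%N -> 0 <= theta j.
Implicit Types (u t : R) (n : nat).

Lemma ewens_weightE (th : nat -> R) n (s : 'S_n) :
  ewens_weight th s = orbit_weight th [set: 'I_n]%SET s.
Proof.
rewrite /ewens_weight /orbit_weight.
rewrite [RHS](eq_bigr (fun D : {set 'I_n} =>
    \prod_(1 <= j < n.+1) if j == #|D| then th j else 1)).
  rewrite exchange_big /=; apply: eq_bigr => j _.
  rewrite /cycle_count -prodr_const -big_mkcondr /=; apply: eq_bigl => D.
  by rewrite inE finset.subsetT andbT eq_sym.
move=> D /andP[/imsetP[y _ ->] _]; rewrite -big_mkcond big_nat1_eq.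
rewrite lt0n card_porbit_neq0 ltnS /=.
by rewrite ifT// (leq_trans (max_card _))// card_ord.
Qed.

Lemma ewens_weightZ u n (s : 'S_n) :
  ewens_weight (fun j => u * theta j) s = u ^+ total_cycles s * ewens_weight theta s.
Proof.
rewrite /ewens_weight /total_cycles -prodrXr -big_split /=.
by apply: eq_bigr => j _; rewrite exprMn.
Qed.

Lemma ewens_weight_ge0 n (s : 'S_n) : 0 <= ewens_weight theta s.
Proof.
rewrite /ewens_weight big_nat prodr_ge0// => j /andP[j1 _].
by rewrite exprn_ge0// theta_ge0.
Qed.

Lemma ewens_h_perm_weight (th : nat -> R) n :
  ewens_h th n = (n`!%:R)^-1 * perm_weight th n.
Proof.
rewrite /ewens_h /perm_weight /weight_sum; congr (_ * _).
apply: eq_big => [s|s _]; last exact: ewens_weightE.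
by apply/esym/fintype.subsetP => x; rewrite inE.
Qed.

Lemma ewens_h_rec (th : nat -> R) n :
  n.+1%:R * ewens_h th n.+1 = \sum_(0 <= j < n.+1) th j.+1 * ewens_h th (n - j).
Proof.
rewrite ewens_h_perm_weight perm_weight_rec mulrA mulr_sumr.
apply: eq_big_nat => j /andP[_]; rewrite ltnS => jn; rewrite ewens_h_perm_weight.
rewrite factS natrM -(bin_fact jn) !natrM.
have f0 k : k`!%:R != 0 :> R by rewrite pnatr_eq0 -lt0n fact_gt0.
have b0 : 'C(n, j)%:R != 0 :> R by rewrite pnatr_eq0 -lt0n bin_gt0.
by field; rewrite !f0 b0 nat1r pnatr_eq0.
Qed.

(** This says that sum_n h_n t^n = exp(u g(t)): the cycle of a given point has
    length j + 1 with weight theta_(j+1), and j + 1 times the coefficient of g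
    is theta_(j+1). *)
Lemma ewens_exp_rec u : 0 <= u ->
  exp_rec (g_coef theta) u (ewens_h (fun j => u * theta j)).
Proof.
move=> u0; split.
- move=> n; rewrite /ewens_h mulr_ge0 ?invr_ge0//; apply: sumr_ge0 => s _.
  by rewrite ewens_weightZ mulr_ge0 ?exprn_ge0// ewens_weight_ge0.
- by rewrite ewens_h_perm_weight fact0 invr1 mul1r /perm_weight
    (@weight_sum_card _ _ 0) ?cardsT ?card_ord// /perm_weight
    (_ : [set: 'I_0]%SET = finset.set0) ?weight_sum0//; apply/setP => -[].
case=> [|n].
  by rewrite mul0r big_nat1 /dcoef mul0r mul0r mulr0.
have d0 : dcoef (g_coef theta) 0 = 0 by rewrite /dcoef mul0r.
rewrite ewens_h_rec [in RHS]big_nat_recl// d0 mul0r add0r mulr_sumr.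
apply: eq_big_nat => j _; rewrite subSS mulrA; congr (_ * _).
by rewrite /dcoef /g_coef; field; rewrite nat1r pnatr_eq0.
Qed.

(** Tilting the law of K by e^(t K) amounts to multiplying all weights by e^t.
    *)
Lemma ewens_mgf t n :
  \sum_(s : 'S_n) expR (t * (total_cycles s)%:R) * ewens_weight theta s
  = n`!%:R * ewens_h (fun j => expR t * theta j) n.
Proof.
rewrite /ewens_h mulrA divff ?mul1r; last by rewrite pnatr_eq0 -lt0n fact_gt0.
by apply: eq_bigr => s _; rewrite ewens_weightZ expRM_natr.
Qed.

End EwensMeasure.

(** * Polynomial approximation of steps *)

Section TaylorTail.
Variable R : realType.
Implicit Types (u : nat -> R) (x y z : R).

(** For k >= N the k-th term is at most 2^(-N) times the k-th term of the
    exponential series at 2 |y|. *)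
Lemma taylor_tail u l y N : (forall k, `|u k| <= `|y| ^+ k / k`!%:R) ->
  sums_to u l -> `|l - \sum_(0 <= k < N) u k| <= 2^-1 ^+ N * expR (2 * `|y|).
Proof.
move=> hu [ul]; pose u' k := if (k < N)%N then 0 else u k.
have su' : sums_to u' (l - series u N).
  have e n : (N <= n)%N -> series u n - series u N = series u' n.
    move=> Nn; rewrite /series /= (@big_cat_nat _ _ _ N 0 n)//= addrAC subrr add0r.
    rewrite [RHS](@big_cat_nat _ _ _ N 0 n)//= [X in _ = X + _]big_nat [X in _ = X + _]big1 ?add0r.
      by apply: eq_big_nat => k /andP[Nk _]; rewrite /u' ltnNge Nk.
    by move=> k /andP[_ kN]; rewrite /u' kN.
  split; apply: cvg_trans (cvgB ul (cvg_cst (series u N))).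
  by apply: near_eq_cvg; exists N => // n /= Nn; exact: e.
have se : sums_to (exp_coeff (2 * `|y|)) (expR (2 * `|y|)).
  exact: sums_to_lim (is_cvg_series_exp_coeff _).
apply: (sums_to_norm_le _ su' (sums_toZ (2^-1 ^+ N) se)) => k.
have e0 : 0 <= 2^-1 ^+ N * exp_coeff (2 * `|y|) k :> R.
  by rewrite mulr_ge0 ?exprn_ge0// exp_coeff_ge0// mulr_ge0.
rewrite /u'; case: ltnP => kN; first by rewrite normr0.
apply: le_trans (hu k) _; rewrite /exp_coeff /= exprMn mulrA mulrA.
rewrite ler_wpM2r ?invr_ge0// ler_peMl ?exprn_ge0//.
rewrite -(subnK kN) addnC exprD mulrA -exprMn mulVf ?expr1n ?mul1r//.
by rewrite exprn_ege1// ler1n.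
Qed.

Lemma cos_taylor_tail y N :
  `|cos y - \sum_(0 <= k < N) cos_coeff y k| <= 2^-1 ^+ N * expR (2 * `|y|).
Proof.
apply: taylor_tail => [k|].
  rewrite /cos_coeff /= !normrM normfV normr_nat normrX normrN1 expr1n mulr1.
  by rewrite normr_nat normrX ler_wpM2r ?invr_ge0//; case: odd; rewrite ?mul0r ?mul1r ?exprn_ge0.
by rewrite unlock; apply: sums_to_lim; exact: is_cvg_series_cos_coeff.
Qed.

Lemma sin_taylor_tail y N :
  `|sin y - \sum_(0 <= k < N) sin_coeff y k| <= 2^-1 ^+ N * expR (2 * `|y|).
Proof.
apply: taylor_tail => [k|].
  rewrite /sin_coeff /= !normrM normfV normr_nat normrX normrN1 expr1n mulr1.
  by rewrite normr_nat normrX ler_wpM2r ?invr_ge0//; case: odd; rewrite ?mul0r ?mul1r ?exprn_ge0.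
by rewrite unlock; apply: sums_to_lim; exact: is_cvg_series_sin_coeff.
Qed.

Lemma pow_le_fact_exp y k : 0 <= y -> y ^+ k <= k`!%:R * expR y.
Proof.
move=> y0; have k0 : 0 < k`!%:R :> R by rewrite ltr0n fact_gt0.
rewrite mulrC -ler_pdivrMr//.
have se : sums_to (exp_coeff y) (expR y) := sums_to_lim (is_cvg_series_exp_coeff _).
exact: (sums_to_term k (fun n => exp_coeff_ge0 n y0) se).
Qed.

Lemma expR_quad_bound y : `|expR y - 1 - y| <= y ^+ 2 * expR `|y|.
Proof.
have h1 := expR_ge1Dx y.
rewrite ger0_norm; last lra.
have e1 := expR_sub1_le y.
have a0 := normr_ge0 y.
have h2 : expR y - 1 - y <= y * (expR y - 1) by lra.
apply: le_trans h2 _; rewrite expr2 -mulrA.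
have [y0|y0] := leP 0 y.
  by rewrite ger0_norm// ler_wpM2l//.
rewrite ltr0_norm//; have -> : y * (expR y - 1) = (- y) * (1 - expR y) by ring.
have -> : y * (y * expR (- y)) = (- y) * ((- y) * expR (- y)) by ring.
rewrite ler_wpM2l ?oppr_ge0 ?(ltW y0)//.
have : 1 <= expR (- y) by rewrite -[leLHS]expR0 ler_expR oppr_ge0 ltW.
have ny : 0 <= - y by rewrite oppr_ge0 ltW.
move=> /(ler_wpM2l ny); lra.
Qed.

Lemma bernoulli_lower z n : 0 <= z <= 1 -> 1 - n%:R * z <= (1 - z) ^+ n.
Proof.
move=> /andP[z0 z1]; elim: n => [|n ih]; first by rewrite mul0r subr0 expr0.
rewrite exprS -natr1.
have : (1 - z) * (1 - n%:R * z) <= (1 - z) * (1 - z) ^+ n.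
  by rewrite ler_wpM2l// subr_ge0.
have : 0 <= n%:R * z * z by rewrite !mulr_ge0.
lra.
Qed.

(** As n grows, this polynomial in p tends to 1 for p < 1/2 and to 0 for p >
    1/2, by Bernoulli's inequality; these are Stone's approximations of a
    step. *)
Definition stone n (p : R) : R := (1 - p ^+ n) ^+ (2 ^ n).

Lemma stone_range n p : 0 <= p <= 1 -> 0 <= stone n p <= 1.
Proof.
move=> /andP[p0 p1]; have q0 : 0 <= p ^+ n by exact: exprn_ge0.
have q1 : p ^+ n <= 1 by exact: exprn_ile1.
by rewrite /stone exprn_ge0 ?subr_ge0//= exprn_ile1// ?subr_ge0// lerBlDr lerDl.
Qed.

Lemma stone_low n p k : 0 < k -> 0 <= p -> p <= 1 / 2 - k ->
  1 - (1 + 2 * k)^-1 ^+ n <= stone n p.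
Proof.
move=> k0 p0 pk; have p1 : p <= 1 by lra.
have pr : 0 <= p ^+ n <= 1 by rewrite exprn_ge0// exprn_ile1.
apply: le_trans (bernoulli_lower (2 ^ n) pr).
rewrite lerD2l lerN2 natrX -exprMn; apply: lerXn2r; rewrite ?nnegrE ?mulr_ge0//.
  by rewrite invr_ge0; lra.
rewrite -div1r ler_pdivlMr; last lra.
nra.
Qed.

Lemma stone_high n p k : 0 < k -> p <= 1 -> 1 / 2 + k <= p ->
  stone n p <= (1 + 2 * k)^-1 ^+ n.
Proof.
move=> k0 p1 pk; have p0 : 0 <= p by lra.
have /andP[z0 z1] : 0 <= p ^+ n <= 1 by rewrite exprn_ge0// exprn_ile1.
rewrite /stone; set z := p ^+ n in z0 z1 *; set N := (2 ^ n)%N.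
have z1' : 0 <= 1 - z by rewrite subr_ge0.
have b : 1 + N%:R * z <= (1 + z) ^+ N.
  elim: N => [|N ih]; first by rewrite mul0r addr0 expr0.
  rewrite exprS -natr1.
  have : (1 + z) * (1 + N%:R * z) <= (1 + z) * (1 + z) ^+ N by rewrite ler_wpM2l// addr_ge0.
  have : 0 <= N%:R * z * z by rewrite !mulr_ge0.
  lra.
have prod1 : (1 - z) ^+ N * (1 + z) ^+ N <= 1.
  rewrite -exprMn exprn_ile1//; last by have := sqr_ge0 z; lra.
  by rewrite mulr_ge0// addr_ge0.
have c0 : 0 <= (1 - z) ^+ N by exact: exprn_ge0.
have : (1 - z) ^+ N * (1 + N%:R * z) <= 1.
  by apply: le_trans prod1; rewrite ler_wpM2l.
have -> : N%:R * z = (2 * p) ^+ n by rewrite /N natrX exprMn.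
have p2 : 1 + 2 * k <= 2 * p by lra.
have pk0 : 0 < (1 + 2 * k) ^+ n by rewrite exprn_gt0//; lra.
have : (1 + 2 * k) ^+ n <= (2 * p) ^+ n by apply: lerXn2r; rewrite ?nnegrE//; lra.
move=> h2 h3; rewrite exprVn -div1r ler_pdivlMr//.
have := ler_wpM2l c0 h2; lra.
Qed.

End TaylorTail.

(** * Convergence of moment generating functions implies convergence in distribution *)

Section Expectation.
Variable R : realType.
Implicit Types (f g : R -> R) (s t x A S e : R).

(** Functions of at most exponential growth: they are integrated by every law
    whose moment generating function is finite. *)
Definition exp_dominated f := measurable_fun setT f /\
  exists A S, [/\ 0 <= A, 0 <= S & forall x, `|f x| <= A * expR (S * `|x|)].

(** Positive linear functionals, which cover at once the law of a random
    permutation and the normal law. *)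
Record expectation (E : (R -> R) -> R) : Prop := {
  ex_lin : forall f g A S, exp_dominated f -> exp_dominated g ->
    E (fun x => A * f x + S * g x) = A * E f + S * E g ;
  ex_le : forall f g, exp_dominated f -> exp_dominated g ->
    (forall x, f x <= g x) -> E f <= E g }.

Lemma dom_lin f g A S : exp_dominated f -> exp_dominated g ->
  exp_dominated (fun x => A * f x + S * g x).
Proof.
move=> [mf [A1 [S1 [A10 S10 h1]]]] [mg [A2 [S2 [A20 S20 h2]]]]; split.
  apply: measurable_funD; apply: measurable_funM => //; exact: measurable_cst.
have s0 : 0 <= S1 + S2 by exact: addr_ge0.
exists (`|A| * A1 + `|S| * A2), (S1 + S2); split => //.
  by rewrite addr_ge0// mulr_ge0.
move=> x; apply: le_trans (ler_normD _ _) _; rewrite !normrM mulrDl -!mulrA.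
apply: lerD; rewrite ler_wpM2l//.
  apply: le_trans (h1 x) _; rewrite ler_wpM2l// ler_expR ler_wpM2r//.
  by rewrite lerDl.
apply: le_trans (h2 x) _; rewrite ler_wpM2l// ler_expR ler_wpM2r//.
by rewrite lerDr.
Qed.

Lemma dom_bounded f A : measurable_fun setT f -> (forall x, `|f x| <= A) ->
  exp_dominated f.
Proof.
move=> mf h; split => //; exists A, 0; split => //.
  exact: le_trans (normr_ge0 _) (h 0).
by move=> x; rewrite mul0r expR0 mulr1.
Qed.

Lemma dom_cst A : exp_dominated (fun=> A).
Proof. by apply: (@dom_bounded _ `|A|) => //; exact: measurable_cst. Qed.

Lemma expR_sx_le s x : expR (s * x) <= expR (`|s| * `|x|).
Proof. by rewrite ler_expR -normrM ler_norm. Qed.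

Lemma measurable_expZ s : measurable_fun setT (fun x : R => expR (s * x)).
Proof.
by apply: measurableT_comp.
Qed.

Lemma dom_monomial k s : exp_dominated (fun x => x ^+ k * expR (s * x)).
Proof.
split.
  apply: measurable_funM; last exact: measurable_expZ.
  by apply: measurable_funX.
exists k`!%:R, (1 + `|s|); split => //.
move=> x; rewrite normrM normrX (ger0_norm (expR_ge0 _)) mulrDl mul1r expRD mulrA.
apply: ler_pM; rewrite ?exprn_ge0 ?expR_ge0//; first exact: pow_le_fact_exp.
exact: expR_sx_le.
Qed.

Lemma dom_exp s : exp_dominated (fun x => expR (s * x)).
Proof.
have := dom_monomial 0 s; congr exp_dominated; apply/funext => x.
by rewrite mul1r.
Qed.

(** A majorant of e^(S |x|) whose expectation is read off the moment
    generating function. *)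
Definition two_exp S x := expR (S * x) + expR (- S * x).

Lemma two_expE S : two_exp S = (fun x => 1 * expR (S * x) + 1 * expR (- S * x)).
Proof. by apply/funext => x; rewrite !mul1r. Qed.

Lemma two_exp_ge S x : 0 <= S -> expR (S * `|x|) <= two_exp S x.
Proof.
move=> S0; rewrite /two_exp; have [x0|x0] := leP 0 x.
  by rewrite ger0_norm// lerDl expR_ge0.
by rewrite ltr0_norm// mulrN -mulNr lerDr expR_ge0.
Qed.

Lemma ex_ge0 E f : expectation E -> exp_dominated f -> (forall x, 0 <= f x) ->
  0 <= E f.
Proof.
move=> EE df f0; have := ex_le EE (dom_cst 0) df f0.
have -> : (fun=> 0) = (fun x : R => 0 * (fun=> 0 : R) x + 0 * (fun=> 0 : R) x) :> (R -> R).
  by apply/funext => x; rewrite !mul0r addr0.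
by rewrite (ex_lin EE 0 0 (dom_cst 0) (dom_cst 0)) !mul0r addr0.
Qed.

Lemma ex_dist E f g h e : expectation E -> exp_dominated f -> exp_dominated g ->
  exp_dominated h -> (forall x, `|f x - g x| <= e * h x) ->
  `|E f - E g| <= e * E h.
Proof.
move=> EE df dg dh hfg; rewrite ler_norml; apply/andP; split.
  have := ex_le EE (dom_lin 1 (- e) dg dh) df; rewrite (ex_lin EE)// => H.
  have : 1 * E g + - e * E h <= E f.
    by apply: H => x; have := hfg x; rewrite ler_norml => /andP[]; lra.
  lra.
have := ex_le EE df (dom_lin 1 e dg dh); rewrite (ex_lin EE)// => H.
have : E f <= 1 * E g + e * E h.
  by apply: H => x; have := hfg x; rewrite ler_norml => /andP[]; lra.
lra.
Qed.

Section Curtiss.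
Variables (En : nat -> (R -> R) -> R) (E : (R -> R) -> R).
Hypothesis hEn : forall n, expectation (En n).
Hypothesis hE : expectation E.
Hypothesis mgf_cvg : forall s,
  En n (fun x => expR (s * x)) @[n --> \oo] --> E (fun x => expR (s * x)).

Definition converges f := exp_dominated f /\ En n f @[n --> \oo] --> E f.

Lemma conv_lin f g A S : converges f -> converges g ->
  converges (fun x => A * f x + S * g x).
Proof.
move=> [df cf] [dg cg]; split; first exact: dom_lin.
rewrite (ex_lin hE)//.
have : A * En n f + S * En n g @[n --> \oo] --> A * E f + S * E g.
  by apply: cvgD; apply: cvgMr.
by apply: cvg_trans; apply: near_eq_cvg; apply: nearW => n; rewrite (ex_lin (hEn n)).
Qed.

Lemma conv_exp s : converges (fun x => expR (s * x)).
Proof. by split; [exact: dom_exp | exact: mgf_cvg]. Qed.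

Lemma conv_two_exp S : converges (two_exp S).
Proof. by rewrite two_expE; apply: conv_lin; exact: conv_exp. Qed.

Lemma conv_ext f g : converges f -> f =1 g -> converges g.
Proof. by move=> cf /funext <-. Qed.

(** Uniform approximation relative to the weight [two_exp S] is enough,
    because the expectations of that weight converge and are therefore
    bounded. *)
Lemma conv_approx f S : exp_dominated f ->
  (forall e, 0 < e -> exists2 g, converges g & forall x, `|f x - g x| <= e * two_exp S x) ->
  converges f.
Proof.
move=> df h; split => //; apply/cvgrPdist_lt => e e0.
have [dh ch] := conv_two_exp S; set w := two_exp S in h dh ch.
have Ew0 : 0 <= E w.
  by apply: (ex_ge0 hE dh) => x; rewrite addr_ge0 ?expR_ge0.
pose K := 2 * (E w + 1) + 1.
have K0 : 0 < K by rewrite /K; lra.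
have [g [dg cg] hg] := h (e / (2 * K)) (divr_gt0 e0 (mulr_gt0 (ltr0Sn _ 1) K0)).
set d := e / (2 * K) in hg.
have d0 : 0 < d by rewrite divr_gt0// mulr_gt0.
have dK : d * K = e / 2 by rewrite /d; field; rewrite gt_eqF.
have b1 := ex_dist hE df dg dh hg.
have [N1 _ hN1] := proj1 (cvgrPdist_lt _ _) cg (e / 4) ltac:(by rewrite divr_gt0).
have [N2 _ hN2] := proj1 (cvgrPdist_lt _ _) ch 1 ltr01.
exists (maxn N1 N2) => // n /=; rewrite geq_max => /andP[n1 n2].
have b2 := ex_dist (hEn n) df dg dh hg.
have b3 := hN1 n n1; have b4 := hN2 n n2.
have b5 : En n w <= E w + 1.
  by move: b4; rewrite distrC => /ltr_normlW; lra.
have -> : E f - En n f = (E f - E g) + (E g - En n g) - (En n f - En n g) by ring.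
apply: le_lt_trans (ler_normB _ _) _.
apply: le_lt_trans (lerD (ler_normD _ _) (lexx _)) _.
have b6 : d * En n w <= d * (E w + 1) by rewrite ler_wpM2l// ltW.
have : d * E w + d * (E w + 1) + d <= d * K.
  by rewrite /K; have : 0 <= d * E w by [rewrite mulr_ge0// ltW]; nra.
rewrite dK; lra.
Qed.

(** Multiplication by x is a derivative in s, and the difference quotients in
    s of x^k e^(s x) approximate it relatively to e^(S |x|). *)
Lemma conv_monomial k s : converges (fun x => x ^+ k * expR (s * x)).
Proof.
elim: k s => [|k ih] s.
  by apply: (conv_ext (conv_exp s)) => x; rewrite mul1r.
have S0 : 0 <= `|s| + 2 by rewrite addr_ge0.
apply: (@conv_approx _ (`|s| + 2)); first exact: dom_monomial.
move=> e e0; pose C : R := (k.+2)`!%:R.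
have C0 : 0 < C by rewrite ltr0n fact_gt0.
(* Step of the difference quotient; its error is h x^(k+2) up to exponentials,
   and (k+2)! bounds the power of x. *)
pose h := Num.min 1 (e / C).
have h0 : 0 < h by rewrite lt_min ltr01 divr_gt0.
have h1 : h <= 1 by rewrite ge_min lexx.
have hC : h * C <= e by rewrite -ler_pdivlMr// ge_min lexx orbT.
exists (fun x => h^-1 * (x ^+ k * expR ((s + h) * x)) + (- h^-1) * (x ^+ k * expR (s * x))).
  exact: conv_lin.
move=> x.
have -> : x ^+ k.+1 * expR (s * x) - (h^-1 * (x ^+ k * expR ((s + h) * x)) + - h^-1 * (x ^+ k * expR (s * x)))
  = - (h^-1 * (x ^+ k * expR (s * x) * (expR (h * x) - 1 - h * x))).
  by rewrite mulrDl expRD exprS; field; rewrite gt_eqF.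
rewrite normrN normrM gtr0_norm ?invr_gt0// normrM normrM normrX (ger0_norm (expR_ge0 _)).
apply: le_trans (_ : e * expR ((`|s| + 2) * `|x|) <= _); last first.
  by rewrite ler_wpM2l ?(ltW e0)// two_exp_ge.
apply: le_trans (_ : h^-1 * (`|x| ^+ k * expR (`|s| * `|x|) * ((h * x) ^+ 2 * expR `|h * x|)) <= _).
  rewrite ler_wpM2l ?invr_ge0 ?(ltW h0)//; apply: ler_pM; rewrite ?mulr_ge0 ?exprn_ge0 ?expR_ge0//.
    by rewrite ler_wpM2l ?exprn_ge0//; exact: expR_sx_le.
  exact: expR_quad_bound.
have -> : h^-1 * (`|x| ^+ k * expR (`|s| * `|x|) * ((h * x) ^+ 2 * expR `|h * x|))
   = h * (`|x| ^+ k.+2) * expR (`|s| * `|x|) * expR `|h * x|.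
  rewrite -(real_normK (num_real (h * x))) normrM (gtr0_norm h0) !exprS expr0; field; rewrite gt_eqF//.
have hx : expR `|h * x| <= expR `|x|.
  by rewrite ler_expR normrM (gtr0_norm h0) ler_piMl.
have xp : `|x| ^+ k.+2 <= C * expR `|x| by exact: pow_le_fact_exp.
have -> : (`|s| + 2) * `|x| = `|x| + `|s| * `|x| + `|x| by ring.
have eX0 := expR_ge0 `|x|; have eS0 := expR_ge0 (`|s| * `|x|).
have X0 : 0 <= `|x| ^+ k.+2 by exact: exprn_ge0.
have hX : h * `|x| ^+ k.+2 <= e * expR `|x|.
  apply: le_trans (_ : h * (C * expR `|x|) <= _); first by rewrite ler_wpM2l// ltW.
  by rewrite mulrA ler_wpM2r.
move: X0 hX; move: (`|x| ^+ k.+2) => Y X0 hX.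
rewrite !expRD !mulrA.
apply: ler_pM; [|exact: expR_ge0 | by rewrite ler_wpM2r | exact: hx].
by rewrite mulr_ge0// mulr_ge0// ltW.
Qed.

Lemma conv_poly (a : nat -> R) N : converges (fun x => \sum_(0 <= k < N) a k * x ^+ k).
Proof.
elim: N => [|N ih].
  have := conv_lin 0 0 (conv_exp 0) (conv_exp 0).
  by congr converges; apply/funext => x; rewrite big_nil !mul0r addr0.
have := conv_lin 1 (a N) ih (conv_monomial N 0).
congr converges; apply/funext => x.
by rewrite big_nat_recr//= mul1r mul0r expR0 mulr1.
Qed.

Lemma half_pow_small e : 0 < e -> exists N : nat, 2^-1 ^+ N <= e.
Proof.
move=> e0; have h : `|2^-1 : R| < 1 by rewrite ger0_norm ?invr_ge0//; lra.
have [N _ hN] := proj1 (cvgrPdist_lt _ _) (cvg_expr h) e e0.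
exists N; have := hN N (leqnn N); rewrite sub0r normrN => /ltW.
exact: le_trans (ler_norm _).
Qed.

(** Taylor polynomials approximate cos(t x) relatively to e^(2 |t| |x|), with
    error 2^(-N). *)
Lemma conv_cos t : converges (fun x => cos (t * x)).
Proof.
apply: (@conv_approx _ (2 * `|t|)).
  apply: (@dom_bounded _ 1) => [|x]; last exact: cos_norm_le1.
  by apply: continuous_measurable_fun; exact: continuous_cosZ.
move=> e e0; have [N hN] := half_pow_small e0.
exists (fun x => \sum_(0 <= k < N) cos_coeff t k * x ^+ k); first exact: conv_poly.
move=> x; have -> : \sum_(0 <= k < N) cos_coeff t k * x ^+ k = \sum_(0 <= k < N) cos_coeff (t * x) k.
  by apply: eq_bigr => k _; rewrite /cos_coeff /= exprMn; ring.
apply: le_trans (cos_taylor_tail _ _) _.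
apply: le_trans (_ : e * expR (2 * `|t| * `|x|) <= _).
  by rewrite normrM mulrA ler_wpM2r// expR_ge0.
by rewrite ler_wpM2l ?(ltW e0)// two_exp_ge// mulr_ge0.
Qed.

Lemma conv_sin t : converges (fun x => sin (t * x)).
Proof.
apply: (@conv_approx _ (2 * `|t|)).
  apply: (@dom_bounded _ 1) => [|x]; last exact: sin_norm_le1.
  apply: continuous_measurable_fun => x; apply: continuous_comp; last exact: continuous_sin.
  by apply: cvgM; [exact: cvg_cst | exact: cvg_id].
move=> e e0; have [N hN] := half_pow_small e0.
exists (fun x => \sum_(0 <= k < N) sin_coeff t k * x ^+ k); first exact: conv_poly.
move=> x; have -> : \sum_(0 <= k < N) sin_coeff t k * x ^+ k = \sum_(0 <= k < N) sin_coeff (t * x) k.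
  by apply: eq_bigr => k _; rewrite /sin_coeff /= exprMn; ring.
apply: le_trans (sin_taylor_tail _ _) _.
apply: le_trans (_ : e * expR (2 * `|t| * `|x|) <= _).
  by rewrite normrM mulrA ler_wpM2r// expR_ge0.
by rewrite ler_wpM2l ?(ltW e0)// two_exp_ge// mulr_ge0.
Qed.

Lemma conv_sin_pow w j t : converges (fun x => sin (w * x) ^+ j * cos (t * x)) /\
  converges (fun x => sin (w * x) ^+ j * sin (t * x)).
Proof.
elim: j t => [|j ih] t.
  split; [apply: (conv_ext (conv_cos t)) | apply: (conv_ext (conv_sin t))] => x;
    by rewrite expr0 mul1r.
have [c1 s1] := ih (t + w); have [c2 s2] := ih (t - w); split.
  apply: (conv_ext (conv_lin (1 / 2) (- (1 / 2)) s1 s2)) => x.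
  by rewrite exprS mulrDl mulrBl sinD sinB; field.
apply: (conv_ext (conv_lin (- (1 / 2)) (1 / 2) c1 c2)) => x.
by rewrite exprS mulrDl mulrBl cosD cosB; field.
Qed.

Lemma conv_poly_sin w (p : {poly R}) : converges (fun x => p.[sin (w * x)]).
Proof.
have h N (a : nat -> R) : converges (fun x => \sum_(i < N) a i * sin (w * x) ^+ i).
  elim: N => [|N ih].
    apply: (conv_ext (conv_lin 0 0 (conv_exp 0) (conv_exp 0))) => x.
    by rewrite big_ord0 !mul0r addr0.
  have [c0 _] := conv_sin_pow w N 0.
  apply: (conv_ext (conv_lin 1 (a N) ih c0)) => x.
  by rewrite big_ord_recr /= mul1r mul0r cos0 mulr1.
by apply: (conv_ext (h (size p) (fun i => p`_i))) => x; rewrite horner_coef.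
Qed.

Definition below a : R -> R := fun x : R => ((x <= a)%R)%:R.

Lemma belowE a : below a = \1_(`]-oo, a]%classic).
Proof.
by apply/funext => x; rewrite /below indicE; congr (_%:R); rewrite mem_setE in_itv.
Qed.

Lemma dom_below a : exp_dominated (below a).
Proof.
apply: (@dom_bounded _ 1) => [|x]; first by rewrite belowE; exact: measurable_indic.
by rewrite /below; case: (x <= a); rewrite ?normr0 ?normr1.
Qed.

Lemma pow_small (z e : R) : 0 < z -> 0 < e -> exists n : nat, (1 + z)^-1 ^+ n <= e.
Proof.
move=> z0 e0; have h : `|(1 + z)^-1| < 1.
  by rewrite ger0_norm ?invr_ge0 ?invf_lt1; lra.
have [N _ hN] := proj1 (cvgrPdist_lt _ _) (cvg_expr h) e e0.
exists N; have := hN N (leqnn N); rewrite sub0r normrN => /ltW.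
exact: le_trans (ler_norm _).
Qed.

Lemma sin_mono_unit (x y : R) : -1 <= x <= 1 -> -1 <= y <= 1 ->
  (sin x < sin y) = (x < y).
Proof.
move=> /andP[x0 x1] /andP[y0 y1]; have p2 := @pi_ge2 R.
by rewrite ltr_sin// in_itv/=; apply/andP; split; lra.
Qed.

(** The map x |-> sin(w x) is increasing on [-L, L] for w = 1 / L, so an
    affine image of it crosses 1/2 between a and b and Stone's polynomials
    turn it into a step. For |x| > L the bound e x^2 >= 1 makes the
    inequalities trivial; the polynomials stay between 0 and 1 there since sin
    is bounded. *)
Lemma smooth_step a b e : a < b -> 0 < e -> exists2 q, converges q &
  forall x, below a x - e * (1 + x ^+ 2) <= q x <= below b x + e * (1 + x ^+ 2).
Proof.
move=> ab e0.
(* L exceeds |a| and |b|, and e L^2 >= 1. *)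
pose L := `|a| + `|b| + 1 + e^-1.
have na := normr_ge0 a; have nb := normr_ge0 b; have ei : 0 < e^-1 by rewrite invr_gt0.
have L1 : 1 <= L by rewrite /L; lra.
have L0 : 0 < L by lra.
have eL : 1 <= e * L ^+ 2.
  have : 1 <= e * L.
    have : e * e^-1 <= e * L by rewrite ler_wpM2l ?(ltW e0)// /L; lra.
    by rewrite divff// gt_eqF.
  have : e * L <= e * L ^+ 2 by rewrite expr2 ler_wpM2l ?(ltW e0)// ler_peMr// ltW.
  lra.
pose w := L^-1; have w0 : 0 < w by rewrite invr_gt0.
have wL : w * L = 1 by rewrite /w mulVf// gt_eqF.
have unit_w x : `|x| <= L -> -1 <= w * x <= 1.
  move=> xL; rewrite -ler_norml normrM (gtr0_norm w0) -wL ler_wpM2l// ltW//.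
pose mid := (a + b) / 2.
have aL : `|a| <= L by rewrite /L; lra.
have bL : `|b| <= L by rewrite /L; lra.
have mL : `|mid| <= L.
  rewrite /mid normrM; apply: le_trans (_ : (`|a| + `|b|) * `|2^-1| <= _).
    by rewrite ler_wpM2r// ler_normD.
  by rewrite ger0_norm ?invr_ge0// /L; lra.
have am : sin (w * a) < sin (w * mid).
  by rewrite sin_mono_unit ?unit_w// ltr_pM2l// /mid; lra.
have mb : sin (w * mid) < sin (w * b).
  by rewrite sin_mono_unit ?unit_w// ltr_pM2l// /mid; lra.
pose y0 := sin (w * mid).
pose k := Num.min (y0 - sin (w * a)) (sin (w * b) - y0) / 8.
have k0 : 0 < k by rewrite divr_gt0// lt_min !subr_gt0 am mb.
have ka : sin (w * a) <= y0 - 8 * k.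
  have : Num.min (y0 - sin (w * a)) (sin (w * b) - y0) <= y0 - sin (w * a).
    by rewrite ge_min lexx.
  by rewrite /k; lra.
have kb : y0 + 8 * k <= sin (w * b).
  have : Num.min (y0 - sin (w * a)) (sin (w * b) - y0) <= sin (w * b) - y0.
    by rewrite ge_min lexx orbT.
  by rewrite /k; lra.
have k2 : 0 < 2 * k by lra.
have [n hn] := pow_small k2 e0.
(* The slope 1/8 keeps the values between 1/4 and 3/4, since |y - y0| <= 2. *)
pose pp y := 1 / 2 + (y - y0) / 8.
pose P : {poly R} := (1 / 2 - y0 / 8)%:P + (1 / 8)%:P * 'X.
have PE y : P.[y] = pp y.
  by rewrite /P !hornerE /pp; ring.
clearbody P.
pose q x := stone n (pp (sin (w * x))).
exists q.
  apply: (conv_ext (conv_poly_sin w ((1 - P ^+ n) ^+ (2 ^ n)))) => x.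
  by rewrite /q /stone !hornerE PE.
move=> x; have sx1 := @sin_norm_le1 R (w * x); have sy1 := @sin_norm_le1 R (w * mid).
rewrite -/y0 in sy1.
have pr : 0 <= pp (sin (w * x)) <= 1.
  move: sx1 sy1; rewrite !ler_norml /pp => /andP[? ?] /andP[? ?].
  by apply/andP; split; lra.
have /andP[q0 q1] := stone_range n pr; rewrite -/(q x) in q0 q1.
have ex0 : 0 <= e * (1 + x ^+ 2) by rewrite mulr_ge0 ?(ltW e0)// addr_ge0// sqr_ge0.
have ex1 : e <= e * (1 + x ^+ 2) by rewrite ler_peMr ?(ltW e0)// lerDl sqr_ge0.
have b01 c0 : 0 <= below c0 x <= 1 by rewrite /below; case: (x <= c0); rewrite ?lexx ler01.
have /andP[ba0 ba1] := b01 a; have /andP[bb0 bb1] := b01 b.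
have [xL|xL] := leP `|x| L; last first.
  have : e * L ^+ 2 <= e * x ^+ 2.
    rewrite ler_wpM2l ?(ltW e0)// -[leRHS](real_normK (num_real x)).
    by apply: lerXn2r; rewrite ?nnegrE ?(ltW L0) ?(ltW xL).
  by move=> h; apply/andP; split; lra.
have sle c0 d : `|c0| <= L -> `|d| <= L -> c0 <= d -> sin (w * c0) <= sin (w * d).
  move=> c0L dL cd; rewrite leNgt sin_mono_unit ?unit_w// -leNgt.
  by rewrite ler_wpM2l// ltW.
apply/andP; split.
  have [xa|xa] := leP x a.
    have := stone_low n k0 (proj1 (andP pr)) (p := pp (sin (w * x))).
    have -> : pp (sin (w * x)) <= 1 / 2 - k.
      by have := sle x a xL aL xa; rewrite /pp; lra.
    by move=> /(_ isT); rewrite -/(q x) /below xa /=; lra.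
  by rewrite /below (lt_geF xa) /=; lra.
have [xb|xb] := leP x b; first by rewrite /below xb /=; lra.
have := stone_high n k0 (p := pp (sin (w * x))) (proj2 (andP pr)).
have -> : 1 / 2 + k <= pp (sin (w * x)).
  by have := sle b x bL xL (ltW xb); rewrite /pp; lra.
by move=> /(_ isT); rewrite -/(q x); lra.
Qed.

Hypothesis E_lipschitz : forall a b, a <= b -> E (below b) - E (below a) <= b - a.

(** Sandwiching an indicator between smooth steps, at the price of a
    displacement of the threshold, which a Lipschitz limiting distribution
    function tolerates. *)
Theorem mgf_cvg_below a : En n (below a) @[n --> \oo] --> E (below a).
Proof.
apply/cvgrPdist_le => e e0.
set W := fun x : R => 1 + x ^+ 2.
have cW : converges W.
  apply: (conv_ext (conv_lin 1 1 (conv_exp 0) (conv_monomial 2 0))) => x.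
  by rewrite mul0r expR0 /W; ring.
have [dW W_cvg] := cW.
have EW0 : 0 <= E W.
  by apply: (ex_ge0 hE dW) => x; rewrite addr_ge0// sqr_ge0.
(* d times the weight E(1 + x^2), taken twice with a margin, is below e / 2.
   *)
pose d := e / (4 * (E W + 2)).
have d0 : 0 < d by rewrite divr_gt0// mulr_gt0//; lra.
have dE : d * (E W + 2) = e / 4 by rewrite /d; field; lra.
have h0 : 0 < e / 4 by rewrite divr_gt0.
have ae : a < a + e / 4 by rewrite ltrDl.
have ea : a - e / 4 < a by rewrite gtrBl.
have [qu cu hu] := smooth_step ae d0.
have [ql cl hl] := smooth_step ea d0.
have [du qu_cvg] := cu; have [dl ql_cvg] := cl.
have up F b q : expectation F -> exp_dominated q ->
    (forall x, below b x - d * (1 + x ^+ 2) <= q x) -> F (below b) <= F q + d * F W.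
  move=> hF dq hq; have := ex_le hF (dom_below b) (dom_lin 1 d dq dW).
  rewrite (ex_lin hF 1 d dq dW) mul1r; apply => x; have := hq x; rewrite /W; lra.
have dn F b q : expectation F -> exp_dominated q ->
    (forall x, q x <= below b x + d * (1 + x ^+ 2)) -> F q <= F (below b) + d * F W.
  move=> hF dq hq; have := ex_le hF dq (dom_lin 1 d (dom_below b) dW).
  rewrite (ex_lin hF 1 d (dom_below b) dW) mul1r; apply => x; have := hq x; rewrite /W; lra.
have [N1 _ hN1] := proj1 (cvgrPdist_lt _ _) qu_cvg (e / 8) ltac:(by rewrite divr_gt0).
have [N2 _ hN2] := proj1 (cvgrPdist_lt _ _) ql_cvg (e / 8) ltac:(by rewrite divr_gt0).
have [N3 _ hN3] := proj1 (cvgrPdist_lt _ _) W_cvg 1 ltr01.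
exists (maxn N1 (maxn N2 N3)) => // n /=.
rewrite !geq_max => /and3P[n1 n2 n3].
have hn := hEn n.
have Wn : d * En n W <= d * (E W + 1).
  rewrite ler_wpM2l ?(ltW d0)//; have := hN3 n n3; rewrite distrC => /ltr_normlW; lra.
have A1 := up (En n) a qu hn du (fun x => proj1 (andP (hu x))).
have A2 := dn E (a + e / 4) qu hE du (fun x => proj2 (andP (hu x))).
have B1 := dn (En n) a ql hn dl (fun x => proj2 (andP (hl x))).
have B2 := up E (a - e / 4) ql hE dl (fun x => proj1 (andP (hl x))).
have := hN1 n n1; rewrite ltr_norml => /andP[u1 _].
have := hN2 n n2; rewrite ltr_norml => /andP[_ l1].
have lu := E_lipschitz (ltW ae); have ll := E_lipschitz (ltW ea).
have dEW : d * (E W + 1) + d * E W <= e / 2.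
  by rewrite -mulrDr; have := d0; nra.
rewrite ler_norml; apply/andP; split; lra.
Qed.

End Curtiss.
End Expectation.

(** * The standard normal law as an expectation *)

Section Gaussian.
Variable R : realType.
Implicit Types (f g : R -> R) (s t x A S e : R).
Notation mu := (@lebesgue_measure R).

Definition gauss_mean f := Rintegral mu setT (fun x => f x * normal_pdf 0 1 x).

(** Completing the square. All integrability questions reduce to normal
    densities through this identity. *)
Lemma normal_pdf_tilt s x :
  expR (s * x) * normal_pdf 0 1 x = expR (s ^+ 2 / 2) * normal_pdf s 1 x.
Proof.
rewrite !normal_pdfE ?oner_neq0// /normal_fun mulrCA -expRD [RHS]mulrCA -expRD.
by congr (_ * expR _); rewrite expr1n -mulr_natr; field.
Qed.

Lemma integrable_exp_pdf s :
  mu.-integrable setT (EFin \o (fun x => expR (s * x) * normal_pdf 0 1 x)).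
Proof.
have -> : (fun x => expR (s * x) * normal_pdf 0 1 x) =
    (fun x => expR (s ^+ 2 / 2) * normal_pdf s 1 x).
  by apply/funext => x; rewrite normal_pdf_tilt.
by apply: integrable_realZ => //; exact: integrable_normal_pdf.
Qed.

Lemma integrable_pdf f : exp_dominated f ->
  mu.-integrable setT (EFin \o (fun x => f x * normal_pdf 0 1 x)).
Proof.
move=> [mf [A [S [A0 S0 h]]]].
have ig : mu.-integrable setT (EFin \o (fun x => A * (two_exp S x * normal_pdf 0 1 x))).
  apply: integrable_realZ => //.
  have := integrable_realD measurableT (integrable_exp_pdf S) (integrable_exp_pdf (- S)).
  by congr (mu.-integrable _ _); apply/funext => x /=; rewrite /two_exp mulrDl.
apply: le_integrable ig => //.
  apply/measurable_EFinP; apply: measurable_funM => //; exact: measurable_normal_pdf.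
move=> x _ /=; rewrite lee_fin mulrA !normrM ler_wpM2r//.
apply: le_trans (h x) _; rewrite ger0_norm// ler_wpM2l// ger0_norm.
  exact: two_exp_ge.
by rewrite addr_ge0 ?expR_ge0.
Qed.

Lemma gauss_mean_exp s : gauss_mean (fun x => expR (s * x)) = expR (s ^+ 2 / 2).
Proof.
rewrite /gauss_mean; have -> : (fun x => expR (s * x) * normal_pdf 0 1 x) =
    (fun x => expR (s ^+ 2 / 2) * normal_pdf s 1 x).
  by apply/funext => x; rewrite normal_pdf_tilt.
rewrite RintegralZl//; last exact: integrable_normal_pdf.
by rewrite /Rintegral integral_normal_pdf /= mulr1.
Qed.

Lemma gauss_mean_expectation : expectation gauss_mean.
Proof.
split.
- move=> f g A S df dg; rewrite /gauss_mean.
  have iA := integrable_realZ A measurableT (integrable_pdf df).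
  have iS := integrable_realZ S measurableT (integrable_pdf dg).
  rewrite -(RintegralZl A measurableT (integrable_pdf df)).
  rewrite -(RintegralZl S measurableT (integrable_pdf dg)) -RintegralD//.
  by congr Rintegral; apply/funext => x; rewrite mulrDl !mulrA.
- move=> f g df dg fg; apply: le_Rintegral => //; try exact: integrable_pdf.
  by move=> x _; rewrite ler_wpM2r// normal_pdf_ge0.
Qed.

Lemma normal_pdf_le1 x : normal_pdf 0 1 x <= 1 :> R.
Proof.
apply: le_trans (normal_pdf_ub _ _ (oner_neq0 _)) _.
have p2 := @pi_ge2 R.
have h : 1 <= 1 ^+ 2 * pi *+ 2 :> R by rewrite expr1n -mulr_natr; lra.
by rewrite /normal_peak invf_le1 ?sqrtr_gt0 ?(lt_le_trans ltr01 h)// -[leLHS]sqrtr1 ler_sqrt// (le_trans ler01 h).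
Qed.

Lemma gauss_mean_below_lipschitz (x y : R) : x <= y ->
  gauss_mean (below y) - gauss_mean (below x) <= y - x.
Proof.
move=> xy; rewrite /gauss_mean -RintegralB//; try exact: integrable_pdf (dom_below _).
have mI : measurable (`]x, y] : set (measurableTypeR R)) by exact: measurable_itv.
have mIE : mu `]x, y]%classic = (if (x < y)%R then (y - x)%:E else 0%E).
  by rewrite lebesgue_measure_itv /= lte_fin; case: ifP.
have I1 : Rintegral mu setT (\1_(`]x, y]%classic)) = y - x.
  rewrite /Rintegral integral_indic// setIT [X in fine X]mIE.
  by case: ltP => // yx; rewrite /= (_ : y = x) ?subrr//; apply/eqP; rewrite eq_le xy yx.
rewrite -I1; apply: le_Rintegral => //.
- by apply: integrable_realB => //; exact: integrable_pdf (dom_below _).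
- apply/integrableP; split; first by apply/measurable_EFinP; exact: measurable_indic.
  under eq_integral do rewrite /= ger0_norm//.
  rewrite integral_indic// setIT [X in (X < _)%E]mIE.
  by case: ifP; rewrite ltry.
- move=> z _; rewrite -mulrBl /below mem_setE in_itv /=.
  have p0 := @normal_pdf_ge0 R 0 1 z; have p1 := normal_pdf_le1 z.
  have [zx|zx] := leP z x; first by rewrite (le_trans zx xy) subrr mul0r.
  by case: (leP z y) => _ /=; rewrite subr0 ?mul1r ?mul0r.
Qed.

Lemma gauss_mean_below (x : R) :
  (gauss_mean (below x))%:E = normal_prob 0 1 `]-oo, x]%classic.
Proof.
rewrite /gauss_mean /normal_prob integral_mkcond fineK; last first.
  by apply: integrable_fin_num => //; exact: integrable_pdf (dom_below x).
apply: eq_integral => z _; rewrite belowE /patch indicE.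
by case: ifP => _ /=; rewrite ?mul1r ?mul0r.
Qed.

End Gaussian.

(** * Derivatives of the saddle point *)

Section SaddleInverse.
Variables (R : realType) (c : nat -> R) (rho : \bar R) (rx : R -> R).
Hypothesis c_ge0 : forall k, 0 <= c k.
Hypothesis c0 : c 0%N = 0.
Hypothesis c_ex : exists2 j, (1 <= j)%N & 0 < c j.
Hypothesis ac : abs_on rho c.
Hypothesis rx_in : forall x : R, 0 < x -> pos_range rho (rx x).
Hypothesis rx_m1 : forall x : R, 0 < x -> mom c 1 (rx x) = x.
Implicit Types r x y : R.
Notation m := (mom c).
Notation in_rho := (pos_range rho).

Lemma m1_inj r s : in_rho r -> in_rho s -> m 1 r = m 1 s -> r = s.
Proof.
move=> rr ss e; have exi : log_m1 c r = log_m1 c s by rewrite /log_m1 e.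
have [h|h|//] := ltgtP r s.
  by have := log_m1_lt c_ge0 c_ex ac rr ss h; rewrite exi ltxx.
by have := log_m1_lt c_ge0 c_ex ac ss rr h; rewrite exi ltxx.
Qed.

Lemma rx_mom r : in_rho r -> rx (m 1 r) = r.
Proof.
move=> rr; have m0 := m_gt0 c_ge0 c_ex ac 1 rr.
by apply: m1_inj => //; [exact: rx_in | exact: rx_m1].
Qed.

Lemma rx_le x y : 0 < x -> x <= y -> rx x <= rx y.
Proof.
move=> x0 xy; rewrite leNgt; apply/negP => h; have y0 := lt_le_trans x0 xy.
have := log_m1_lt c_ge0 c_ex ac (rx_in y0) (rx_in x0) h.
by rewrite /log_m1 !rx_m1// ltr_ln ?posrE// ltNge xy.
Qed.

Lemma near_inr r : in_rho r -> \forall z \near r, in_rho z.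
Proof.
move=> [rr r0]; have [s rs ss] := range_open rr.
exists (Num.min r (s - r)) => /=; first by rewrite lt_min r0 subr_gt0.
move=> z /=; rewrite lt_min => /andP[h1 h2].
have z0 : 0 < z by move: h1 => /ltr_normlW; lra.
split => //; apply: range_le ss; first exact: ltW.
by move: h2; rewrite distrC => /ltr_normlW; lra.
Qed.

Lemma is_derive_rx x : 0 < x -> is_derive x (1 : R) rx (rx x / m 2 (rx x)).
Proof.
move=> x0; have rr := rx_in x0; have [_ r0] := rr.
have d := is_derive_m ac 1 rr; have m2 := m_gt0 c_ge0 c_ex ac 2 rr.
rewrite -{1}(rx_m1 x0) -[rx x / _]invf_div; apply: is_derive_inverse d _.
- by near=> z; apply: rx_mom; near: z; exact: near_inr.
- near=> z; have zz : in_rho z by near: z; exact: near_inr.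
  apply: differentiable_continuous; apply/derivable1_diffP.
  by have := is_derive_m ac 1 zz; case.
- by rewrite mulf_neq0 ?invr_neq0 ?gt_eqF.
Unshelve. all: by end_near. Qed.

Lemma is_derive_mom_rx p x : 0 < x ->
  is_derive x (1 : R) (fun y => m p (rx y)) (m p.+1 (rx x) / m 2 (rx x)).
Proof.
move=> x0; have rr := rx_in x0; have [_ r0] := rr.
have m2 := m_gt0 c_ge0 c_ex ac 2 rr.
have h := @is_derive1_comp R (m p) rx x _ _ (is_derive_m ac p rr) (is_derive_rx x0).
by apply: is_derive_eq h _; field; rewrite !gt_eqF.
Qed.

Lemma is_derive_ln_rx x : 0 < x ->
  is_derive x (1 : R) (fun y => ln (rx y)) (m 2 (rx x))^-1.
Proof.
move=> x0; have rr := rx_in x0; have [_ r0] := rr.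
have m2 := m_gt0 c_ge0 c_ex ac 2 rr.
have h := @is_derive1_comp R (@ln R) rx x _ _ (is_derive1_ln r0) (is_derive_rx x0).
by apply: is_derive_eq h _; field; rewrite !gt_eqF.
Qed.

Lemma derive1_rx x : 0 < x -> derive1 rx x = rx x / m 2 (rx x).
Proof. by move=> x0; rewrite derive1E; case: (is_derive_rx x0). Qed.

Lemma derive2_rx x : 0 < x ->
  derive1n 2 rx x = rx x * (m 2 (rx x) - m 3 (rx x)) / m 2 (rx x) ^+ 3.
Proof.
move=> x0; have rr := rx_in x0; have [_ r0] := rr.
have m2 := m_gt0 c_ge0 c_ex ac 2 rr; have m2n : m 2 (rx x) != 0 by rewrite gt_eqF.
have dG : is_derive x (1 : R) (rx * (fun y => (m 2 (rx y))^-1))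
   (rx x * (m 2 (rx x) - m 3 (rx x)) / m 2 (rx x) ^+ 3).
  have d1 := is_derive_rx x0.
  have d2 := @is_deriveV _ (fun y => m 2 (rx y)) x _ _ m2n (is_derive_mom_rx 2 x0).
  apply: is_derive_eq (is_deriveM d1 d2) _.
  by rewrite /GRing.scale /=; field.
rewrite derive1nS derive1n1 derive1E; case: dG => _ <-.
apply: near_eq_derive; near=> y; rewrite derive1_rx//.
by near: y; exact: lt_nbhsr.
Unshelve. all: by end_near. Qed.

(** In terms of moments, r'' x^2 is - m_1^2 r (m_3 - m_2) / m_2^3 and r' x is
    m_1 r / m_2, so the derivative bound says m_1 (m_3 - m_2) <= C m_2^2. *)
Lemma regular_moments (C : R) :
  (\forall x \near +oo, `|derive1n 2 rx x * x ^+ 2| <= C * `|derive1n 1 rx x * x ^+ 1|) ->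
  exists N : nat, near_radius rho (fun r => m 1 r * m 3 r <= N%:R * m 2 r ^+ 2).
Proof.
move=> [M [_ hM]]; pose X := Num.max M 0 + 1.
have X0 : 0 < X by rewrite ltr_wpDl// le_max lexx orbT.
have MX : M < X by rewrite ltr_pwDr// le_max lexx.
exists (Num.truncn (`|C| + 1)).+1, (rx X); first by case: (rx_in X0).
move=> r rr Xr; have r0 : 0 < r by apply: lt_trans Xr; case: (rx_in X0).
have ir : in_rho r by [].
have m1p := m_gt0 c_ge0 c_ex ac 1 ir; have m2p := m_gt0 c_ge0 c_ex ac 2 ir.
have m3p := m_gt0 c_ge0 c_ex ac 3 ir.
have m12 := m_succ_le c_ge0 c0 ac 1 ir; have m23 := m_succ_le c_ge0 c0 ac 2 ir.
have Xm : X <= m 1 r.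
  by rewrite -(rx_m1 X0); apply: (m_mono c_ge0 ac) => //; [exact: rx_in | exact: ltW].
have := hM (m 1 r) (lt_le_trans MX Xm).
rewrite derive1n1 derive2_rx// derive1_rx// rx_mom// expr1.
(* Both sides of the hypothesis share the positive factor r_x' x. *)
have -> : r * (m 2 r - m 3 r) / m 2 r ^+ 3 * m 1 r ^+ 2
   = - (m 1 r * (m 3 r - m 2 r) / m 2 r ^+ 2 * (r / m 2 r * m 1 r)).
  by field; rewrite gt_eqF.
have w0 : 0 < r / m 2 r * m 1 r by rewrite mulr_gt0// divr_gt0.
rewrite normrN normrM (gtr0_norm w0) ler_pM2r// => /(le_trans (ler_norm _)).
rewrite ler_pdivrMr ?exprn_gt0// => h.
have hN : `|C| + 1 <= (Num.truncn (`|C| + 1)).+1%:R.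
  by apply: ltW; exact: truncnS_gt.
apply: le_trans (_ : (`|C| + 1) * m 2 r ^+ 2 <= _); last by rewrite ler_wpM2r// sqr_ge0.
have : C * m 2 r ^+ 2 <= `|C| * m 2 r ^+ 2 by rewrite ler_wpM2r ?sqr_ge0 ?ler_norm.
have : m 1 r * m 2 r <= m 2 r ^+ 2 by rewrite expr2 ler_wpM2r// ltW.
lra.
Qed.

End SaddleInverse.

(** If c_p were the only nonzero coefficient, Re g would be as large at the
    angle 2 pi / p as at 0, which contradicts the monotonicity clause as soon
    as delta < 2 pi / p. This is where p >= 2 is used. *)
Lemma two_coefficients (R : realType) (c : nat -> R) (rho : \bar R) (delta eps : R -> R) :
  (forall k, 0 <= c k) -> c 0%N = 0 -> abs_on rho c -> saddle_data c rho delta eps ->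
  (exists2 j, (2 <= j)%N & 0 < c j) ->
  exists j l, [/\ (1 <= j < l)%N, 0 < c j & 0 < c l].
Proof.
move=> c_ge0 c0 ac sd [p p2 cp].
have [[l [l1 lp cl]]|no] := pselect (exists l, [/\ (1 <= l)%N, l != p & 0 < c l]).
  have [h|h|h] := ltngtP l p; last by rewrite h eqxx in lp.
    by exists l, p; rewrite l1 h.
  by exists p, l; rewrite h (leq_trans _ p2).
have cE k : k != p -> c k = 0.
  move=> kp; case: k kp => [//|k] kp; apply/eqP; rewrite eq_le c_ge0 andbT leNgt.
  by apply/negP => ck; apply: no; exists k.+1.
have p0 : 0 < p%:R :> R by rewrite ltr0n (leq_trans _ p2).
have pi0 := pi_gt0 R; pose phi : R := 2 * pi / p%:R.
have phi0 : 0 < phi by rewrite divr_gt0// mulr_gt0.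
have phi_pi : phi <= pi.
  by rewrite ler_pdivrMr// mulrC ler_wpM2l ?(ltW pi0)// ler_nat.
have [r [rr r0 dphi]] := near_radius_ex (sd_delta0 sd phi0).
have /andP[d0 _] := sd_delta sd rr.
have nphi : delta r < `|phi| by rewrite gtr0_norm.
have h := sd_mono sd rr (_ : - pi <= phi <= pi) nphi.
have {}h : cosum c r phi <= cosum c r (delta r).
  by apply: h; rewrite phi_pi andbT; lra.
have pphi : cos (p%:R * phi) = 1.
  by rewrite /phi mulrC divfK ?gt_eqF// mulr_natl -[pi *+ 2]add0r cosD2pi cos0.
have t0 := sums_toB (cosum_sums ac phi rr) (cosum_sums ac (delta r) rr).
have tp k : 0 <= c k * r ^+ k * cos (k%:R * phi) - c k * r ^+ k * cos (k%:R * delta r).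
  have [->|kp] := eqVneq k p; last by rewrite cE// !mul0r subrr.
  rewrite pphi -mulrBr mulr_ge0// ?one_minus_cos_ge0//.
  by rewrite mulr_ge0 ?exprn_ge0// ltW.
have := sums_to_term p tp t0; rewrite pphi -mulrBr one_minus_cosE => ht.
have s0 : 0 < sin (p%:R * delta r / 2).
  apply: sin_gt0_pi; rewrite divr_gt0 ?mulr_gt0//=.
  by move: dphi; rewrite ltr_pdivlMr// => ?; rewrite ltr_pdivrMr//; lra.
have : 0 < c p * r ^+ p * (2 * sin (p%:R * delta r / 2) ^+ 2).
  by rewrite !mulr_gt0// exprn_gt0.
by move=> /lt_le_trans/(_ ht); rewrite subr_gt0 ltNge h.
Qed.

(** * Second order expansion *)

Section SecondOrder.
Variable R : realType.
Implicit Types (f : R -> R) (s t A B : R).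

Lemma second_order_upper f (f1 f2 : R -> R) s B : 0 <= s ->
  (forall t, 0 <= t <= s -> [/\ is_derive t (1 : R) f (f1 t),
     is_derive t (1 : R) f1 (f2 t) & f2 t <= B]) ->
  f s - f 0 - s * f1 0 <= B * s ^+ 2 / 2.
Proof.
move=> s0 h.
have dlin (a b t : R) : is_derive t (1 : R) (fun x => a * x + b * x ^+ 2) (a + 2 * b * t).
  have d := is_deriveD (is_deriveZ a (is_derive_id t (1 : R))) (is_deriveZ b (is_deriveX 2 (is_derive_id t (1 : R)))).
  by apply: is_derive_eq d _; rewrite /GRing.scale /= expr1; ring.
have h1 t : 0 <= t <= s -> f1 t <= f1 0 + B * t.
  move=> /andP[t0 ts].
  have := @is_derive_nondecreasing R (fun x => (B * x + 0 * x ^+ 2) - f1 x)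
    (fun x => (B + 2 * 0 * x) - f2 x) 0 t t0.
  have H z : 0 <= z <= t -> is_derive z (1 : R) (fun x => (B * x + 0 * x ^+ 2) - f1 x) ((B + 2 * 0 * z) - f2 z) /\ 0 <= (B + 2 * 0 * z) - f2 z.
    move=> /andP[z0 zt].
    have [_ d2 b2] := h z ltac:(by rewrite z0 (le_trans zt)).
    split; first by have := is_deriveB (dlin B 0 z) d2.
    by rewrite mulr0 mul0r addr0 subr_ge0.
  by move=> /(_ H); rewrite !expr2 !mul0r !mulr0; lra.
have := @is_derive_nondecreasing R (fun x => (f1 0 * x + (B / 2) * x ^+ 2) - f x)
    (fun x => (f1 0 + 2 * (B / 2) * x) - f1 x) 0 s s0.
have H z : 0 <= z <= s -> is_derive z (1 : R) (fun x => (f1 0 * x + (B / 2) * x ^+ 2) - f x)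
    ((f1 0 + 2 * (B / 2) * z) - f1 z) /\ 0 <= (f1 0 + 2 * (B / 2) * z) - f1 z.
  move=> hz; have [d1 _ _] := h z hz.
  split; first by have := is_deriveB (dlin (f1 0) (B / 2) z) d1.
  by have := h1 z hz; rewrite mulrCA divff ?mulr1//; lra.
by move=> /(_ H); rewrite expr2 !mulr0 addr0 sub0r; lra.
Qed.

(** Taylor's formula by integrating the bound on the second derivative twice;
    negative s is reduced to positive s by reflection. *)
Lemma second_order f (f1 f2 : R -> R) s A B :
  (forall t, `|t| <= `|s| -> [/\ is_derive t (1 : R) f (f1 t),
     is_derive t (1 : R) f1 (f2 t) & `|f2 t - A| <= B]) ->
  `|f s - f 0 - s * f1 0 - A * s ^+ 2 / 2| <= B * s ^+ 2 / 2.
Proof.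
have pos f' f1' f2' s' : 0 <= s' ->
    (forall t, 0 <= t <= s' -> [/\ is_derive t (1 : R) f' (f1' t),
      is_derive t (1 : R) f1' (f2' t) & `|f2' t - A| <= B]) ->
    `|f' s' - f' 0 - s' * f1' 0 - A * s' ^+ 2 / 2| <= B * s' ^+ 2 / 2.
  move=> s0 h; rewrite ler_norml; apply/andP; split; last first.
    have := @second_order_upper f' f1' f2' s' (A + B) s0.
    have H t : 0 <= t <= s' -> [/\ is_derive t (1 : R) f' (f1' t),
        is_derive t (1 : R) f1' (f2' t) & f2' t <= A + B].
      by move=> /h[d1 d2]; rewrite ler_norml => /andP[_ ?]; split => //; lra.
    by move=> /(_ H); lra.
  have := @second_order_upper (- f') (- f1') (- f2') s' (B - A) s0.
  have H t : 0 <= t <= s' -> [/\ is_derive t (1 : R) (- f') ((- f1') t),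
      is_derive t (1 : R) (- f1') ((- f2') t) & (- f2') t <= B - A].
    move=> /h[d1 d2]; rewrite ler_norml => /andP[? _]; split.
    - exact: is_deriveN.
    - exact: is_deriveN.
    - by rewrite fctE; lra.
  by move=> /(_ H); rewrite !fctE; lra.
move=> h; have [s0|s0] := leP 0 s.
  apply: (pos f f1 f2) => // t /andP[t0 ts]; apply: h.
  by rewrite !ger0_norm.
have opp (g dg : R -> R) t : is_derive (- t) (1 : R) g (dg (- t)) ->
    is_derive t (1 : R) (fun x => g (- x)) (- dg (- t)).
  move=> d; have d1 := is_derive1_comp d (is_deriveN (is_derive_id t (1 : R))).
  by apply: is_derive_eq d1 _; rewrite mulrN1.
have := pos (fun x => f (- x)) (fun x => - f1 (- x)) (fun x => f2 (- x)) (- s).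
rewrite oppr_ge0 (ltW s0) opprK oppr0 mulrNN sqrrN; apply => //.
move=> t /andP[t0 ts]; have [d1 d2 b2] := h (- t) ltac:(by rewrite normrN ger0_norm// ltr0_norm).
split => //; first exact: (opp f f1).
have d3 := is_deriveN (opp f1 f2 t d2).
by apply: is_derive_eq d3 _; rewrite opprK.
Qed.

End SecondOrder.

(** * Moment generating function of the number of cycles *)

Section SaddleMgf.
Variables (R : realType) (c : nat -> R) (rho : \bar R) (delta eps rx : R -> R).
Hypothesis c_ge0 : forall k, 0 <= c k.
Hypothesis c0 : c 0%N = 0.
Hypothesis c_two : exists j l, [/\ (1 <= j < l)%N, 0 < c j & 0 < c l].
Hypothesis ac : abs_on rho c.
Hypothesis sd : saddle_data c rho delta eps.
Hypothesis rx_in : forall x : R, 0 < x -> pos_range rho (rx x).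
Hypothesis rx_m1 : forall x : R, 0 < x -> mom c 1 (rx x) = x.
Hypothesis reg_var : exists N : nat, near_radius rho
  (fun r => mom c 1 r * mom c 3 r <= N%:R * mom c 2 r ^+ 2).
Implicit Types r x y t : R.
Notation m := (mom c).
Notation in_rho := (pos_range rho).
Local Notation c_ex := (c_ex c_two).
Local Notation m_gt0 := (m_gt0 c_ge0 c_ex ac).
Local Notation rx_le := (rx_le c_ge0 c_ex ac rx_in rx_m1).

Lemma m1_onto x : 0 < x -> exists2 r, in_rho r & m 1 r = x.
Proof. by move=> x0; exists (rx x); [exact: rx_in | exact: rx_m1]. Qed.

Lemma log_m1_rx x : 0 < x -> log_m1 c (rx x) = ln x.
Proof. by move=> x0; rewrite /log_m1 rx_m1. Qed.

Lemma rx_eventually P : at_radius rho P ->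
  exists2 X, 1 <= X & forall x, X <= x -> P (rx x).
Proof.
move=> [r0 ir h]; exists (Num.max 1 (m 1 r0)); first by rewrite le_max lexx.
move=> x; rewrite ge_max => /andP[x1 mx]; have x0 := lt_le_trans ltr01 x1.
apply: h; first exact: rx_in.
rewrite -(rx_mom c_ge0 c_ex ac rx_in rx_m1 ir); apply: rx_le => //.
exact: m_gt0.
Qed.

(** The argument x e^(-t) at which the saddle point for the weights e^t theta
    is attained. *)
Definition tilt x t := x * expR (- t).

Lemma tilt_gt0 x t : 0 < x -> 0 < tilt x t.
Proof. by move=> x0; rewrite mulr_gt0// expR_gt0. Qed.

Lemma tilt0 x : tilt x 0 = x.
Proof. by rewrite /tilt oppr0 expR0 mulr1. Qed.

Lemma ln_tilt x t : 0 < x -> ln (tilt x t) = ln x - t.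
Proof. by move=> x0; rewrite lnM ?posrE ?expR_gt0// expRK. Qed.

Lemma tilt_le0 x t : 0 < x -> t <= 0 -> x <= tilt x t.
Proof. by move=> x0 t0; rewrite ler_peMr ?(ltW x0)// -expR0 ler_expR oppr_ge0. Qed.

Lemma tilt_ge0 x t : 0 < x -> 0 <= t -> tilt x t <= x.
Proof. by move=> x0 t0; rewrite ler_piMr ?(ltW x0)// -expR0 ler_expR oppr_le0. Qed.

Lemma tilt_large x t X : `|t| <= 1 / 2 -> 1 <= X -> 4 * X <= x -> X <= tilt x t.
Proof.
move=> ht X1 hx; apply: le_trans (_ : x * expR (- 1) <= _); last first.
  by apply: ler_wpM2l; [lra | rewrite ler_expR lerN2; have := ler_norm t; lra].
have e4 := @expR1_le4 R; have : 1 / 4 <= expR (- 1) :> R.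
  by rewrite expRN div1r lef_pV2 ?posrE ?expR_gt0.
move=> h; apply: le_trans (_ : x * (1 / 4) <= _); first lra.
by rewrite ler_wpM2l//; lra.
Qed.

Lemma expR_unit t : `|t| <= 1 / 2 -> 1 / 2 <= expR t <= 2.
Proof.
move=> ht; have hz : (0 : R) < 1 / 2 by lra.
have e2 : expR (1 / 2) <= 2 :> R.
  have h : expR (1 / 2) ^+ 2 <= 2 ^+ 2 :> R.
    rewrite -expRM_natl (_ : 2%:R * (1 / 2) = 1); last by field.
    by have := @expR1_le4 R; lra.
  by move: h; rewrite ler_pXn2r// nnegrE ?expR_ge0.
move: ht; rewrite ler_norml => /andP[t1 t2]; apply/andP; split; last first.
  by apply: le_trans e2; rewrite ler_expR.
apply: le_trans (_ : expR (- (1 / 2)) <= _); last by rewrite ler_expR; lra.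
by rewrite expRN div1r lef_pV2 ?posrE ?expR_gt0// -div1r.
Qed.

(** The exponent Phi(t) of the saddle point approximation of h_x(e^t). *)
Definition phase x t := expR t * m 0 (rx (tilt x t)) - x * ln (rx (tilt x t)).

Lemma is_derive_tilt x t : is_derive t (1 : R) (tilt x) (- tilt x t).
Proof.
have d := is_derive1_comp (is_derive_expR (- t)) (is_deriveN (is_derive_id t (1 : R))).
have d1 := is_deriveZ x d.
by apply: is_derive_eq d1 _; rewrite /GRing.scale /= mulrN1 mulrN.
Qed.

(** The contributions of the moving saddle point cancel, as it is a critical
    point of e^t g(r) - x ln r. *)
Lemma is_derive_phase x t : 0 < x ->
  is_derive t (1 : R) (phase x) (expR t * m 0 (rx (tilt x t))).
Proof.
move=> x0; have y0 := tilt_gt0 t x0; have dy := is_derive_tilt x t.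
have m2 := m_gt0 2 (rx_in y0).
have d0 := is_derive1_comp (is_derive_mom_rx c_ge0 c_ex ac rx_in rx_m1 0 y0) dy.
have dl := is_derive1_comp (is_derive_ln_rx c_ge0 c_ex ac rx_in rx_m1 y0) dy.
have d := is_deriveB (is_deriveM (is_derive_expR t) d0) (is_deriveZ x dl).
apply: is_derive_eq d _; rewrite /GRing.scale /= rx_m1//.
have hx : expR t * tilt x t = x by rewrite /tilt mulrCA -expRD subrr expR0 mulr1.
set y := tilt x t in hx m2 *; clearbody y; rewrite -hx.
by field; rewrite gt_eqF.
Qed.

Lemma is_derive_phase1 x t : 0 < x ->
  is_derive t (1 : R) (fun t => expR t * m 0 (rx (tilt x t))) (expR t * residual c (rx (tilt x t))).
Proof.
move=> x0; have y0 := tilt_gt0 t x0; have dy := is_derive_tilt x t.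
have m2 := m_gt0 2 (rx_in y0).
have d0 := is_derive1_comp (is_derive_mom_rx c_ge0 c_ex ac rx_in rx_m1 0 y0) dy.
have d := is_deriveM (is_derive_expR t) d0.
apply: is_derive_eq d _; rewrite /GRing.scale /= /residual rx_m1//.
by field; rewrite gt_eqF.
Qed.

(** Stability of the second derivative of the phase. For t >= 0 the bound
    [residual_ratio] is applied from the tilted point up to x, for t < 0 from x up
    to the tilted point; monotonicity gives the other half. *)
Lemma variance_stable : exists C X, [/\ 0 < C, 1 <= X & forall x t, X <= x -> `|t| <= 1 / 2 ->
  C * `|t| * ln x <= 1 ->
  `|expR t * residual c (rx (tilt x t)) - residual c (rx x)| <= (4 * `|t| + C * `|t| * ln x) * residual c (rx x)].
Proof.
have [C C0 /rx_eventually[X X1 hX]] := residual_ratio c_ge0 c0 c_two ac sd m1_onto reg_var.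
exists C, (4 * X); split => //; first lra.
move=> x t xX ht hC; have x0 : 0 < x by lra.
have y0 := tilt_gt0 t x0; have ix := rx_in x0; have iy := rx_in y0.
have yX := tilt_large ht X1 xX; have xX' : X <= x by lra.
have Xlnx : 0 <= ln x by apply: ln_ge0; lra.
have v0 := residual_ge0 c_ge0 c_ex ac ix; have w0 := residual_ge0 c_ge0 c_ex ac iy.
pose k := C * `|t| * ln x; rewrite -/k in hC *.
have k0 : 0 <= k by rewrite !mulr_ge0 ?(ltW C0).
have close : `|residual c (rx (tilt x t)) - residual c (rx x)| <= k * residual c (rx x).
  have [t0|t0] := leP 0 t.
    have le := rx_le y0 (tilt_ge0 x0 t0).
    have mono := residual_mono c_ge0 c_ex ac ix iy le.
    have := hX _ yX (rx x) ix le; rewrite !log_m1_rx// ln_tilt//.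
    have -> : ln x - (ln x - t) = t by ring.
    have ktl : C * t * (ln x - t) <= k.
      rewrite /k ger0_norm// ler_wpM2l ?mulr_ge0 ?(ltW C0)//; lra.
    move=> /(_ (le_trans ktl hC)) h.
    rewrite distrC ger0_norm ?subr_ge0//.
    have : residual c (rx (tilt x t)) * (1 + C * t * (ln x - t)) <= residual c (rx (tilt x t)) * (1 + k).
      by rewrite ler_wpM2l// lerD2l.
    have : residual c (rx (tilt x t)) * k <= residual c (rx x) * k by rewrite ler_wpM2r.
    lra.
  have le := rx_le x0 (tilt_le0 x0 (ltW t0)).
  have mono := residual_mono c_ge0 c_ex ac iy ix le.
  have := hX _ xX' _ iy le; rewrite !log_m1_rx// ln_tilt//.
  have -> : ln x - t - ln x = `|t| by rewrite ltr0_norm//; ring.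
  move=> /(_ hC); rewrite -/k => h; rewrite ger0_norm ?subr_ge0//; lra.
have vk : k * residual c (rx x) <= residual c (rx x) by rewrite ler_piMl.
have v2 : residual c (rx (tilt x t)) <= 2 * residual c (rx x).
  by move: close => /(le_trans (ler_norm _)); lra.
have e1 : `|expR t - 1| <= 2 * `|t|.
  apply: le_trans (expR_sub1_norm (lexx `|t|)) _; rewrite mulrC ler_wpM2r//.
  by have /andP[] := @expR_unit `|t| ltac:(by rewrite normr_id).
have -> : expR t * residual c (rx (tilt x t)) - residual c (rx x) =
   (expR t - 1) * residual c (rx (tilt x t)) + (residual c (rx (tilt x t)) - residual c (rx x)) by ring.
apply: le_trans (ler_normD _ _) _; rewrite [leRHS]mulrDl; apply: lerD => //.
rewrite normrM (ger0_norm w0).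
apply: le_trans (_ : (2 * `|t|) * (2 * residual c (rx x)) <= _); first exact: ler_pM.
lra.
Qed.

Lemma phase_expansion : exists C X, [/\ 0 < C, 1 <= X & forall x s, X <= x -> `|s| <= 1 / 2 ->
  C * `|s| * ln x <= 1 ->
  `|phase x s - phase x 0 - s * m 0 (rx x) - residual c (rx x) * s ^+ 2 / 2|
   <= (4 * `|s| + C * `|s| * ln x) * residual c (rx x) * s ^+ 2 / 2].
Proof.
have [C [X [C0 X1 h]]] := variance_stable.
exists C, X; split => // x s xX hs hC; have x0 : 0 < x by lra.
have lnx : 0 <= ln x by apply: ln_ge0; lra.
have := @second_order R (phase x) (fun t => expR t * m 0 (rx (tilt x t)))
   (fun t => expR t * residual c (rx (tilt x t))) s (residual c (rx x)).
rewrite tilt0 expR0 mul1r; apply => t ts.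
have ktl : C * `|t| * ln x <= C * `|s| * ln x.
  by rewrite ler_wpM2r// ler_wpM2l// ltW.
split; [exact: is_derive_phase | exact: is_derive_phase1 |].
apply: le_trans (h x t xX (le_trans ts hs) (le_trans ktl hC)) _.
rewrite ler_wpM2r ?(residual_ge0 c_ge0 c_ex ac (rx_in x0))//; lra.
Qed.

(** From [m2_growth], since ln m_1 changes by exactly t between the two saddle
    points. *)
Lemma m2_close : exists N X : R, [/\ 0 <= N, 1 <= X & forall x t, X <= x -> `|t| <= 1 / 2 ->
  expR (- (N * `|t|)) <= m 2 (rx x) / (expR t * m 2 (rx (tilt x t))) <= expR (N * `|t|)].
Proof.
have [N N1 /rx_eventually[X X1 hX]] := m2_growth c_ge0 c_two ac reg_var.
exists (N%:R + 1), (4 * X); split; [by rewrite addr_ge0 | lra |].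
move=> x t xX ht; have x0 : 0 < x by lra.
have y0 := tilt_gt0 t x0; have ix := rx_in x0; have iy := rx_in y0.
have yX := tilt_large ht X1 xX; have xX' : X <= x by lra.
have mx := m_gt0 2 ix; have my := m_gt0 2 iy.
have N0 : 0 <= N%:R :> R by [].
rewrite ler_pdivlMr ?mulr_gt0 ?expR_gt0// ler_pdivrMr ?mulr_gt0 ?expR_gt0//.
rewrite !mulrA -!expRD.
have [t0|t0] := leP 0 t.
  have le := rx_le y0 (tilt_ge0 x0 t0); have mono := m_mono c_ge0 ac 2 ix iy le.
  have := hX _ yX _ ix le; rewrite !log_m1_rx// ln_tilt//.
  have -> : ln x - (ln x - t) = t by ring.
  rewrite ger0_norm// => h; apply/andP; split.
    apply: le_trans mono; rewrite ler_piMl ?(ltW my)// -[leRHS]expR0 ler_expR.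
    by have : 0 <= N%:R * t by [rewrite mulr_ge0]; lra.
  apply: le_trans h _; rewrite mulrC ler_wpM2r ?(ltW my)// ler_expR; lra.
have le := rx_le x0 (tilt_le0 x0 (ltW t0)); have mono := m_mono c_ge0 ac 2 iy ix le.
have := hX _ xX' _ iy le; rewrite !log_m1_rx// ln_tilt//.
have -> : ln x - t - ln x = - t by ring.
rewrite ltr0_norm// => h; apply/andP; split.
  apply: le_trans (_ : expR (- ((N%:R + 1) * - t) + t) * (m 2 (rx x) * expR (N%:R * - t)) <= _).
    by rewrite ler_wpM2l// expR_ge0.
  rewrite mulrCA -expRD ler_piMr ?(ltW mx)// -[leRHS]expR0 ler_expR; lra.
apply: le_trans mono _; rewrite ler_peMl ?(ltW my)// -[leLHS]expR0 ler_expR.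
by have : 0 <= N%:R * - t by [rewrite mulr_ge0// oppr_ge0 ltW]; lra.
Qed.

Implicit Types (e u A X : R) (n : nat).
Variable H : R -> nat -> R.
Hypothesis exp_rec_H : forall u : R, 0 <= u -> exp_rec c u (H u).

Lemma near_nat X : \forall n \near \oo, X <= n%:R :> R.
Proof. exact: nbhs_infty_ger. Qed.

(** The quantity that [local_limit] sends to 1, for n points and weights
    multiplied by e^t. *)
Definition local_term n t := H (expR t) n * rx (tilt n%:R t) ^+ n
  * expR (- (expR t * m 0 (rx (tilt n%:R t))))
  * Num.sqrt (2 * pi * (expR t * m 2 (rx (tilt n%:R t)))).

Lemma local_close e : 0 < e -> exists2 X : R, 1 <= X & forall n t, X <= n%:R ->
  `|t| <= 1 / 2 -> `|local_term n t - 1| <= e.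
Proof.
move=> e0; have L := local_limit c_ge0 c0 c_ex ac sd e0.
have [X X1 hX] := rx_eventually (near_at_radius L).
exists (4 * X); first lra.
move=> n t nX ht; have n0 : 0 < n%:R :> R by lra.
have y0 := tilt_gt0 t n0; have /andP[u1 u2] := expR_unit ht.
apply: (hX _ (tilt_large ht X1 nX) (rx_in y0)) => //.
  by rewrite rx_m1// /tilt mulrCA -expRD subrr expR0 mulr1.
exact: exp_rec_H (expR_ge0 _).
Qed.

Lemma H_eventually_gt0 : \forall n \near \oo, 0 < H 1 n.
Proof.
have h2 : (0 : R) < 1 / 2 by lra.
have [X X1 hX] := local_close h2.
near=> n; have nX : X <= n%:R by near: n; exact: near_nat.
have h0 : `|0 : R| <= 1 / 2 by rewrite normr0; lra.
have [H0 _ _] := exp_rec_H ler01.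
rewrite lt0r H0 andbT; apply/eqP => e; have := hX n 0 nX h0.
by rewrite /local_term expR0 e !mul0r sub0r normrN normr1; lra.
Unshelve. all: by end_near. Qed.

(** The two saddle point approximations differ by the exponential of a
    difference of phases and by the square root of a ratio of second moments.
    *)
Lemma mgf_factorization n t : (0 < n)%N -> H 1 n != 0 ->
  H (expR t) n / H 1 n * expR (- (t * m 0 (rx n%:R))) =
  local_term n t / local_term n 0
  * expR (phase n%:R t - phase n%:R 0 - t * m 0 (rx n%:R))
  * Num.sqrt (m 2 (rx n%:R) / (expR t * m 2 (rx (tilt n%:R t)))).
Proof.
move=> n0 Hn; have x0 : 0 < n%:R :> R by rewrite ltr0n.
have y0 := tilt_gt0 t x0; have [_ r0] := rx_in x0; have [_ s0] := rx_in y0.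
have mr := m_gt0 2 (rx_in x0); have ms := m_gt0 2 (rx_in y0).
have et := expR_gt0 t.
have phE (u : R) : 0 < rx (tilt n%:R u) -> expR (phase n%:R u) =
    expR (expR u * m 0 (rx (tilt n%:R u))) / rx (tilt n%:R u) ^+ n.
  by move=> ru; rewrite /phase expRD expRN expRM_natl lnK.
have -> : expR (phase n%:R t - phase n%:R 0 - t * m 0 (rx n%:R)) =
    expR (phase n%:R t) / expR (phase n%:R 0) * expR (- (t * m 0 (rx n%:R))).
  by rewrite -expRN -!expRD.
rewrite !phE ?tilt0// /local_term tilt0 expR0 !mul1r !expRN.
set p2 := 2 * pi; have p0 : 0 < p2 by rewrite mulr_gt0 ?pi_gt0.
have q0 : 0 < expR t * m 2 (rx (tilt n%:R t)) by rewrite mulr_gt0.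
rewrite !(sqrtrM _ (ltW p0)) (sqrtrM _ (ltW mr)) sqrtrV ?(ltW q0)//.
have S1 : 0 < Num.sqrt p2 by rewrite sqrtr_gt0.
have S2 : 0 < Num.sqrt (m 2 (rx n%:R)) by rewrite sqrtr_gt0.
have S3 : 0 < Num.sqrt (expR t * m 2 (rx (tilt n%:R t))) by rewrite sqrtr_gt0.
have E1 := expR_gt0 (m 0 (rx n%:R)).
have E2 := expR_gt0 (expR t * m 0 (rx (tilt n%:R t))).
have E3 := expR_gt0 (t * m 0 (rx n%:R)).
have R1 : 0 < rx n%:R ^+ n by rewrite exprn_gt0.
have R2 : 0 < rx (tilt n%:R t) ^+ n by rewrite exprn_gt0.
by field; rewrite Hn !gt_eqF.
Qed.

Definition variance n := residual c (rx n%:R).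

Lemma variance_large A : 0 < A -> exists2 X : R, 1 <= X & forall n, X <= n%:R ->
  A * ln n%:R ^+ 2 <= variance n.
Proof.
move=> A0; have [X X1 h] := rx_eventually (residual_large c_ge0 c0 c_two ac sd m1_onto reg_var A0).
exists X => // n nX; have := h _ nX.
by rewrite log_m1_rx//; lra.
Qed.

Section Scaled.
Variable tau : R.
Definition mgf_shift n := tau / Num.sqrt (variance n).

(** This is the use of [residual_large]: the variance beats every multiple of (ln
    n)^2, and ln m_1(r_n) = ln n. *)
Lemma shift_small e : 0 < e -> \forall n \near \oo,
  [/\ 1 <= ln (n%:R : R), 0 < variance n, variance n * mgf_shift n ^+ 2 = tau ^+ 2
    & `|mgf_shift n| * ln n%:R <= e].
Proof.
(* With A (ln n)^2 <= variance n, the product of s and ln n is at most |tau| /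
   sqrt A <= e. *)
move=> e0; pose A := (tau ^+ 2 + 1) / e ^+ 2.
have t1 : 0 < tau ^+ 2 + 1 by rewrite ltr_wpDl ?sqr_ge0.
have A0 : 0 < A by rewrite divr_gt0 ?exprn_gt0.
have [X X1 hX] := variance_large A0.
near=> n.
have ln1 : 1 <= ln (n%:R : R).
  have : expR 1 <= n%:R :> R by near: n; exact: near_nat.
  by move=> h; rewrite -[leLHS]expRK ler_ln ?posrE ?expR_gt0// (lt_le_trans (expR_gt0 1) h).
have vA : A * ln n%:R ^+ 2 <= variance n by apply: hX; near: n; exact: near_nat.
have l0 : 0 < ln (n%:R : R) by lra.
have v0 : 0 < variance n by apply: lt_le_trans vA; rewrite mulr_gt0 ?exprn_gt0.
have vs : variance n * mgf_shift n ^+ 2 = tau ^+ 2.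
  by rewrite /mgf_shift expr_div_n sqr_sqrtr ?(ltW v0)// mulrC divfK ?gt_eqF.
split => //.
rewrite -(@ler_pXn2r _ 2) ?nnegrE ?mulr_ge0 ?(ltW l0) ?(ltW e0)//.
rewrite exprMn real_normK ?num_real// -(ler_pM2l A0).
apply: le_trans (_ : variance n * mgf_shift n ^+ 2 <= _).
  by rewrite mulrCA [leRHS]mulrC ler_wpM2l ?sqr_ge0.
by rewrite vs /A divfK ?gt_eqF ?exprn_gt0//; lra.
Unshelve. all: by end_near. Qed.

Lemma shift_le e : 0 < e -> \forall n \near \oo, `|mgf_shift n| <= e.
Proof.
move=> e0; near=> n.
have [l1 _ _ h] : [/\ 1 <= ln (n%:R : R), 0 < variance n, variance n * mgf_shift n ^+ 2 = tau ^+ 2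
    & `|mgf_shift n| * ln n%:R <= e] by near: n; exact: shift_small.
by apply: le_trans h; rewrite ler_peMr.
Unshelve. all: by end_near. Qed.

Lemma local_cvg (t : nat -> R) : (\forall n \near \oo, `|t n| <= 1 / 2) ->
  local_term n (t n) @[n --> \oo] --> (1 : R).
Proof.
move=> ht; apply/cvgrPdist_le => e e0; have [X X1 hX] := local_close e0.
near=> n; rewrite distrC; apply: hX; first by near: n; exact: near_nat.
by near: n.
Unshelve. all: by end_near. Qed.

Lemma phase_cvg : phase n%:R (mgf_shift n) - phase n%:R 0 - mgf_shift n * m 0 (rx n%:R)
  @[n --> \oo] --> tau ^+ 2 / 2.
Proof.
have [C [X [C0 X1 hX]]] := phase_expansion.
apply/cvgrPdist_le => e e0.
have t1 : 0 < tau ^+ 2 + 1 by rewrite ltr_wpDl ?sqr_ge0.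
pose d := Num.min (1 / 2) (Num.min 1 (e / (tau ^+ 2 + 1)) / (4 + C)).
have C4 : 0 < 4 + C by lra.
have d0 : 0 < d.
  by rewrite lt_min divr_gt0//= divr_gt0// lt_min ltr01 divr_gt0.
have d2 : d <= 1 / 2 by rewrite ge_min lexx.
have dC : (4 + C) * d <= Num.min 1 (e / (tau ^+ 2 + 1)).
  by rewrite mulrC -ler_pdivlMr// ge_min lexx orbT.
have dC1 : (4 + C) * d <= 1 by apply: le_trans dC _; rewrite ge_min lexx.
have dCe : (4 + C) * d <= e / (tau ^+ 2 + 1).
  by apply: le_trans dC _; rewrite ge_min lexx orbT.
near=> n.
have [l1 v0 vs h] : [/\ 1 <= ln (n%:R : R), 0 < variance n, variance n * mgf_shift n ^+ 2 = tau ^+ 2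
    & `|mgf_shift n| * ln n%:R <= d] by near: n; exact: shift_small.
have nX : X <= n%:R by near: n; exact: near_nat.
have sl : `|mgf_shift n| <= `|mgf_shift n| * ln n%:R by rewrite ler_peMr.
have k1 : 4 * `|mgf_shift n| + C * `|mgf_shift n| * ln n%:R <= (4 + C) * d.
  rewrite [leRHS]mulrDl -mulrA; apply: lerD; apply: ler_wpM2l; lra.
have sC : C * `|mgf_shift n| * ln n%:R <= 1.
  by apply: le_trans (le_trans k1 dC1); rewrite lerDr mulr_ge0.
have := hX _ _ nX (le_trans sl (le_trans h d2)) sC.
rewrite -/(variance n); set k := _ + _ in k1 *.
have -> : k * variance n * mgf_shift n ^+ 2 / 2 = k * (tau ^+ 2 / 2) by rewrite -vs !mulrA.
rewrite vs distrC => /le_trans; apply.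
apply: le_trans (_ : e / (tau ^+ 2 + 1) * (tau ^+ 2 / 2) <= _).
  by rewrite ler_wpM2r ?divr_ge0 ?sqr_ge0//; exact: le_trans k1 dCe.
rewrite mulrAC ler_pdivrMr// ler_wpM2l ?(ltW e0)//.
by have := sqr_ge0 tau; lra.
Unshelve. all: by end_near. Qed.

Lemma m2_cvg : m 2 (rx n%:R) / (expR (mgf_shift n) * m 2 (rx (tilt n%:R (mgf_shift n))))
  @[n --> \oo] --> (1 : R).
Proof.
have [N [X [N0 X1 hX]]] := m2_close.
have s0 : N * `|mgf_shift n| @[n --> \oo] --> 0.
  rewrite -(mulr0 N); apply: cvgMr; apply/cvgrPdist_le => e e0.
  near=> n; rewrite sub0r normrN normr_id; near: n; exact: shift_le.
apply: (@squeeze_cvgr _ _ _ _ (fun n => expR (- (N * `|mgf_shift n|))) (fun n => expR (N * `|mgf_shift n|))).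
- near=> n; apply: hX; first by near: n; exact: near_nat.
  by near: n; apply: shift_le; lra.
- rewrite -expR0 -oppr0; apply: (cvg_comp _ _ (cvgN s0)); exact: continuous_expR.
- rewrite -expR0; apply: (cvg_comp _ _ s0); exact: continuous_expR.
Unshelve. all: by end_near. Qed.

Theorem saddle_mgf :
  H (expR (mgf_shift n)) n / H 1 n * expR (- (mgf_shift n * m 0 (rx n%:R)))
    @[n --> \oo] --> expR (tau ^+ 2 / 2).
Proof.
have h2 : (0 : R) < 1 / 2 by lra.
have l1 := local_cvg (shift_le h2).
have l0 : local_term n 0 @[n --> \oo] --> (1 : R).
  by apply: local_cvg; near=> n; rewrite normr0 ltW.
have D : expR (phase n%:R (mgf_shift n) - phase n%:R 0 - mgf_shift n * m 0 (rx n%:R))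
    @[n --> \oo] --> expR (tau ^+ 2 / 2).
  by apply: (cvg_comp _ _ phase_cvg); exact: continuous_expR.
have S : Num.sqrt (m 2 (rx n%:R) / (expR (mgf_shift n) * m 2 (rx (tilt n%:R (mgf_shift n)))))
    @[n --> \oo] --> Num.sqrt (1 : R).
  by apply: (cvg_comp _ _ m2_cvg); exact: sqrt_continuous.
have all : local_term n (mgf_shift n) / local_term n 0
    * expR (phase n%:R (mgf_shift n) - phase n%:R 0 - mgf_shift n * m 0 (rx n%:R))
    * Num.sqrt (m 2 (rx n%:R) / (expR (mgf_shift n) * m 2 (rx (tilt n%:R (mgf_shift n)))))
    @[n --> \oo] --> expR (tau ^+ 2 / 2).
  have := cvgM (cvgM (cvgM l1 (cvgV (oner_neq0 R) l0)) D) S.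
  by rewrite sqrtr1 invr1 !mul1r mulr1; exact.
apply: cvg_trans all; apply: near_eq_cvg; near=> n.
have n0 : (0 < n)%N by near: n; exact: nbhs_infty_gt.
have Hn : 0 < H 1 n by near: n; exact: H_eventually_gt0.
by rewrite mgf_factorization// gt_eqF.
Unshelve. all: by end_near. Qed.

End Scaled.
End SaddleMgf.

(** * Asymptotic normality *)

Section NormalizedCycles.
Variables (R : realType) (theta : nat -> R).
Hypothesis theta_ge0 : forall j, (1 <= j)%N -> 0 <= theta j.

Definition normalized_mean (mu sigma : R) n (f : R -> R) : R :=
  \sum_(s : 'S_n) ewens_weight theta s / (ewens_h theta n * n`!%:R)
     * f (((total_cycles s)%:R - mu) / sigma).

Lemma normalized_mean_expectation mu sigma n :
  expectation (@normalized_mean mu sigma n).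
Proof.
split=> [f g A S _ _|f g _ _ fg].
  rewrite /normalized_mean !mulr_sumr -big_split /=.
  by apply: eq_bigr => s _; ring.
apply: ler_sum => s _; rewrite ler_wpM2l//.
rewrite divr_ge0 ?ewens_weight_ge0// mulr_ge0// mulr_ge0 ?invr_ge0//.
by apply: sumr_ge0 => s' _; exact: ewens_weight_ge0.
Qed.

Lemma normalized_mean_exp mu sigma n t :
  normalized_mean mu sigma n (fun x => expR (t * x)) =
  ewens_h (fun j => expR (t / sigma) * theta j) n / ewens_h theta n
    * expR (- (t / sigma * mu)).
Proof.
have f0 : n`!%:R != 0 :> R by rewrite pnatr_eq0 -lt0n fact_gt0.
have -> : ewens_h (fun j => expR (t / sigma) * theta j) n / ewens_h theta n =
    (n`!%:R * ewens_h (fun j => expR (t / sigma) * theta j) n) / (ewens_h theta n * n`!%:R).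
  move: (ewens_h theta n) (ewens_h _ n) => h1 h2.
  by rewrite (mulrC h1) invfM mulrACA divff// mul1r.
rewrite -ewens_mgf !mulr_suml; apply: eq_bigr => s _.
have -> : t * (((total_cycles s)%:R - mu) / sigma) =
   t / sigma * (total_cycles s)%:R + - (t / sigma * mu) by ring.
rewrite expRD; ring.
Qed.

Lemma normalized_mean_below mu sigma n x :
  normalized_mean mu sigma n (below x) =
  ewens_prob theta [set s : 'S_n | ((total_cycles s)%:R - mu) / sigma <= x]%SET.
Proof.
rewrite /normalized_mean /ewens_prob [RHS]big_mkcond /=; apply: eq_bigr => s _.
by rewrite inE /below; case: (_ <= x); rewrite ?mulr1 ?mulr0.
Qed.

End NormalizedCycles.

(* [theta_nondegenerate] excludes only g(t) = theta_1 t. That series is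
   log-admissible (rho = +oo, a(r) = b(r) = theta_1 r) and satisfies the
   derivative bounds, but K_{0n} = n almost surely and
   g(r_n) + n * eta_1(n) = 0, so no normal limit can hold. When rho < +oo the
   hypothesis is automatic. *)
Theorem corollary3p5 (R : realType) (theta : nat -> R) (a b rx : R -> R)
  (theta_ge0 : forall j, (1 <= j)%N -> 0 <= theta j)
  (theta_nondegenerate : exists2 j, (2 <= j)%N & theta j != 0)
  (g_admissible : log_admissible (g_coef theta) a b)
  (rx_saddle : saddle_point (cvg_radius (g_coef theta)) a rx)
  (rx_derivatives : forall k, (2 <= k <= 4)%N -> exists C : R,
     \forall x \near +oo,
       `|derive1n k rx x * x ^+ k| <= C * `|derive1n k.-1 rx x * x ^+ k.-1|) :
  exists mu sigma : nat -> R,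
    [/\ cvg_in_distribution
          (fun n x => ewens_prob theta
             [set s : 'S_n | ((total_cycles s)%:R - mu n) / sigma n <= x]%SET)
          (normal_prob 0 1),
        exists2 e : nat -> R, e n @[n --> \oo] --> 0 &
          \forall n \near \oo,
            mu n = gR (g_coef theta) (rx n%:R) * (1 + e n)
      & exists2 e : nat -> R, e n @[n --> \oo] --> 0 &
          \forall n \near \oo,
            sigma n ^+ 2 = (gR (g_coef theta) (rx n%:R)
                            + n%:R * eta1 rx n%:R) * (1 + e n)].
Proof.
pose c := g_coef theta.
have [c_ge0 rho_gt0 ab [delta [eps sd]]] := saddle_data_of_log_admissible g_admissible.
set rho := cvg_radius (g_coef theta) in rho_gt0 ab sd rx_saddle.
have ac : abs_on rho c := abs_on_radius c_ge0.
have c0 : c 0%N = 0 by [].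
have c_two : exists j l, [/\ (1 <= j < l)%N, 0 < c j & 0 < c l].
  apply: (two_coefficients c_ge0 c0 ac sd); have [j j2 tj] := theta_nondegenerate.
  have j1 : (1 <= j)%N by exact: leq_trans j2.
  exists j => //; case: j j1 j2 tj => // j _ _ tj.
  by rewrite /c /= divr_gt0// lt0r tj theta_ge0.
have c_ex := c_ex c_two.
have rx_m1 (x : R) : 0 < x -> mom c 1 (rx x) = x.
  by move=> /rx_saddle[rr ax _]; rewrite -(proj1 (ab _ rr)).
have rx_in (x : R) : 0 < x -> pos_range rho (rx x).
  move=> x0; have [rr _ _] := rx_saddle x x0; split => //; have [r0 _] := rr.
  rewrite lt0r r0 andbT; apply/eqP => e; have := rx_m1 x x0.
  have := mom_sums ac 1 rr; rewrite e => h.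
  (* r_x = 0 is excluded because m_1(0) = 0 < x. *)
  have z : sums_to (fun=> 0 : R) (mom c 1 0).
    apply: sums_to_ext h _ => -[|k]; first by rewrite expr1 mulr0.
    by rewrite expr0n /= mulr0 mul0r.
  by rewrite (sums_to_unique z (sums_to0 R)) => xe; rewrite -xe ltxx in x0.
have reg : exists N : nat, near_radius rho
    (fun r => mom c 1 r * mom c 3 r <= N%:R * mom c 2 r ^+ 2).
  have [C hC] := rx_derivatives 2 isT.
  exact: (regular_moments c_ge0 c0 c_ex ac rx_in rx_m1 hC).
pose H (u : R) := ewens_h (fun j => u * theta j).
have hH (u : R) : 0 <= u -> exp_rec c u (H u) by exact: ewens_exp_rec.
have H1 n : H 1 n = ewens_h theta n.
  by rewrite /H; congr (ewens_h _ n); apply/funext => j; rewrite mul1r.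
pose mu (n : nat) := mom c 0 (rx n%:R).
pose sigma (n : nat) := Num.sqrt (variance c rx n).
exists mu, sigma; split.
- move=> x _.
  have hEn n : expectation (@normalized_mean R theta (mu n) (sigma n) n).
    exact: normalized_mean_expectation.
  have mgf (t : R) : @normalized_mean R theta (mu n) (sigma n) n (fun x => expR (t * x))
      @[n --> \oo] --> gauss_mean (fun x => expR (t * x)).
    rewrite gauss_mean_exp.
    have := saddle_mgf c_ge0 c0 c_two ac sd rx_in rx_m1 reg hH (tau := t).
    apply: cvg_trans; apply: near_eq_cvg; near=> n.
    by rewrite normalized_mean_exp /mgf_shift -/(sigma n) H1.
  have lim := mgf_cvg_below hEn (gauss_mean_expectation R) mgf
    (@gauss_mean_below_lipschitz R) (a := x).
  rewrite -gauss_mean_below; apply: cvg_EFin; first by near=> n.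
  apply: cvg_trans lim; apply: near_eq_cvg; near=> n.
  by rewrite /= normalized_mean_below.
- exists (fun=> 0); first exact: cvg_cst.
  by near=> n; rewrite addr0 mulr1.
- exists (fun=> 0); first exact: cvg_cst.
  near=> n; rewrite addr0 mulr1.
  have n0 : 0 < n%:R :> R by rewrite ltr0n; near: n; exact: nbhs_infty_gt.
  have rr := rx_in _ n0; have [_ r0] := rr.
  have m2 := m_gt0 c_ge0 c_ex ac 2 rr.
  (* r_x' = r_x / m_2 turns n eta_1(n) into - n^2 / m_2, and n = m_1(r_n). *)
  rewrite /sigma sqr_sqrtr ?(residual_ge0 c_ge0 c_ex ac rr)//.
  rewrite /variance /residual rx_m1// /eta1 (derive1_rx c_ge0 c_ex ac rx_in rx_m1 n0).
  rewrite -[gR _ _]/(mom c 0 (rx n%:R)); congr (_ + _).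
  by field; rewrite !gt_eqF.
Unshelve. all: by end_near. Qed.
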